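(* Let $\pi:Q\to M$ be a surjective submersion, let $\mathcal H$ be an Ehresmann connection on $\pi$ with curvature $\mathcal R$, and consider the sub-Riemannian manifold $(Q,\mathcal H,\tilde{\mathbf g})$ for some metric tensor $\tilde{\mathbf g}$ on $\mathcal H$. Then an $\mathcal H$-horizontal curve $\tilde\gamma(t)$ in $Q$ is an abnormal curve if and only if there is a non-zero curve $\beta(t)\in\mathrm{Ann}(\mathcal H)_{\tilde\gamma(t)}$ such that $$\blacktriangledown_{\dot\gamma}\beta(t)=0,\qquad\beta(t)\mathcal R(\dot\gamma(t),\cdot)=0,\qquad\text{where }\gamma(t)=\pi(\tilde\gamma(t)).$$
   Context: All manifolds are smooth and connected. $\mathcal V=\ker\pi_*$; an Ehresmann connection is a subbundle $\mathcal H\subseteq TQ$ with $TQ=\mathcal H\oplus\mathcal V$, with projections $\mathrm{pr}_{\mathcal H},\mathrm{pr}_{\mathcal V}$. For $v\in T_{\pi(q)}M$, $h_qv\in\mathcal H_q$ is the unique element with $\pi_*h_qv=v$; $hX|_q=h_qX|_{\pi(q)}$. $\mathrm{Ann}(\mathcal H)\subseteq T^*Q$ is the bundle of covectors vanishing on $\mathcal H$. A curve $\tilde\gamma$ is $\mathcal H$-horizontal if it is absolutely continuous (here with $L^2$-derivative, as is the convention for sub-Riemannian manifolds) and $\dot{\tilde\gamma}(t)\in\mathcal H$ for almost every $t$. Abnormal curves: let $\sigma$ be the canonical symplectic form on $T^*Q$. An abnormal extremal of $(Q,\mathcal H,\tilde{\mathbf g})$ is an absolutely continuous curve $\tilde\lambda(t)$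 in $\mathrm{Ann}(\mathcal H)$ with $L^2$-derivative, never meeting the zero section, such that for almost every $t$, $\sigma(\dot{\tilde\lambda}(t),w)=0$ for all $w\in T_{\tilde\lambda(t)}\mathrm{Ann}(\mathcal H)$. An abnormal curve is the projection to $Q$ of an abnormal extremal. Curvature: $\mathcal R(\tilde X,\tilde Y)=\mathrm{pr}_{\mathcal V}[\mathrm{pr}_{\mathcal H}\tilde X,\mathrm{pr}_{\mathcal H}\tilde Y]$; for $\beta\in T_q^*Q$, $v\in T_{\pi(q)}M$, $\beta\mathcal R(v,\cdot)$ is $u\mapsto\beta(\mathcal R(h_qv,h_qu))$, $u\in T_{\pi(q)}M$. Parallel transport: $\blacktriangledown_XV:=[hX,V]$ for $X\in\Gamma(TM)$, $V\in\Gamma(\mathcal V)$; it is $C^\infty(M)$-linear in $X$ and induces an operator $\blacktriangledown_{\dot\gamma}$ on absolutely continuous vertical vector fields along a horizontal curve $\tilde\gamma$ projecting to $\gamma$ (Leibniz rule, and $\blacktriangledown_{\dot\gamma}(V|_{\tilde\gamma(t)})=\blacktriangledown_{\dot\gamma(t)}V|_{\tilde\gamma(t)}$). For $\beta(t)$ in $\mathrm{Ann}(\mathcal H)$ along $\tilde\gamma$ it is determined by $\frac{d}{dt}(\beta(t)V(t))=(\blacktriangledown_{\dot\gamma}\beta(t))V(t)+\beta(t)(\blacktriangledown_{\dot\gamma}V(t))$. Curves $\beta(t)$ are absolutely continuous and the equations hold for almost every $t$. *)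

(* Defs.v *)
From HB Require Import structures.
From mathcomp Require Import all_boot all_order all_algebra.
From mathcomp Require Import all_classical all_reals all_analysis.
Set Implicit Arguments.
Unset Strict Implicit.
Unset Printing Implicit Defensive.
Import Order.TTheory GRing.Theory Num.Theory.
Import numFieldNormedType.Exports.
Local Open Scope classical_set_scope.
Local Open Scope ring_scope.

Section Calculus.
Context {R : realType}.

Fixpoint Ck_on {V W : normedModType R} (k : nat) (U : set V) (f : V -> W)
    : Prop :=
  match k with
  | 0 => forall x, U x -> {for x, continuous f}
  | k'.+1 => (forall x, U x -> differentiable f x) /\
             (forall v : V, Ck_on k' U ('D_v f))
  end.

(* Only meant for open [U]. *)
Definition smooth_on {V W : normedModType R} (U : set V) (f : V -> W) : Prop :=
  forall k, Ck_on k U f.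

Definition smooth_near {V W : normedModType R} (f : V -> W) (x : V) : Prop :=
  exists2 U : set V, open_nbhs x U & smooth_on U f.

(* The open intervals ]s i, t i[ are pairwise disjoint. *)
Definition abs_continuous {V : normedModType R} (a b : R) (f : R -> V) : Prop :=
  forall e : R, 0 < e -> exists2 d : R, 0 < d &
    forall (k : nat) (s t : 'I_k -> R),
      (forall i, [/\ a <= s i, s i <= t i & t i <= b]) ->
      (forall i j, i != j -> t i <= s j \/ t j <= s i) ->
      \sum_i (t i - s i) < d -> \sum_i `|f (t i) - f (s i)| < e.

Definition L2_derivative {V : normedModType R} (a b : R) (f : R -> V) : Prop :=
  (@lebesgue_measure R).-integrable `[a, b]
    (fun t => (`|derive1 f t| ^+ 2)%:E).

Definition ae_on (a b : R) (P : R -> Prop) : Prop :=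
  {ae (@lebesgue_measure R), forall t : R, a <= t <= b -> P t}.

End Calculus.

Section Manifolds.
Variable R : realType.

Record chart (M : topologicalType) (n : nat) := Chart {
  cdom : set M;
  cmap : M -> 'rV[R]_n;
  cinv : 'rV[R]_n -> M;
  cdom_open : open cdom;
  cimg_open : open (cmap @` cdom);
  cmapK : forall q, cdom q -> cinv (cmap q) = q;
  cmap_cont : {within cdom, continuous cmap};
  cinv_cont : {within cmap @` cdom, continuous cinv} }.

(* [chart_at] is a choice of a chart around each point; it carries no
   information besides the atlas, but gives a model for the tangent spaces. *)
Record manifold := Manifold {
  carrier :> topologicalType;
  dim : nat;
  atlas : set (chart carrier dim);
  chart_at : carrier -> chart carrier dim;
  chart_at_atlas : forall q, atlas (chart_at q);
  chart_at_dom : forall q, cdom (chart_at q) q;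
  transition_smooth : forall phi psi, atlas phi -> atlas psi ->
    smooth_on (cmap phi @` (cdom phi `&` cdom psi)) (cmap psi \o cinv phi);
  manifold_hausdorff : hausdorff_space carrier;
  manifold_second_countable : @second_countable carrier;
  manifold_connected : connected [set: carrier] }.

End Manifolds.

Arguments atlas {R} m.
Arguments chart_at {R m} q.
Arguments dim {R} m.

(* The tangent space at a point q of Q is modelled on R^n by the components in
   the chart [chart_at q]; thus a section of TQ is a map Q -> tangent R Q, and
   components in any other chart at q are obtained by applying the Jacobian of
   the transition map (see [tcoord]). *)
Notation tangent R Q := 'rV[R]_(dim Q).
Notation cotangent R Q := 'Hom('rV[R]_(dim Q), R^o).

Section TangentBundle.
Context {R : realType}.
Implicit Types Q M : manifold R.

(* Components in phi of v in T_qQ, and the inverse operation. *)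
Definition tcoord Q (phi : chart R Q (dim Q)) (q : Q) (v : tangent R Q)
    : 'rV[R]_(dim Q) :=
  'd (cmap phi \o cinv (chart_at q)) (cmap (chart_at q) q) v.

Definition of_tcoord Q (phi : chart R Q (dim Q)) (q : Q) (x : 'rV[R]_(dim Q))
    : tangent R Q :=
  'd (cmap (chart_at q) \o cinv phi) (cmap phi q) x.

Definition vfield Q := Q -> tangent R Q.

Definition vrep Q (phi : chart R Q (dim Q)) (X : vfield Q)
    : 'rV[R]_(dim Q) -> 'rV[R]_(dim Q) :=
  fun x => tcoord phi (cinv phi x) (X (cinv phi x)).

(* Smoothness on some neighbourhood of q. *)
Definition smooth_vfield Q (X : vfield Q) (q : Q) : Prop :=
  smooth_near (vrep (chart_at q) X) (cmap (chart_at q) q).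

Definition smooth_fun Q (f : Q -> R) (q : Q) : Prop :=
  @smooth_near R _ R^o (f \o cinv (chart_at q)) (cmap (chart_at q) q).

(* With [X,Y]f = X(Yf) - Y(Xf). *)
Definition lie Q (X Y : vfield Q) : vfield Q := fun q =>
  let phi := chart_at q in let x := cmap phi q in
  'd (vrep phi Y) x (vrep phi X x) - 'd (vrep phi X) x (vrep phi Y x).

(* A vector field near q extending v in T_qQ, namely the one with constant
   components in [chart_at q].  It serves to evaluate at vectors operators that
   are C^oo-linear in a vector field, for which any extension would do. *)
Definition extend Q (q : Q) (v : tangent R Q) : vfield Q :=
  fun q' => of_tcoord (chart_at q) q' v.

Definition smooth_map Q M (f : Q -> M) : Prop :=
  continuous f /\
  forall q, smooth_near (cmap (chart_at (f q)) \o f \o cinv (chart_at q))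
                        (cmap (chart_at q) q).

Definition tangent_map Q M (f : Q -> M) (q : Q)
    : 'Hom('rV[R]_(dim Q), 'rV[R]_(dim M)) :=
  linfun ('d (cmap (chart_at (f q)) \o f \o cinv (chart_at q))
             (cmap (chart_at q) q)).

Definition surjective_submersion Q M (pi : Q -> M) : Prop :=
  [/\ smooth_map pi, (forall x, exists q, pi q = x)
    & forall q, limg (tangent_map pi q) = fullv].

Definition subbundle Q (H : Q -> {vspace tangent R Q}) : Prop :=
  forall q, exists (U : set Q) (k : nat) (X : 'I_k -> vfield Q),
    [/\ open_nbhs q U,
        (forall i q', U q' -> smooth_vfield (X i) q')
      & (forall q', U q' -> basis_of (H q') [seq X i q' | i : 'I_k])].

End TangentBundle.

Section SubRiemannian.
Context {R : realType}.
Implicit Types Q : manifold R.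

Definition metric_tensor Q (H : Q -> {vspace tangent R Q})
    (g : Q -> tangent R Q -> tangent R Q -> R) : Prop :=
  [/\ (forall q c u v w, u \in H q -> v \in H q -> w \in H q ->
        g q (c *: u + v) w = c * g q u w + g q v w),
      (forall q u v, u \in H q -> v \in H q -> g q u v = g q v u),
      (forall q u, u \in H q -> u != 0 -> 0 < g q u u)
    & (forall q (X Y : vfield Q),
        smooth_vfield X q -> smooth_vfield Y q ->
        (\forall q' \near q, X q' \in H q' /\ Y q' \in H q') ->
        smooth_fun (fun q' => g q' (X q') (Y q')) q)].

(* Bracket-generation is not assumed. *)
Record subRiemannian Q := SubRiemannian {
  hdistr : Q -> {vspace tangent R Q};
  hdistr_subbundle : subbundle hdistr;
  hmetric : Q -> tangent R Q -> tangent R Q -> R;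
  hmetricP : metric_tensor hdistr hmetric }.

End SubRiemannian.

Section Curves.
Context {R : realType}.
Implicit Types (Q : manifold R) (a b t : R).

(* Quantification over the pieces of a curve lying in a single chart. *)
Definition chartwise Q a b (gamma : R -> Q)
    (P : chart R Q (dim Q) -> R -> R -> Prop) : Prop :=
  forall phi, atlas Q phi ->
  forall c d, a <= c -> c <= d -> d <= b ->
    (forall t, c <= t <= d -> cdom phi (gamma t)) -> P phi c d.

Definition ac_L2_curve Q a b (gamma : R -> Q) : Prop :=
  {within `[a, b], continuous gamma} /\
  chartwise a b gamma (fun phi c d =>
    abs_continuous c d (cmap phi \o gamma) /\
    L2_derivative c d (cmap phi \o gamma)).

Definition velocity Q (gamma : R -> Q) t : tangent R Q :=
  derive1 (cmap (chart_at (gamma t)) \o gamma) t.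

Definition horizontal_curve Q (H : Q -> {vspace tangent R Q}) a b
    (gamma : R -> Q) : Prop :=
  ac_L2_curve a b gamma /\
  ae_on a b (fun t => velocity gamma t \in H (gamma t)).

Definition ac_vfield_along Q a b (gamma : R -> Q) (V : R -> tangent R Q)
    : Prop :=
  chartwise a b gamma (fun phi c d =>
    abs_continuous c d (fun t => tcoord phi (gamma t) (V t))).

(* The i-th component of a covector in phi is its value on the i-th coordinate
   vector. *)
Definition ccoord Q (phi : chart R Q (dim Q)) (q : Q) (beta : cotangent R Q)
    : 'rV[R]_(dim Q) :=
  \row_i (beta (of_tcoord phi q (delta_mx 0 i)) : R).

Definition ac_covector_along Q a b (gamma : R -> Q) (beta : R -> cotangent R Q)
    : Prop :=
  chartwise a b gamma (fun phi c d =>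
    abs_continuous c d (fun t => ccoord phi (gamma t) (beta t))).

(* The fibre of Ann(H) at q. *)
Definition Ann Q (H : Q -> {vspace tangent R Q}) (q : Q) : set (cotangent R Q) :=
  [set beta | forall v, v \in H q -> beta v = 0].

End Curves.

Section AbnormalCurves.
Context {R : realType}.
Variable Q : manifold R.
Implicit Types (a b t : R) (S : subRiemannian Q).

Definition cotangent_bundle : Type := (Q * cotangent R Q)%type.

(* Canonical coordinates (x, p) on T^*Q. *)
Definition canonical (phi : chart R Q (dim Q)) (lam : cotangent_bundle)
    : 'rV[R]_(dim Q) * 'rV[R]_(dim Q) :=
  (cmap phi lam.1, ccoord phi lam.1 lam.2).

(* The form sum_i dx_i /\ dp_i on T_lam T^*Q, the elements of which are
   represented by their components in canonical coordinates. *)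
Definition sympl (v w : 'rV[R]_(dim Q) * 'rV[R]_(dim Q)) : R :=
  \sum_i (v.1 0 i * w.2 0 i - v.2 0 i * w.1 0 i).

(* T_lam Ann(H): the velocities at lam of smooth curves in Ann(H), in the
   canonical coordinates of [chart_at lam.1]. *)
Definition tangent_Ann (H : Q -> {vspace tangent R Q}) (lam : cotangent_bundle)
    : set ('rV[R]_(dim Q) * 'rV[R]_(dim Q)) :=
  let phi := chart_at lam.1 in
  [set w | exists c : R -> cotangent_bundle,
    [/\ c 0 = lam,
        (\forall s \near (0 : R),
           cdom phi (c s).1 /\ Ann H (c s).1 (c s).2),
        @smooth_near R R^o _ (canonical phi \o c) 0
      & w = derive1 (canonical phi \o c) 0]].

Definition cotangent_velocity (lam : R -> cotangent_bundle) t
    : 'rV[R]_(dim Q) * 'rV[R]_(dim Q) :=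
  derive1 (canonical (chart_at (lam t).1) \o lam) t.

Definition cotangent_ac_L2 a b (lam : R -> cotangent_bundle) : Prop :=
  {within `[a, b], continuous (fst \o lam)} /\
  chartwise a b (fst \o lam) (fun phi c d =>
    abs_continuous c d (canonical phi \o lam) /\
    L2_derivative c d (canonical phi \o lam)).

Definition abnormal_extremal S a b (lam : R -> cotangent_bundle) : Prop :=
  let H := hdistr S in
  [/\ cotangent_ac_L2 a b lam,
      (forall t, a <= t <= b -> Ann H (lam t).1 (lam t).2),
      (forall t, a <= t <= b -> (lam t).2 != 0)
    & ae_on a b (fun t => forall w, tangent_Ann H (lam t) w ->
        sympl (cotangent_velocity lam t) w = 0)].

Definition abnormal_curve S a b (gamma : R -> Q) : Prop :=
  exists2 lam : R -> cotangent_bundle, abnormal_extremal S a b lam &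
    forall t, a <= t <= b -> (lam t).1 = gamma t.

End AbnormalCurves.

Section Ehresmann.
Context {R : realType}.
Variables (Q M : manifold R) (pi : Q -> M) (H : Q -> {vspace tangent R Q}).

Definition vertical (q : Q) : {vspace tangent R Q} := lker (tangent_map pi q).

Definition ehresmann_connection : Prop :=
  [/\ subbundle H,
      (forall q, (H q + vertical q)%VS = fullv)
    & (forall q, (H q :&: vertical q)%VS = 0%VS)].

Definition prH (q : Q) (v : tangent R Q) : tangent R Q :=
  daddv_pi (H q) (vertical q) v.
Definition prV (q : Q) (v : tangent R Q) : tangent R Q :=
  daddv_pi (vertical q) (H q) v.

(* The horizontal part of any preimage of v; see [hlift_unique]. *)
Definition hlift (q : Q) (v : tangent R M) : tangent R Q :=
  prH q ((tangent_map pi q)^-1%VF v).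

Definition hlift_vfield (X : vfield M) : vfield Q :=
  fun q => hlift q (X (pi q)).

Definition curvature (X Y : vfield Q) : vfield Q := fun q =>
  prV q (lie (fun q' => prH q' (X q')) (fun q' => prH q' (Y q')) q).

Definition curvature_at (q : Q) (v w : tangent R Q) : tangent R Q :=
  curvature (extend q v) (extend q w) q.

(* The covector beta R(v, .) on T_(pi q) M. *)
Definition covector_curvature (q : Q) (beta : cotangent R Q) (v : tangent R M)
    (u : tangent R M) : R :=
  beta (curvature_at q (hlift q v) (hlift q u)).

Definition transport (X : vfield M) (V : vfield Q) : vfield Q :=
  lie (hlift_vfield X) V.

Definition transport_at (q : Q) (v : tangent R M) (V : vfield Q) : tangent R Q :=
  transport (extend (pi q) v) V q.

(* [transport_along gamma V t W] means that W is the transport derivative at t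
   of the vertical field V along gamma: V being a combination of restrictions
   to gamma of vertical fields E i on Q, W is given by the Leibniz rule. *)
Definition transport_along (gamma : R -> Q) (V : R -> tangent R Q) (t : R)
    (W : tangent R Q) : Prop :=
  exists (k : nat) (E : 'I_k -> vfield Q) (f : 'I_k -> R -> R),
    [/\ (forall i, smooth_vfield (E i) (gamma t) /\
           \forall q \near gamma t, E i q \in vertical q),
        (forall i, derivable (f i) t 1),
        (\forall s \near t, V s = \sum_i f i s *: E i (gamma s))
      & W = \sum_i (derive1 (f i) t *: E i (gamma t) +
                    f i t *: transport_at (gamma t)
                               (velocity (pi \o gamma) t) (E i))].

(* alpha is the transport derivative of the curve beta in Ann(H) along
   gamma. *)
Definition cotransport_along (a b : R) (gamma : R -> Q)
    (beta alpha : R -> cotangent R Q) : Prop :=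
  (forall t, a <= t <= b -> Ann H (gamma t) (alpha t)) /\
  forall V : R -> tangent R Q,
    (forall t, a <= t <= b -> V t \in vertical (gamma t)) ->
    ac_vfield_along a b gamma V ->
    ae_on a b (fun t => forall W, transport_along gamma V t W ->
      @is_derive R R^o R^o t 1 (fun s => beta s (V s))
        (alpha t (V t) + beta t W)).

Lemma hliftP q v : ehresmann_connection -> limg (tangent_map pi q) = fullv ->
  hlift q v \in H q /\ tangent_map pi q (hlift q v) = v.
Proof.
move=> [_ HV HV0] surj; split; first exact: memv_pi.
have := daddv_pi_add (HV0 q) (w := (tangent_map pi q)^-1%VF v).
rewrite HV memvf => /(_ isT) e.
rewrite -[RHS](@limg_lfunVK _ _ _ (tangent_map pi q)) ?surj ?memvf //.
rewrite -[in RHS]e linearD /=.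
have /eqP-> : tangent_map pi q
    (daddv_pi (vertical q) (H q) ((tangent_map pi q)^-1%VF v)) == 0.
  by rewrite -memv_ker memv_pi.
by rewrite addr0.
Qed.

Lemma hlift_unique q v w : ehresmann_connection ->
  limg (tangent_map pi q) = fullv ->
  w \in H q -> tangent_map pi q w = v -> w = hlift q v.
Proof.
move=> EH surj wH wv; have [hH hv] := hliftP v EH surj.
have [_ _ HV0] := EH.
apply/eqP; rewrite -subr_eq0 -memv0 -(HV0 q) memv_cap memvB //=.
by rewrite memv_ker linearB /= wv hv subrr.
Qed.

End Ehresmann.

(* Main.v *)
Require Import Defs.
From HB Require Import structures.
From mathcomp Require Import all_boot all_order all_algebra.
From mathcomp Require Import all_classical all_reals all_analysis.
From mathcomp Require Import measurable_realfun ring lra.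
Set Implicit Arguments.
Unset Strict Implicit.
Unset Printing Implicit Defensive.
Import Order.TTheory GRing.Theory Num.Theory.
Import numFieldNormedType.Exports.
Local Open Scope classical_set_scope.
Local Open Scope ring_scope.

(** Fix a chart, let x(t) be the coordinates of the horizontal curve, p(t) those
    of a covector curve in Ann(H) over it, and P(y) the matrix of the projection
    onto the vertical space.  All conditions of the theorem are compared, at
    almost every t, with the linear equation
<<
      p'(t) v = p(t) (D_v P)(x(t)) x'(t)      for all v.
>>
    Since Ann(H) is the set of the (y, p) with
    p = p P(y), its tangent vectors at (x, p) are the (v, r) with
    r = r P + p D_v P; evaluating the symplectic form on them gives the equation.
    On a vertical v it expresses that p is parallel, because differentiating
    P hX = 0 yields p D_v(hX) = - p (D_v P) hX; on a horizontal v it expresses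
    that p R(x', v) = 0, because the bracket of the fields (1 - P) u and
    (1 - P) v is (D_v P) u - (D_u P) v for horizontal u, v.

    The equation entails |p'| <= K |x'| |p|, so that p either vanishes
    identically or never vanishes, and p' is square integrable as x' is. *)

(** * Absolutely continuous functions *)

(** Three obstacles lie between the pointwise equation and the theorem. The transport condition
    quantifies over vertical fields along the curve before it discards a null set, so this set may
    vary with the field. The condition is therefore tested, on each piece of the curve in a chart,
    on finitely many fields: the vertical projections of the coordinate vectors times a cut-off that
    vanishes at the ends of the piece and can be divided out inside. Next, tangent spaces are
    modelled in [chart_at (gamma t)], a chart that jumps with t, whereas an estimate over an
    interval needs a fixed one. The equation is not visibly invariant; its transfer between charts
    uses p = p P, x' P = 0 and the symmetry of the second derivatives of transition maps. Finally,
    absolute continuity is the epsilon-delta notion, so derivatives almost everywhere and the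
    integral formula have to be extracted from it, by way of a Radon-Nikodym density. *)

Lemma interval_ind (R : realType) (P : R -> R -> Prop) (a b : R) : a <= b ->
  (forall c d e, a <= c -> c <= d -> d <= e -> e <= b -> P c d -> P d e -> P c e) ->
  (forall t, a <= t <= b -> exists2 r : R, 0 < r &
    forall c d, a <= c -> c <= d -> d <= b -> `|c - t| < r -> `|d - t| < r ->
      P c d) ->
  P a b.
Proof.
move=> ab Pcat Ploc.
(* A Heine-Borel argument by supremum. [P] is not assumed to pass to subintervals, so [E] records it
   on every initial segment; the local property at [sup E] then leads beyond [sup E] unless [b] is
   reached. *)
pose E := [set x | a <= x <= b /\ forall y, a <= y <= x -> P a y].
have Ea : E a.
  split=> [|y /andP[ay ya]]; first by rewrite lexx.
  have -> : y = a by apply/le_anti/andP.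
  have [|r r0 Pr] := Ploc a; first by rewrite lexx.
  by apply: Pr => //; rewrite subrr normr0.
have ubE : ubound E b by move=> x [/andP[]].
have supE : has_sup E by split; [exists a|exists b].
have as' : a <= sup E by apply: ub_le_sup => //; exists b.
have sb : sup E <= b by apply: ge_sup => //; exists a.
have [|r r0 Pr] := Ploc (sup E); first by rewrite as'.
have [x [/andP[ax xb] Ex] xs] : exists2 x, E x & sup E - r < x.
  by have [x] := sup_adherent r0 supE; exists x.
have xs' : x <= sup E.
  by apply: ub_le_sup; [exists b|split => //; rewrite ax].
have Pa_ y : a <= y <= b -> y < sup E + r -> P a y.
  move=> /andP[ay yb] yr; have [yx|xy] := leP y x; first by apply: Ex; rewrite ay.
  apply: (Pcat _ x) => //; first exact: ltW.
    by apply: Ex; rewrite ax lexx.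
  apply: Pr => //; first exact: ltW.
    by rewrite ler0_norm ?subr_le0// opprB; lra.
  by rewrite ltr_norml; apply/andP; split; lra.
apply: (Pa_); first by rewrite ab lexx.
rewrite ltNge; apply/negP => sbr.
have r2 : sup E + r / 2 < sup E + r by lra.
have asr : a <= sup E + r / 2 <= b by apply/andP; split; lra.
suff : E (sup E + r / 2).
  move=> /(ub_le_sup (proj2 supE)); rewrite gerDl leNgt.
  by move=> /negP; apply; rewrite divr_gt0.
split=> // y /andP[ay yr]; apply: Pa_; last exact: le_lt_trans yr r2.
by rewrite ay (le_trans yr)//; case/andP: asr.
Qed.

Section AbsContinuous.
Context {R : realType}.
Implicit Types (V W : normedModType R) (a b c d : R).

(** Allows a sigma type as index, as when every interval of a family is itself subdivided. *)
Lemma ac_finType V a b (f : R -> V) : abs_continuous a b f ->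
  forall e : R, 0 < e -> exists2 d : R, 0 < d &
    forall (T : finType) (s t : T -> R),
      (forall i, [/\ a <= s i, s i <= t i & t i <= b]) ->
      (forall i j, i != j -> t i <= s j \/ t j <= s i) ->
      \sum_i (t i - s i) < d -> \sum_i `|f (t i) - f (s i)| < e.
Proof.
move=> acf e e0; have [d d0 df] := acf e e0; exists d => // T s t st dis std.
have := df #|T| (s \o enum_val) (t \o enum_val).
have E (F : T -> R) : \sum_i F i = \sum_(i < #|T|) F (enum_val i).
  by rewrite (reindex (@enum_val _ T)) //; exact/onW_bij/enum_val_bij.
rewrite (E (fun i => t i - s i)) in std.
rewrite (E (fun i => `|f (t i) - f (s i)|)).
apply=> [i|i j ij|//]; first exact: st.
apply: dis.
by apply: contra_neq ij; apply: enum_val_inj.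
Qed.

Lemma ac_sub V a b c d (f : R -> V) : a <= c -> d <= b ->
  abs_continuous a b f -> abs_continuous c d f.
Proof.
move=> ac db acf e e0; have [r r0 rf] := acf e e0; exists r => // k s t st.
apply: rf => i; have [? ? ?] := st i.
by split=> //; [apply: le_trans ac _|apply: le_trans db].
Qed.

(** The common source of the closure properties below: dominated increments inherit the modulus of
    absolute continuity. *)
Lemma ac_dom V1 V2 W a b (f : R -> V1) (g : R -> V2) (h : R -> W) (K : R) :
  (forall s t, a <= s -> s <= t -> t <= b ->
    `|h t - h s| <= K * (`|f t - f s| + `|g t - g s|)) ->
  abs_continuous a b f -> abs_continuous a b g -> abs_continuous a b h.
Proof.
move=> hK acf acg e e0.
(* [K] may be zero or negative; [C] is a positive bound for it, and each of [f] and [g] is granted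
   the error [e / (2 * C)]. *)
pose C := `|K| + 1.
have C0 : 0 < C by rewrite ltr_wpDl.
have e1 : 0 < e / (2 * C) by rewrite divr_gt0// mulr_gt0.
have [r1 r10 rf] := acf _ e1; have [r2 r20 rg] := acg _ e1.
exists (Num.min r1 r2); first by rewrite lt_min r10.
move=> k s t st dis; rewrite lt_min => /andP[/(rf k s t st dis) Hf].
move=> /(rg k s t st dis) Hg.
apply: (@le_lt_trans _ _ (\sum_i C * (`|f (t i) - f (s i)| + `|g (t i) - g (s i)|))).
  apply: ler_sum => i _; have [? ? ?] := st i.
  apply: (le_trans (hK _ _ _ _ _)) => //; apply: ler_wpM2r; first exact: addr_ge0.
  by rewrite /C; have := ler_norm K; lra.
rewrite -mulr_sumr big_split /= -ltr_pdivlMl//.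
apply: (lt_le_trans (ltrD Hf Hg)).
suff -> : C^-1 * e = e / (2 * C) + e / (2 * C) by [].
by field; rewrite gt_eqF.
Qed.

Lemma ac_dom1 V W a b (f : R -> V) (h : R -> W) (K : R) :
  (forall s t, a <= s -> s <= t -> t <= b -> `|h t - h s| <= K * `|f t - f s|) ->
  abs_continuous a b f -> abs_continuous a b h.
Proof.
move=> hK acf; apply: (@ac_dom _ _ _ _ _ f f _ (K / 2)) => // s t sa st tb.
apply: (le_trans (hK _ _ _ _ _)) => //.
by rewrite [leRHS](_ : _ = K * `|f t - f s|)//; field.
Qed.

Lemma ac_ext V a b (f g : R -> V) : (forall t, a <= t <= b -> f t = g t) ->
  abs_continuous a b f -> abs_continuous a b g.
Proof.
move=> fg; apply: (@ac_dom1 _ _ _ _ _ _ 1) => s t sa st tb.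
by rewrite mul1r !fg// ?sa ?tb ?(le_trans st)// (le_trans sa).
Qed.

Lemma ac_cst V a b (v : V) : abs_continuous a b (fun=> v).
Proof.
move=> e e0; exists 1 => // k s t _ _ _.
by rewrite big1// => i _; rewrite subrr normr0.
Qed.

Lemma ac_id a b : @abs_continuous R R^o a b id.
Proof.
move=> e e0; exists e => // k s t st _; apply: le_lt_trans.
by apply: ler_sum => i _; have [_ ? _] := st i; rewrite ger0_norm// subr_ge0.
Qed.

Lemma ac_cat V a c b (f : R -> V) : a <= c -> c <= b ->
  abs_continuous a c f -> abs_continuous c b f -> abs_continuous a b f.
Proof.
move=> ac cb f1 f2 e e0.
have e2 : 0 < e / 2 by rewrite divr_gt0.
have [r1 r10 rf] := f1 _ e2; have [r2 r20 rg] := f2 _ e2.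
exists (Num.min r1 r2); first by rewrite lt_min r10.
move=> k s t st dis; rewrite lt_min => /andP[tr1 tr2].
(* The maps [m] and [M] cut every interval at [c]; an interval on one side of [c] has a single point
   as one of its two images. *)
pose m x := Num.min x c; pose M x := Num.max x c.
have mh x y : x <= y -> m x <= m y.
  by move=> xy; rewrite /m /Num.min; do 2?case: ltP => ? //; lra.
have Mh x y : x <= y -> M x <= M y.
  by move=> xy; rewrite /M /Num.max; do 2?case: ltP => ? //; lra.
have Hf : \sum_i `|f (m (t i)) - f (m (s i))| < e / 2.
  apply: rf => [i|i j ij|]; last first.
  - apply: le_lt_trans tr1; apply: ler_sum => i _; have [_ + _] := st i.
    by rewrite /m /Num.min; do 2?case: ltP => ? //; lra.
  - by case: (dis i j ij) => /mh; [left|right].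
  have [? ? ?] := st i; split; last by rewrite /m ge_min lexx orbT.
    by rewrite /m le_min ac andbT.
  exact: mh.
have Hg : \sum_i `|f (M (t i)) - f (M (s i))| < e / 2.
  apply: rg => [i|i j ij|]; last first.
  - apply: le_lt_trans tr2; apply: ler_sum => i _; have [_ + _] := st i.
    by rewrite /M /Num.max; do 2?case: ltP => ? //; lra.
  - by case: (dis i j ij) => /Mh; [left|right].
  have [? ? ?] := st i; split; first by rewrite /M le_max lexx orbT.
    exact: Mh.
  by rewrite /M ge_max cb andbT.
apply: (@le_lt_trans _ _ (\sum_i (`|f (m (t i)) - f (m (s i))| +
   `|f (M (t i)) - f (M (s i))|))).
  apply: ler_sum => i _; have [_ sti _] := st i.
  rewrite /m /M /Num.min /Num.max; case: ltP => tc; case: ltP => sc.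
  - by rewrite subrr normr0 addr0.
  - by lra.
  - rewrite -[f (t i) - f (s i)](subrKA (f c)) addrC.
    by rewrite (le_trans (ler_normD _ _))// addrC.
  - by rewrite subrr normr0 add0r.
by rewrite big_split/= (splitr e) ltrD.
Qed.

Lemma ac_continuous_at V a b (f : R -> V) t : abs_continuous a b f ->
  a <= t <= b -> forall e : R, 0 < e -> exists2 d : R, 0 < d &
  forall s, a <= s <= b -> `|s - t| < d -> `|f s - f t| < e.
Proof.
move=> acf /andP[at' tb] e e0; have [d d0 df] := acf e e0; exists d => // s.
move=> /andP[as' sb] std.
have := df 1 (fun=> Num.min s t) (fun=> Num.max s t).
rewrite !big_ord1 /Num.min /Num.max => H.
have [st|ts] := ltP s t.
  rewrite st in H; rewrite distrC; apply: H.
  - by move=> _; split => //; exact: ltW.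
  - by move=> i j; rewrite !ord1.
  - by apply: le_lt_trans std; rewrite distrC ler_norm.
rewrite ltNge ts /= in H; apply: H.
- by move=> _; split.
- by move=> i j; rewrite !ord1.
- by apply: le_lt_trans std; rewrite ler_norm.
Qed.


End AbsContinuous.

(** * Differentiation almost everywhere of absolutely continuous functions *)

Section AcFTC.
Context {R : realType}.
Implicit Types (a b c d t : R) (f : R -> R).
Notation mu := (@lebesgue_measure R).
Notation TV := total_variation.
Notation AC := (@abs_continuous R R^o).

Lemma itv_partition_nth_mono x0 a b (s : seq R) m n : itv_partition a b s ->
  (m <= n <= size s)%N -> nth x0 (a :: s) m <= nth x0 (a :: s) n.
Proof.
move=> [px _] /andP[mn ns].
have : sorted <=%R (a :: s) by apply: (sub_path _ px) => ? ?; exact: ltW.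
move=> /(sorted_leq_nth le_trans lexx x0); apply => //.
by rewrite inE /= ltnS (leq_trans mn).
Qed.

(** On an interval shorter than the [d] that belongs to the error 1, every partition has total
    length below [d] and hence variation below 1. Such intervals are glued. *)
Lemma ac_bounded_variation a b f : a <= b -> AC a b f -> bounded_variation a b f.
Proof.
move=> ab acf; apply: (@interval_ind R (fun c d => bounded_variation c d f)) => //.
  move=> c d e ac cd de eb /(bounded_variationP _ cd) cdf.
  move=> /(bounded_variationP _ de) def.
  apply/(bounded_variationP _ (le_trans cd de)).
  by rewrite (total_variationD f cd de) fin_numD cdf.
have [d d0 df] := acf 1 ltr01.
move=> t /andP[at' tb]; exists (d / 2); first by rewrite divr_gt0.
move=> x y ax xy yb xt yt; exists 1 => _ [s ps <-].
rewrite /variation big_mkord.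
apply/ltW/(df (size s) (fun i => nth y (x :: s) i)
  (fun i => nth y (x :: s) i.+1)) => [i|i j ij|].
- have isz := ltn_ord i; split.
  + by apply: (le_trans ax); apply: itv_partition_nth_ge => //; rewrite ltnW.
  + by apply: (nondecreasing_fun_itv_partition (f := id) _ ps isz).
  + by apply: le_trans yb; apply: itv_partition_nth_le.
- wlog : i j ij / (i < j)%N.
    move=> H; have /orP[/H|/H] : (i < j)%N || (j < i)%N by rewrite -neq_ltn.
      exact.
    by move=> /(_ _)/or_comm; apply; rewrite eq_sym.
  move=> {}ij; left; apply: (itv_partition_nth_mono _ ps).
  by rewrite ij /= ltnW.
have -> : \sum_(i < size s) (nth y (x :: s) i.+1 - nth y (x :: s) i) = y - x.
  rewrite -(big_mkord xpredT (fun i => nth y (x :: s) i.+1 - nth y (x :: s) i)).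
  rewrite telescope_sumr//.
  by rewrite (itv_partition_nth_size y ps).
by move: xt yt; rewrite !ltr_norml => /andP[? ?] /andP[? ?]; lra.
Qed.

(** Each interval of a disjoint family is partitioned so finely that its total variation is nearly
    attained. All the pieces together form a disjoint family of the same total length, to which the
    absolute continuity of [f] applies. *)
Lemma ac_total_variation a b f : a <= b -> AC a b f ->
  AC a b (fun t => fine (TV a t f)).
Proof.
move=> ab acf e e0; have bvf := ac_bounded_variation ab acf.
have bv c d : a <= c -> c <= d -> d <= b -> TV c d f \is a fin_num.
  move=> ac cd db; apply/bounded_variationP => //.
  exact: (bounded_variationl cd db (bounded_variationr ac (le_trans cd db) bvf)).
have e2 : 0 < e / 2 by rewrite divr_gt0.
have [d d0 df] := ac_finType acf e2.
exists d => // k s t st dis std.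
have E i : `|fine (TV a (t i) f) - fine (TV a (s i) f)| = fine (TV (s i) (t i) f).
  have [ai sti tb] := st i.
  rewrite (total_variationD f ai sti) fineD ?bv//; last exact: le_trans tb.
  by rewrite addrC addKr ger0_norm// fine_ge0// total_variation_ge0.
under eq_bigr do rewrite E.
have [k0|k0] := posnP k; first by subst k; rewrite big_ord0.
(* The [k] approximation errors add up to [e / 2]; the other half is left for the pieces. *)
pose eta := e / 2 / k%:R.
have eta0 : 0 < eta by rewrite divr_gt0// ltr0n.
have /choice[S HS] : forall i, exists S : seq R, itv_partition (s i) (t i) S /\
    fine (TV (s i) (t i) f) <= variation (s i) (t i) f S + eta.
  move=> i; have [ai sti tb] := st i.
  have [sti'|->] : s i < t i \/ s i = t i.
    by move: sti; rewrite le_eqVlt => /orP[/eqP|]; [right|left].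
    have := bv _ _ ai sti tb; rewrite /TV => /ub_ereal_sup_adherent.
    move=> /(_ eta eta0)[_ [_ [S pS <-] <-]].
    rewrite -/(TV (s i) (t i) f) -(fineK (bv _ _ ai sti tb)) -EFinB lte_fin => H.
    by exists S; split => //; rewrite -lerBlDr ltW.
  exists [::]; split; first by split.
  by rewrite total_variationxx /variation big_nil add0r ltW.
apply: (@le_lt_trans _ _ (\sum_i (variation (s i) (t i) f (S i) + eta))).
  by apply: ler_sum => i _; case: (HS i).
rewrite big_split/= sumr_const card_ord (splitr e).
rewrite -[eta *+ k]mulr_natr divfK; last by rewrite pnatr_eq0 -lt0n.
rewrite ltrD2r.
(* One index for the pieces of all partitions; [tag x] is the interval that piece [x] subdivides. *)
pose T := {i : 'I_k & 'I_(size (S i))}.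
pose u (x : T) := nth (t (tag x)) (s (tag x) :: S (tag x)) (tagged x).
pose v (x : T) := nth (t (tag x)) (s (tag x) :: S (tag x)) (tagged x).+1.
have P i : itv_partition (s i) (t i) (S i) by case: (HS i).
have su x : s (tag x) <= u x.
  exact: (itv_partition_nth_ge (ltnW (ltn_ord (tagged x) : (_ < _)%N)) (P _)).
have uv x : u x <= v x.
  by apply: (nondecreasing_fun_itv_partition (f := id) _ (P _) (ltn_ord (tagged x))).
have vt x : v x <= t (tag x).
  exact: (itv_partition_nth_le (ltn_ord (tagged x) : (_.+1 < _.+1)%N) (P _)).
have -> : \sum_i variation (s i) (t i) f (S i) = \sum_x `|f (v x) - f (u x)|.
  under eq_bigr do rewrite /variation big_mkord.
  rewrite (sig_big_dep _ _ (fun i (j : 'I_(size (S i))) =>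
    `|f (nth (t i) (s i :: S i) j.+1) - f (nth (t i) (s i :: S i) j)|)) //=.
apply: df => [x|x y xy|].
- have [ai sti tb] := st (tag x); split => //; first exact: le_trans (su x).
  exact: le_trans (vt x) tb.
- have [xyt|xyt] := eqVneq (tag x) (tag y); last first.
    by case: (dis _ _ xyt) => H; [left|right];
      [apply: (le_trans (vt x)); apply: (le_trans H)
      |apply: (le_trans (vt y)); apply: (le_trans H)].
  case: x y xyt xy => [i p] [i' q] /= ii; subst i' => pq.
  have {}pq : p != q by apply: contra_neq pq => ->.
  rewrite /u /v /=.
  wlog : p q pq / (p < q)%N.
    move=> H; have /orP[/H|/H] : (p < q)%N || (q < p)%N by rewrite -neq_ltn.
      exact.
    by move=> /(_ _)/or_comm; apply; rewrite eq_sym.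
  move=> {}pq; left; apply: (@itv_partition_nth_mono _ _ _ _ p.+1 q (P i)).
  by rewrite pq /= ltnW.
apply: le_lt_trans std.
have -> : \sum_x (v x - u x) = \sum_i \sum_(j < size (S i))
    (nth (t i) (s i :: S i) j.+1 - nth (t i) (s i :: S i) j).
  by rewrite (sig_big_dep _ _ (fun i (j : 'I_(size (S i))) =>
    nth (t i) (s i :: S i) j.+1 - nth (t i) (s i :: S i) j)).
apply: ler_sum => i _.
rewrite -(big_mkord xpredT (fun j => nth (t i) (s i :: S i) j.+1 - nth (t i) (s i :: S i) j)).
by rewrite telescope_sumr// (itv_partition_nth_size _ (P i)).
Qed.

(** The expression is the retraction of the line onto [[a, b]], monotone and 1-Lipschitz.
    Composition with it extends a function on [[a, b]] by constants to the whole line. *)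
Lemma clamp_bounds a b t : a <= b ->
  a <= Num.max a (Num.min t b) /\ Num.max a (Num.min t b) <= b.
Proof.
move=> ab; rewrite /Num.min; case: ltP => tb; rewrite /Num.max; case: ltP => ?;
by split => //; lra.
Qed.

Lemma clampE a b t : a <= t <= b -> Num.max a (Num.min t b) = t.
Proof.
move=> /andP[at' tb]; rewrite /Num.min; case: ltP => tb'; rewrite /Num.max;
by case: ltP => ?; lra.
Qed.

Lemma clamp_homo a b s t : s <= t ->
  Num.max a (Num.min s b) <= Num.max a (Num.min t b).
Proof.
move=> st; rewrite /Num.min; case: ltP => tb; case: ltP => sb;
by rewrite /Num.max; do 2?case: ltP => ?; lra.
Qed.

Lemma clamp_lip a b s t : s <= t ->
  Num.max a (Num.min t b) - Num.max a (Num.min s b) <= t - s.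
Proof.
move=> st; rewrite /Num.min; case: ltP => tb; case: ltP => sb;
by rewrite /Num.max; do 2?case: ltP => ?; lra.
Qed.

Lemma clamp_dist a b s t :
  `|Num.max a (Num.min t b) - Num.max a (Num.min s b)| <= `|t - s|.
Proof.
wlog st : s t / s <= t.
  by move=> H; have /orP[/H //|/H] := le_total s t; rewrite distrC [leRHS]distrC.
by rewrite !ger0_norm ?subr_ge0 ?clamp_lip ?clamp_homo.
Qed.

(** Meant for the components of an open set of small measure. An interval contains the segment
    between any two of its points, so its measure controls its diameter. *)
Lemma interval_mu_bounds (I : set R) (r : R) : is_interval I -> I !=set0 ->
  measurable I -> (mu I < r%:E)%E ->
  [/\ has_lbound I, has_ubound I & ((sup I - inf I)%:E <= mu I)%E].
Proof.
move=> itvI [x0 Ix0] mI muI.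
have D x y : I x -> I y -> x <= y -> ((y - x)%:E <= mu I)%E.
  move=> Ix Iy xy; have : (mu `[x, y]%classic <= mu I)%E.
    apply: le_measure; rewrite ?inE//= => z /=; rewrite in_itv/= => xzy.
    exact: (itvI x y Ix Iy z xzy).
  rewrite lebesgue_measure_itv /= lte_fin; case: ltP => // yx.
  by rewrite (le_anti (introT andP (conj xy yx))) subrr.
have D' x y : I x -> I y -> x <= y -> y - x < r.
  by move=> Ix Iy xy; rewrite -lte_fin; apply: le_lt_trans muI; exact: D.
have lbI : has_lbound I.
  exists (x0 - r) => y Iy; have [yx|xy] := leP y x0.
    by have := D' _ _ Iy Ix0 yx; lra.
  by have := D' _ _ Ix0 Ix0 (lexx _); lra.
have ubI : has_ubound I.
  exists (x0 + r) => y Iy; have [yx|xy] := leP y x0.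
    by have := D' _ _ Ix0 Ix0 (lexx _); lra.
  by have := D' _ _ Ix0 Iy (ltW xy); lra.
split => //.
have fmu : mu I \is a fin_num.
  by rewrite ge0_fin_numE// (lt_trans muI)// ltry.
rewrite -(fineK fmu) lee_fin lerBlDr; apply: ge_sup; first by exists x0.
move=> y Iy; rewrite -lerBlDl; apply: lb_le_inf; first by exists x0.
move=> x Ix; rewrite lerBlDl -lerBlDr.
have [xy|/ltW yx] := leP x y.
  by rewrite -lee_fin fineK// D.
by rewrite (@le_trans _ _ 0)// ?subr_le0// fine_ge0.
Qed.

(** Outer regularity encloses the null set in an open [U] of measure below the [d] of absolute
    continuity. The components of [U] are disjoint intervals, and the increments of [f] over any
    finite number of them sum to less than [e]; in the limit the measure of [U] is at most [e]. *)
Lemma ac_monotone_dominates a b f (F : cumulative R R) : a <= b ->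
  F =1 (fun t => f (Num.max a (Num.min t b))) ->
  AC a b f -> forall A : set R, measurable A -> mu A = 0%E ->
  lebesgue_stieltjes_measure F A = 0%E.
Proof.
move=> ab FE acf A mA A0.
pose nu := lebesgue_stieltjes_measure F.
have nuE x y : x <= y -> nu `]x, y]%classic = (F y - F x)%:E.
  move=> xy; rewrite /nu /lebesgue_stieltjes_measure /measure_extension.
  by rewrite measurable_mu_extE/= ?wlength_itv_bnd//; exact: is_ocitv.
have leM (X Y : set R) : measurable X -> measurable Y -> X `<=` Y ->
    (mu X <= mu Y)%E.
  by move=> mX mY XY; apply: le_measure => //; rewrite inE; [exact: mX|exact: mY].
have leN (X Y : set R) : measurable X -> measurable Y -> X `<=` Y ->
    (nu X <= nu Y)%E.
  by move=> mX mY XY; apply: le_measure => //; rewrite inE; [exact: mX|exact: mY].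
suff H e : 0 < e -> (nu A <= e%:E)%E.
  by apply/le_anti/andP; split => //; apply/lee_addgt0Pr => e e0; rewrite add0e H.
move=> e0; have [d d0 df] := acf e e0.
have muA : (mu A < +oo)%E by rewrite A0.
have [U [oU AU UA]] := @lebesgue_regularity_outer R A d mA muA d0.
have mU : measurable U by exact: open_measurable.
have muU : (mu U < d%:E)%E.
  rewrite -(setDUK AU); apply: (le_lt_trans (measureU2 _ _ _)) => //.
    exact: measurableD.
  by change ((mu A + mu (U `\` A) < d%:E)%E); rewrite A0 add0e.
apply: (@le_trans _ _ (nu U)); first exact: leN.
pose I := open_disjoint_itv oU.
have oI q : open (I q) by exact: open_disjoint_itv_open.
have mI q : measurable (I q) by exact: open_measurable.
have iI q : is_interval (I q) by exact: open_disjoint_itv_is_interval.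
have tI : trivIset setT I by exact: open_disjoint_itv_trivIset.
have UI : U = \bigcup_q I q by exact: open_disjoint_itv_bigcup.
have muI q : (mu (I q) < d%:E)%E.
  apply: le_lt_trans muU; apply: leM => //.
  by rewrite UI; exact: bigcup_sup.
have nuU : (fun n => \sum_(0 <= i < n) nu (I i))%E @ \oo --> nu U.
  by rewrite UI; apply: measure_semi_sigma_additive => //; rewrite -UI.
rewrite -(cvg_lim _ nuU)//; apply: lime_le; first by apply/cvg_ex; eexists; exact: nuU.
near=> N.
pose c x := Num.max a (Num.min x b).
(* Components may leave [[a, b]], hence the clamp; an empty one is replaced by the degenerate
   interval at [a]. *)
pose s (q : 'I_N) := if `[< I q !=set0 >] then c (inf (I q)) else a.
pose t (q : 'I_N) := if `[< I q !=set0 >] then c (sup (I q)) else a.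
have B (q : nat) : I q !=set0 ->
    [/\ has_lbound (I q), has_ubound (I q), inf (I q) <= sup (I q) &
     ((sup (I q) - inf (I q))%:E <= mu (I q))%E].
  move=> Iq; have [? ? ?] := interval_mu_bounds (@iI q) Iq (mI q) (muI q).
  split => //; have [x Ix] := Iq; apply: (@le_trans _ _ x).
    exact: ge_inf.
  exact: ub_le_sup.
apply: (@le_trans _ _ (\sum_(q < N) (`|f (t q) - f (s q)|)%:E)%E).
  rewrite big_mkord; apply: lee_sum => q _; rewrite /t /s.
  case: asboolP => [Iq|Iq]; last first.
    have -> : I q = set0 by rewrite -subset0 => x Ix; apply: Iq; exists x.
    by rewrite /nu measure0 lee_fin.
  have [lI uI isu _] := B _ Iq.
  apply: (@le_trans _ _ (nu `]inf (I q), sup (I q)]%classic)).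
    apply: leN => //.
    move=> z Iz; rewrite /= in_itv/=.
    apply/andP; split; last exact: ub_le_sup.
    (* An open component misses its infimum, so it lies in the half-open interval whose measure is
       known. *)
    rewrite lt_neqAle ge_inf// andbT; apply/eqP => zE.
    have [r /= r0 rI] := open_nbhs_nbhs (conj (oI q) Iz) : nbhs_ball _ _.
    have : I q (z - r / 2).
      by apply: rI; rewrite /ball/= opprB addrC subrK gtr0_norm; lra.
    by move=> /(ge_inf lI); rewrite zE; lra.
  by rewrite nuE// lee_fin !FE ler_norm.
rewrite sumEFin lee_fin ltW//; apply: df => [q|p q pq|].
- rewrite /s /t; case: asboolP => Iq; last by split.
  have [lI uI isu _] := B _ Iq.
  have [? ?] := clamp_bounds (inf (I q)) ab; have [? ?] := clamp_bounds (sup (I q)) ab.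
  by split => //; exact: clamp_homo.
- rewrite /s /t; case: asboolP => Ip; last first.
    left; case: asboolP => Iq //.
    by have [] := clamp_bounds (inf (I q)) ab.
  case: asboolP => Iq; last first.
    by right; have [] := clamp_bounds (inf (I p)) ab.
  have dpq : I p `&` I q = set0.
    by move/trivIsetP : tI => /(_ p q Logic.I Logic.I); apply.
  have [x Ix] := Ip; have [y Iy] := Iq.
  have H p' q' x' y' : I p' x' -> I q' y' -> I p' `&` I q' = set0 -> x' < y' ->
      sup (I p') <= inf (I q').
    move=> Ix' Iy' dis xy'.
    apply: ge_sup; first by exists x'.
    move=> u Iu; apply: lb_le_inf; first by exists y'.
    move=> v Iv; rewrite leNgt; apply/negP => vu.
    have K z : I p' z -> I q' z -> False.
      by move=> pz qz; have : (I p' `&` I q') z by []; rewrite dis.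
    have [vx|xv] := leP v x'.
      by apply: (K x') => //; apply: (iI q' _ _ Iv Iy' x'); rewrite vx ltW.
    by apply: (K v) => //; apply: (iI p' _ _ Ix' Iu v); rewrite !ltW.
  have [xy|yx|xy] := ltgtP x y.
  + by left; apply: clamp_homo; apply: H dpq xy.
  + by right; apply: clamp_homo; rewrite setIC in dpq; apply: H dpq yx.
  + by subst y; have : (I p `&` I q) x by []; rewrite dpq.
rewrite -lte_fin; apply: le_lt_trans muU.
apply: (@le_trans _ _ (\sum_(q < N) mu (I q))%E).
  rewrite -sumEFin; apply: lee_sum => q _; rewrite /s /t.
  case: asboolP => Iq; last by rewrite subrr.
  have [lI uI isu suI] := B _ Iq; apply: le_trans suI.
  by rewrite lee_fin clamp_lip.
have muUc : (fun n => \sum_(0 <= i < n) mu (I i))%E @ \oo --> mu U.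
  by rewrite UI; apply: measure_semi_sigma_additive => //; rewrite -UI.
rewrite -(cvg_lim _ muUc)// -(big_mkord xpredT (fun q => mu (I q))).
by apply: nneseries_lim_ge => n _ _; exact: measure_ge0.
Unshelve. all: by end_near. Qed.

Lemma ac_clamp_continuous (V : normedModType R) a b (f : R -> V) : a <= b ->
  abs_continuous a b f -> continuous (fun t => f (Num.max a (Num.min t b))).
Proof.
move=> ab acf t; apply/cvgrPdist_lt => e e0.
have [d d0 df] := ac_continuous_at acf (introT andP (clamp_bounds t ab)) e0.
apply/nbhs_ballP; exists d => //= s ts; rewrite distrC; apply: df.
  exact/andP/clamp_bounds.
by apply: le_lt_trans (clamp_dist _ _ _ _) _; rewrite distrC.
Qed.

(* Radon-Nikodym, for the Lebesgue-Stieltjes measure of f. *)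
Lemma ac_monotone_integral a b f : a <= b ->
  (forall s t, a <= s -> s <= t -> t <= b -> f s <= f t) -> AC a b f ->
  exists2 g : R -> R, mu.-integrable setT (EFin \o g) &
    forall t, a <= t <= b -> f t - f a = \int[mu]_(x in `[a, t]) g x.
Proof.
move=> ab ndf acf.
(* The extension by constants is a cumulative function on the whole line. *)
pose F0 t := f (Num.max a (Num.min t b)).
have ndF : nondecreasing F0.
  move=> s t st; have [? ?] := clamp_bounds s ab; have [? ?] := clamp_bounds t ab.
  by apply: ndf => //; exact: clamp_homo.
have cF : forall x, F0 @ at_right x --> F0 x.
  exact/right_continuousW/(ac_clamp_continuous ab acf).
pose F : cumulative R R := HB.pack F0 (isCumulative.Build R _ R F0 ndF cF).
pose nu := lebesgue_stieltjes_measure F.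
have nuE x y : x <= y -> nu `]x, y]%classic = (F y - F x)%:E.
  move=> xy; rewrite /nu /lebesgue_stieltjes_measure /measure_extension.
  by rewrite measurable_mu_extE/= ?wlength_itv_bnd//; exact: is_ocitv.
have mab : measurable (`]a, b]%classic : set (measurableTypeR R)).
  exact: (@measurable_itv R).
have nuoo : (nu `]a, b]%classic < +oo)%E by rewrite nuE// ltry.
pose nu' : {finite_measure set (measurableTypeR R) -> \bar R} := mfrestr mab nuoo.
have [|h [h0 hfin ih hE]] := @radon_nikodym_sigma_finite _ _ _ mu nu'.
  apply/null_content_dominatesP => A mA A0; apply/eqP.
  rewrite eq_le measure_ge0 andbT.
  have := ac_monotone_dominates ab (fun=> erefl _) acf mA A0 (F := F).
  rewrite -/nu => <-; rewrite /nu' /mfrestr /= /mrestr.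
  by apply: le_measure; rewrite ?inE//; exact: measurableI.
have EFh : EFin \o (fine \o h) = h by apply/funext => x /=; rewrite fineK.
exists (fine \o h); first by rewrite EFh.
move=> t /andP[at' tb].
rewrite -Rintegral_itv_obnd_cbnd; last by rewrite EFh; apply: integrableS ih.
have -> : \int[mu]_(x in `]a, t]) (fine \o h) x = fine (nu' `]a, t]%classic).
  rewrite hE; last exact: (@measurable_itv R).
  by rewrite /Rintegral; congr (fine _); apply: eq_integral => x _ /=; rewrite fineK.
have -> : nu' `]a, t]%classic = nu (`]a, t]%classic `&` `]a, b]%classic) by [].
have -> : (`]a, t]%classic `&` `]a, b]%classic : set R) = `]a, t]%classic.
  apply: setIidl.
  by move=> x /=; rewrite !in_itv /= => /andP[-> /le_trans]; apply.
by rewrite nuE//= /F0 !clampE// ?lexx ?at'.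
Qed.

Lemma ae_on_oo a b (P : R -> Prop) :
  {ae mu, forall t, a < t < b -> P t} -> ae_on a b P.
Proof.
have N (r : R) : {ae mu, forall t : R, t != r}.
  exists [set r]; split; first exact: (@measurable_set1 R).
    exact: lebesgue_measure_set1.
  by move=> t /= /negP; rewrite negbK => /eqP.
rewrite /ae_on; apply: filterS3 (N a) (N b).
  exact: (ae_filter_ringOfSetsType mu).
move=> t /= ta tb H /andP[at' tb']; apply: H.
by rewrite !lt_neqAle at' tb' tb eq_sym ta.
Qed.

Lemma ae_onS a b (P Q : R -> Prop) : (forall t, a <= t <= b -> P t -> Q t) ->
  ae_on a b P -> ae_on a b Q.
Proof.
move=> PQ; apply: (@filterS _ _ (ae_filter_ringOfSetsType mu)).
by move=> t Pt tab; apply: PQ => //; exact: Pt.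
Qed.

Lemma ae_onI a b (P Q : R -> Prop) : ae_on a b P -> ae_on a b Q ->
  ae_on a b (fun t => P t /\ Q t).
Proof.
apply: (@filterS2 _ _ (ae_filter_ringOfSetsType mu)).
by move=> t Pt Qt tab; split; [exact: Pt|exact: Qt].
Qed.

Lemma ae_on_all a b n (P : 'I_n -> R -> Prop) : (forall i, ae_on a b (P i)) ->
  ae_on a b (fun t => forall i, P i t).
Proof.
move=> H.
have := @filter_forall _ _ (fun i => [set t | a <= t <= b -> P i t]) _
  (ae_filter_ringOfSetsType mu) H.
by apply: (@filterS _ _ (ae_filter_ringOfSetsType mu)) => t Pt tab i; exact: Pt.
Qed.

(* f is the difference of the increasing functions V and V - f, with V the total
   variation of f. *)
Theorem ac_FTC a b f : a <= b -> AC a b f -> exists g : R -> R,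
  [/\ mu.-integrable setT (EFin \o g),
      forall t, a <= t <= b -> f t - f a = \int[mu]_(x in `[a, t]) g x
    & ae_on a b (fun t => @is_derive R R^o R^o t 1 f (g t))].
Proof.
move=> ab acf; have bvf := ac_bounded_variation ab acf.
have acv := ac_total_variation ab acf.
pose v t := fine (TV a t f).
have bv c d : a <= c -> c <= d -> d <= b -> TV c d f \is a fin_num.
  move=> ac cd db; apply/bounded_variationP => //.
  exact: (bounded_variationl cd db (bounded_variationr ac (le_trans cd db) bvf)).
have vE s t : a <= s -> s <= t -> t <= b -> `|f t - f s| <= v t - v s.
  move=> sa st tb; rewrite /v (total_variationD f sa st) fineD ?bv//; last first.
    exact: le_trans tb.
  rewrite addrAC subrr add0r -lee_fin fineK ?bv//; exact: total_variation_ge.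
have [g1 ig1 g1E] : exists2 g : R -> R, mu.-integrable setT (EFin \o g) &
    forall t, a <= t <= b -> v t - v a = \int[mu]_(x in `[a, t]) g x.
  apply: ac_monotone_integral => // s t sa st tb.
  by rewrite -subr_ge0; apply: le_trans (vE _ _ sa st tb).
have [g2 ig2 g2E] : exists2 g : R -> R, mu.-integrable setT (EFin \o g) &
    forall t, a <= t <= b -> (v t - f t) - (v a - f a) = \int[mu]_(x in `[a, t]) g x.
  apply: (ac_monotone_integral (f := fun t => v t - f t)) => //.
    move=> s t sa st tb; have := vE _ _ sa st tb.
    by move=> /(le_trans (ler_norm _)); lra.
  apply: (ac_dom (f := v) (g := f) (K := 1)) => // s t sa st tb.
  rewrite mul1r; apply: le_trans (ler_normB _ _).
  by rewrite le_eqVlt; apply/orP; left; apply/eqP; congr (`|_|); ring.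
have mitv t : measurable (`[a, t]%classic : set R) by exact: measurable_itv.
have ig : mu.-integrable setT (EFin \o (g1 \- g2)).
  by have := integrableB measurableT ig1 ig2; apply: eq_integrable.
exists (g1 \- g2).
have fE t : a <= t <= b -> f t - f a = \int[mu]_(x in `[a, t]) (g1 \- g2) x.
  move=> tab; rewrite RintegralB//; first by rewrite -g1E// -g2E//; ring.
    by apply: integrableS ig1.
  by apply: integrableS ig2.
split=> //.
have igy y : mu.-integrable `[a, y] (EFin \o (g1 \- g2)).
  by apply: integrableS ig => //; exact: (@measurable_itv R).
have lig : locally_integrable setT (g1 \- g2).
  by have := integrable_locally measurableT ig; rewrite patch_setT.
apply: ae_on_oo; have := FTC1 igy lig.
apply: filterS; first exact: (ae_filter_ringOfSetsType mu).
move=> t /= H /andP[at' tb].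
have [dF F't] : derivable (fun x => \int[mu]_(t in `[a, x]) (g1 \- g2) t) t 1 /\
  derive1 (fun x => \int[mu]_(t in `[a, x]) (g1 \- g2) t) t = (g1 \- g2) t.
  by apply: (H _); rewrite lte_fin.
have -> : g1 t - g2 t = 0 + (g1 \- g2) t by rewrite add0r.
apply: (@near_eq_is_derive _ R^o R^o (fun x => f a + \int[mu]_(t in `[a, x]) (g1 \- g2) t)).
- near=> x; rewrite -fE; first by rewrite addrC subrK.
  apply/andP; split; apply/ltW; near: x; [exact: lt_nbhsr|exact: lt_nbhsl].
- pose G : R^o -> R^o := fun x => \int[mu]_(t in `[a, x]) (g1 \- g2) t.
  have dG : is_derive (t : R^o) (1 : R^o) G ((g1 \- g2) t).
    by apply: DeriveDef; [exact: dF|rewrite -F't derive1E].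
  exact: (@is_deriveD _ _ _ (cst (f a)) G _ _ _ _ (is_derive_cst _ _ _) dG).
Unshelve. all: by end_near. Qed.

End AcFTC.

(** * Absolutely continuous curves in R^n and a uniqueness theorem for linear estimates *)

Section VectorAC.
Context {R : realType}.
Implicit Types (a b c d t : R).
Notation mu := (@lebesgue_measure R).
Notation AC := (@abs_continuous R R^o).

Lemma within_continuous_dist (V : normedModType R) (f : R -> V) a b t :
  {within `[a, b], continuous f} -> a <= t <= b -> forall e : R, 0 < e ->
  exists2 d : R, 0 < d &
    forall s, a <= s <= b -> `|s - t| < d -> `|f s - f t| < e.
Proof.
move=> /subspace_continuousP cf tab e e0.
have /cvgrPdist_lt/(_ e e0) := cf t tab.
rewrite near_withinE => -[d /= d0 dP].
by exists d => // s sab std; rewrite distrC; apply: dP => //=; rewrite distrC.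
Qed.

Lemma norm_mx_coord m n (M : 'M[R]_(m, n)) i j : `|M i j| <= `|M|.
Proof.
by rewrite [leRHS]/Num.Def.normr/= mx_normrE; exact: (le_bigmax _ _ (i, j)).
Qed.

Lemma norm_mx_le m n (M : 'M[R]_(m, n)) (r : R) : 0 <= r ->
  (forall i j, `|M i j| <= r) -> `|M| <= r.
Proof.
move=> r0 H; rewrite [leLHS]/Num.Def.normr/= mx_normrE.
by apply: bigmax_le => // -[i j] _; exact: H.
Qed.

Lemma norm_rV_le_sum n (v : 'rV[R]_n) : `|v| <= \sum_j `|v 0 j|.
Proof.
apply: norm_mx_le => [|i j]; first by rewrite sumr_ge0.
by rewrite ord1 (bigD1 j)//= lerDl sumr_ge0.
Qed.

Lemma ac_coord m n a b (f : R -> 'M[R]_(m, n)) i j : abs_continuous a b f ->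
  AC a b (fun t => f t i j).
Proof.
apply: (ac_dom1 (K := 1)) => s t sa st tb; rewrite mul1r.
by have := norm_mx_coord (f t - f s) i j; rewrite !mxE.
Qed.

(** The integrable densities [g] replace [derive1 f] under integrals, as the latter takes a default
    value where there is no derivative. *)
Lemma ac_coord_FTC n a b (f : R -> 'rV[R]_n) : a <= b -> abs_continuous a b f ->
  exists g : 'I_n -> R -> R,
  [/\ forall j, mu.-integrable setT (EFin \o g j),
      forall j t, a <= t <= b -> f t 0 j - f a 0 j = \int[mu]_(x in `[a, t]) g j x
    & ae_on a b (fun t => derivable f t 1 /\ forall j, derive1 f t 0 j = g j t)].
Proof.
move=> ab acf.
have /choice[g Hg] : forall j, exists g : R -> R,
  [/\ mu.-integrable setT (EFin \o g),
      forall t, a <= t <= b -> f t 0 j - f a 0 j = \int[mu]_(x in `[a, t]) g x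
    & ae_on a b (fun t => @is_derive R R^o R^o t 1 (fun t => f t 0 j) (g t))].
  by move=> j; apply: ac_FTC => //; exact: ac_coord.
exists g; split=> [j|j|]; [by case: (Hg j)|by case: (Hg j)|].
have : ae_on a b (fun t => forall j, @is_derive R R^o R^o t 1 (fun t => f t 0 j) (g j t)).
  by apply: ae_on_all => j; case: (Hg j).
apply: ae_onS => t _ H.
have df : derivable f t 1.
  by apply/derivable_mxP => i j; rewrite ord1; have [] := H j.
split => // j; rewrite derive1E derive_mx// mxE; exact: derive_val.
Qed.

Lemma ac_derivable n a b (f : R -> 'rV[R]_n) : a <= b -> abs_continuous a b f ->
  ae_on a b (fun t => derivable f t 1).
Proof.
move=> ab /(ac_coord_FTC ab)[g [_ _]]; apply: ae_onS => t _; by case.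
Qed.

(* On an interval where the integral of K |x'| is small, the supremum of |p| is
   bounded by half of itself as soon as p has a zero. *)
Lemma ac_uniqueness n m a b (p : R -> 'rV[R]_n) (x : R -> 'rV[R]_m) (K : R) :
  a <= b -> abs_continuous a b p -> abs_continuous a b x ->
  ae_on a b (fun t => derivable p t 1 -> derivable x t 1 ->
    `|derive1 p t| <= K * `|derive1 x t| * `|p t|) ->
  (exists2 t0, a <= t0 <= b & p t0 = 0) ->
  forall t, a <= t <= b -> p t = 0.
Proof.
move=> ab acp acx.
wlog K0 : K / 0 <= K.
  move=> H aeK; apply: (H `|K|) => //; apply: ae_onS aeK => t _ + dp dx.
  move=> /(_ dp dx)/le_trans; apply; apply: ler_wpM2r => //.
  by apply: ler_wpM2r => //; exact: ler_norm.
have [g [ig gE gd]] := ac_coord_FTC ab acp.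
have [h [ih hE hd]] := ac_coord_FTC ab acx.
move=> aeK.
(* An integrable function that dominates the norm of x' almost everywhere. *)
pose k := fun t => \sum_j `|h j t|.
have ik : mu.-integrable setT (EFin \o k).
  have -> : EFin \o k = (fun t => \sum_(j <- index_enum 'I_m) (`|h j t|%:E))%E.
    by apply/funext => t /=; rewrite sumEFin.
  apply: integrable_sum => // j _.
  by have := integrable_norm (ih j); apply: eq_integrable.
have bnd : ae_on a b (fun t => forall i, `|g i t| <= K * `|p t| * k t).
  apply: ae_onS (ae_onI aeK (ae_onI gd hd)) => t _ [H [[dp gp] [dx hx]]] i.
  rewrite -gp; apply: (le_trans (norm_mx_coord _ _ _)).
  apply: (le_trans (H dp dx)); rewrite mulrAC; apply: ler_wpM2l.
    by rewrite mulr_ge0.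
  by apply: (le_trans (norm_rV_le_sum _)); rewrite /k; under eq_bigr do rewrite hx.
pose W t := \int[mu]_(x in `[a, t]) k x.
have mitv (i : interval R) : measurable ([set` i] : set (measurableTypeR R)).
  exact: (@measurable_itv R).
have incr s t M : a <= s -> s <= t -> t <= b ->
    (forall r, s <= r <= t -> `|p r| <= M) -> forall i,
    `|p t 0 i - p s 0 i| <= K * M * (W t - W s).
  move=> sa st tb pM i.
  have M0 : 0 <= M by apply: le_trans (pM s _); rewrite ?lexx.
  have iS (f : R -> R) (j : interval R) : mu.-integrable setT (EFin \o f) ->
    mu.-integrable [set` j] (EFin \o f) by apply: integrableS.
  have -> : p t 0 i - p s 0 i = \int[mu]_(x in `]s, t]) g i x.
    rewrite -(Rintegral_itvB (a := BLeft a)) ?bnd_simp//; last exact: iS.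
    rewrite -!gE ?sa ?(le_trans sa st) ?tb ?(le_trans st tb)//; ring.
  have -> : W t - W s = \int[mu]_(x in `]s, t]) k x.
    by rewrite -(Rintegral_itvB (a := BLeft a)) ?bnd_simp//; exact: iS.
  rewrite -RintegralZl//; last exact: iS.
  apply: (le_trans (le_normr_Rintegral _ _)) => //; first exact: iS.
  rewrite -lee_fin.
  have igi : mu.-integrable `]s, t] (EFin \o (fun x => `|g i x|)).
    have /integrable_norm := @iS _ `]s, t] (ig i); exact: eq_integrable.
  have ikk : mu.-integrable `]s, t] (EFin \o (fun x => K * M * k x)).
    have -> : EFin \o (fun x => K * M * k x) = (fun x => (K * M)%:E * (k x)%:E)%E.
      by apply/funext => y /=; rewrite EFinM.
    by apply: integrableZl => //; exact: iS.
  rewrite /Rintegral !fineK; last 2 first.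
    exact: integrable_fin_num.
    exact: integrable_fin_num.
  apply: ae_ge0_le_integral => //=.
  - exact: measurable_int igi.
  - by move=> y _; rewrite lee_fin mulr_ge0 ?mulr_ge0// sumr_ge0.
  - exact: measurable_int ikk.
  - apply: (@filterS _ _ (ae_filter_ringOfSetsType mu)) bnd => y H.
    rewrite in_itv/= => /andP[sx xt]; rewrite lee_fin.
    apply: (le_trans (H _ i)).
      by rewrite (le_trans sa (ltW sx)) (le_trans xt tb).
    apply: ler_wpM2r; first exact: sumr_ge0.
    by apply: ler_wpM2l => //; apply: pM; rewrite ltW.
pose P c d := (exists2 t0, c <= t0 <= d & p t0 = 0) ->
  forall t, c <= t <= d -> p t = 0.
(* A zero in one of two adjacent intervals reaches the other through the common endpoint [d]. *)
apply: (@interval_ind R P) => // [c d e ac cd de eb Pc Pd [t0 /andP[ct te] pt0]|].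
  have [td|dt] := leP t0 d.
    have Pc' := Pc (ex_intro2 _ _ t0 (introT andP (conj ct td)) pt0).
    have Pd' : forall t, d <= t <= e -> p t = 0.
      by apply: Pd; exists d; rewrite ?lexx ?de// Pc'// cd lexx.
    move=> t /andP[ct' te']; have [td'|/ltW dt'] := leP t d.
      by rewrite Pc'// ct'.
    by rewrite Pd'// dt'.
  have dte : d <= t0 <= e by rewrite ltW.
  have Pd' := Pd (ex_intro2 _ _ t0 dte pt0).
  have Pc' : forall t, c <= t <= d -> p t = 0.
    by apply: Pc; exists d; rewrite ?lexx ?cd// Pd'// lexx.
  move=> t /andP[ct' te']; have [td'|/ltW dt'] := leP t d.
    by rewrite Pc'// ct'.
  by rewrite Pd'// dt'.
move=> t tab; have ik' : mu.-integrable `[a, b] (EFin \o k) by apply: integrableS ik.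
have cW := parameterized_integral_continuous ab ik'.
(* By way of [t], any two points of this neighbourhood have [K] times the increment of [W] below
   1/2. *)
have [r r0 Wr] : exists2 r : R, 0 < r & forall s, a <= s <= b -> `|s - t| < r ->
    K * `|W s - W t| < 4^-1.
  (* The use of [K + 1] covers the case [K = 0]. *)
  have e0 : 0 < (4 * (K + 1))^-1 by rewrite invr_gt0 mulr_gt0// ltr_wpDl.
  have [d d0 dW] := within_continuous_dist cW tab e0.
  exists d => // s sab std; apply: (@le_lt_trans _ _ (K * (4 * (K + 1))^-1)).
    by apply: ler_wpM2l => //; apply/ltW/dW.
  rewrite invfM mulrCA gtr_pMr ?invr_gt0// ltr_pdivrMr ?mul1r; last by rewrite ltr_wpDl.
  by rewrite ltrDl.
exists r => // c d ac cd db ct dt [t1 /andP[ct1 t1d] pt1] s csd.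
have rng u : c <= u <= d -> a <= u <= b /\ `|u - t| < r.
  move=> /andP[cu ud]; rewrite (le_trans ac cu) (le_trans ud db); split => //.
  move: ct dt; rewrite !ltr_norml => /andP[? ?] /andP[? ?]; apply/andP; split; lra.
have [M [s0 s0cd MP] Mle] : exists2 M : R, (exists2 s0, c <= s0 <= d & `|p s0| = M) &
    forall u, c <= u <= d -> `|p u| <= M.
  have cN : {within `[c, d], continuous (fun u => `|p u|)}.
    apply/subspace_continuousP => u /=; rewrite in_itv/= => ucd.
    apply/cvgrPdist_lt => e e0.
    have [uab _] := rng _ ucd.
    have [q q0 qP] := ac_continuous_at acp uab e0.
    rewrite near_withinE; exists q => //= v uv; rewrite in_itv/= => vcd.
    have [vab _] := rng _ vcd.
    rewrite distrC; apply: le_lt_trans (qP _ vab _); last by rewrite distrC.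
    exact: ler_dist_dist.
  have [s0 s0cd Mx] := EVT_max cd cN.
  exists `|p s0|; first by exists s0 => //; rewrite -in_itv.
  by move=> u ucd; apply: Mx; rewrite in_itv.
have M0 : 0 <= M by rewrite -MP.
have small u : c <= u <= d -> `|p u| <= M / 2.
  move=> ucd; apply: norm_mx_le => [|i j]; first by rewrite divr_ge0.
  rewrite ord1.
  have W1 v : c <= v <= d -> K * `|W v - W t| < 4^-1.
    by move=> /rng[vab vt]; exact: Wr.
  have W2 : K * `|W u - W t1| <= 2^-1.
    have t1cd : c <= t1 <= d by rewrite ct1.
    have := W1 _ ucd; have := W1 _ t1cd.
    have : K * `|W u - W t1| <= K * (`|W u - W t| + `|W t1 - W t|).
      apply: ler_wpM2l => //; rewrite -[W u - W t1](subrKA (W t)).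
      by apply: (le_trans (ler_normD _ _)); rewrite [`|W t - _|]distrC.
    by rewrite mulrDr; lra.
  suff : `|p u 0 j - p t1 0 j| <= K * M * `|W u - W t1|.
    rewrite pt1 mxE subr0 => /le_trans; apply; rewrite mulrAC mulrC.
    exact: ler_wpM2l.
  have [/andP[cu ud] [/andP[au ub] _]] := (ucd, rng _ ucd).
  have [ut|/ltW tu] := leP u t1.
    rewrite distrC [`|W u - _|]distrC.
    apply: (le_trans (incr _ _ M au ut (le_trans t1d db) _ j)).
      by move=> v /andP[uv vt]; rewrite Mle// (le_trans cu)// (le_trans vt).
    by apply: ler_wpM2l; [exact: mulr_ge0|exact: ler_norm].
  apply: (le_trans (incr _ _ M (le_trans ac ct1) tu ub _ j)).
    by move=> v /andP[uv vt]; rewrite Mle// (le_trans ct1)//= (le_trans vt).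
  by apply: ler_wpM2l; [exact: mulr_ge0|exact: ler_norm].
have M00 : M <= 0 by have := small _ s0cd; rewrite MP; lra.
by apply/eqP; rewrite -normr_le0; exact: le_trans (Mle _ csd) M00.
Qed.

End VectorAC.

(** * Measurability and square integrability of derivatives *)

Section DeriveMeasurable.
Context {R : realType}.
Implicit Types (a b c d t : R).
Notation mu := (@lebesgue_measure R).
Notation AC := (@abs_continuous R R^o).

Lemma dquot_continuous (V : normedModType R) (f : R -> V) (h : R) : continuous f ->
  continuous (fun t => h^-1 *: (f (h + t) - f t)).
Proof.
move=> cf t.
have H : f (h + s) - f s @[s --> t] --> f (h + t) - f t.
  apply: cvgB; last exact: cf.
  apply: (@continuous_comp _ _ _ (fun t => h + t) f); last exact: cf.
  by apply: cvgD; [exact: cvg_cst|exact: cvg_id].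
exact: (cvgZ (cvg_cst _) H).
Qed.

Lemma derivable_dquotP (V : normedModType R) (f : R -> V) (t : R) :
  derivable f t 1 <-> cvg (h^-1 *: (f (h + t) - f t) @[h --> (0 : R)^']).
Proof.
rewrite /derivable; suff -> : (fun h : R => h^-1 *: ((f \o shift t) (h *: 1) - f t)) =
  (fun h => h^-1 *: (f (h + t) - f t)) by [].
by apply/funext => h /=; rewrite [h *: 1]mulr1.
Qed.

(** Cauchy criterion for the difference quotients. For fixed increments the condition is closed in
    [t], by continuity of [f], and closedness survives the uncountable intersection over pairs of
    increments; only [n] and [m] range over a countable set. *)
Lemma measurable_derivable (f : R -> R) : continuous f ->
  measurable [set t | derivable (f : R -> R^o) t 1].
Proof.
move=> cf.
pose q (h t : R) : R^o := h^-1 *: ((f : R -> R^o) (h + t) - f t).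
have -> : [set t | derivable (f : R -> R^o) t 1] =
  \bigcap_(n : nat) \bigcup_(m : nat) \bigcap_(x in [set x : R * R |
    [/\ x.1 != 0, x.2 != 0, `|x.1| < m.+1%:R^-1 & `|x.2| < m.+1%:R^-1]])
    [set t | `|q x.1 t - q x.2 t| <= n.+1%:R^-1].
  apply/seteqP; split => t /=.
    move=> /derivable_dquotP/cvg_ex[/= l ql] n _.
    have e0 : 0 < n.+1%:R^-1 / 2 :> R by rewrite divr_gt0// invr_gt0.
    move/cvgrPdist_lt : ql => /(_ _ e0)[d /= d0 dP].
    have [m _ /(_ m (leqnn m)) md] := near_infty_natSinv_lt (PosNum d0).
    exists m => // -[h k] /= [h0 k0 hm km].
    have := dP h; have := dP k; rewrite /= !sub0r !normrN.
    move=> /(_ (lt_trans km md) k0) Hk /(_ (lt_trans hm md) h0) Hh.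
    rewrite -[q h t - q k t](subrKA l) (le_trans (ler_normD _ _))//.
    by rewrite (splitr n.+1%:R^-1) lerD// ltW// distrC.
  move=> H; apply/derivable_dquotP; apply/cauchy_cvgP/cauchy_exP => e e0.
  have [n _ /(_ n (leqnn n)) ne] := near_infty_natSinv_lt (PosNum e0).
  have [m _ mP] := H n Logic.I.
  have m0 : 0 < m.+1%:R^-1 :> R by rewrite invr_gt0.
  have k0 : 0 < m.+1%:R^-1 / 2 :> R by rewrite divr_gt0.
  (* Any admissible increment gives a centre for the Cauchy filter; half the radius is one. *)
  exists (q (m.+1%:R^-1 / 2) t); exists m.+1%:R^-1 => //= h.
  rewrite /= sub0r normrN => hm h0.
  have /= := mP (m.+1%:R^-1 / 2, h); rewrite -ball_normE /= => /(_ _)/le_lt_trans; apply => //.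
  have kn : m.+1%:R^-1 / 2 != 0 :> R by rewrite gt_eqF.
  split => //.
  by rewrite gtr0_norm// ltr_pdivrMr// ltr_pMr// ltr1n.
apply: bigcapT_measurable => n; apply: bigcupT_measurable => m.
apply: closed_measurable; apply: closed_bigI => -[h k] _.
have cN : continuous (fun t => `|q h t - q k t|).
  move=> t; apply: cvg_norm; apply: cvgB; exact: dquot_continuous.
by apply: (preimage_closed _ (@closed_le R n.+1%:R^-1)) => t _; exact: cN.
Qed.

(** On [D] the derivative is the pointwise limit of the quotients for the increments 1/(n+1); off
    [D] it is the default value of a limit, hence constant. *)
Lemma measurable_norm_derive1 (V : normedModType R) (f : R -> V) : continuous f ->
  measurable [set t | derivable f t 1] -> measurable_fun setT (fun t => `|derive1 f t|).
Proof.
move=> cf mD; set D := [set t | _] in mD.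
pose q (h t : R) : V := h^-1 *: (f (h + t) - f t).
rewrite -(setUv D); apply/measurable_funU => //; first exact: measurableC.
split.
  apply: (@measurable_fun_cvg _ _ _ _ (fun n t => `|q n.+1%:R^-1 t|)) => [n|t Dt].
    apply: measurable_funTS; apply: continuous_measurable_fun => t.
    by apply: cvg_norm; exact: dquot_continuous.
  apply: cvg_norm; have /derivable_dquotP ct : derivable f t 1 by [].
  apply: (@cvg_comp _ _ _ (fun n => n.+1%:R^-1) (fun h => q h t) _ (0^') _ _ ct).
  move=> A [d /= d0 dA].
  have := near_infty_natSinv_lt (PosNum d0); apply: filterS => n nd.
  apply: dA; last by rewrite gt_eqF// invr_gt0.
  by rewrite /= sub0r normrN gtr0_norm// invr_gt0.
apply: (eq_measurable_fun (cst `|point : V|)); last exact: measurable_cst.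
move=> t; rewrite inE => /= nD; congr (`|_|); rewrite /derive1 /lim /lim_in.
apply/esym; rewrite xgetPN // => l Hl; apply: nD.
by apply/derivable_dquotP/cvg_ex; exists l.
Qed.

Lemma derivable1_pairP (V W : normedModType R) (f : R -> V) (g : R -> W) t :
  derivable (fun s => (f s, g s)) t 1 <-> derivable f t 1 /\ derivable g t 1.
Proof.
split=> [/derivable1_diffP d|[/derivable1_diffP df /derivable1_diffP dg]].
  split; apply/derivable1_diffP.
    apply: (@differentiable_comp _ _ _ _ (fun s => (f s, g s)) fst) => //.
    by apply: linear_differentiable => -[u v]; exact: cvg_fst.
  apply: (@differentiable_comp _ _ _ _ (fun s => (f s, g s)) snd) => //.
  by apply: linear_differentiable => -[u v]; exact: cvg_snd.
by apply/derivable1_diffP; exact: differentiable_pair.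
Qed.

Lemma derive1_pair (V W : normedModType R) (f : R -> V) (g : R -> W) t :
  derivable f t 1 -> derivable g t 1 ->
  derive1 (fun s => (f s, g s)) t = (derive1 f t, derive1 g t).
Proof.
move=> /derivable1_diffP df /derivable1_diffP dg.
rewrite derive1E' ?diff_pair//; last exact: differentiable_pair.
by rewrite !derive1E'.
Qed.

Lemma near_eq_derive1 (V : normedModType R) (f g : R -> V) t :
  (\near t, f t = g t) -> derive1 f t = derive1 g t.
Proof.
by move=> fg; rewrite !derive1E; apply: near_eq_derive.
Qed.

Lemma near_clamp a b t : a < t < b -> \near t, Num.max a (Num.min t b) = t.
Proof.
move=> /andP[at' tb]; near=> s; apply: clampE; apply/andP.
by split; apply: ltW; near: s; [exact: lt_nbhsr|exact: lt_nbhsl].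
Unshelve. all: by end_near. Qed.

(** The clamp makes both curves continuous on the line and keeps their derivatives inside the
    interval; two endpoints do not affect measurability. *)
Lemma measurable_norm_derive1_pair n m a b (x : R -> 'rV[R]_n) (p : R -> 'rV[R]_m) :
  a <= b -> abs_continuous a b x -> abs_continuous a b p ->
  measurable_fun `[a, b] (fun t => `|derive1 (fun t => (x t, p t)) t|).
Proof.
move=> ab acx acp.
pose c t := Num.max a (Num.min t b).
have cx : continuous (x \o c) by exact: ac_clamp_continuous.
have cp : continuous (p \o c) by exact: ac_clamp_continuous.
have mD k (f : R -> 'rV[R]_k) : continuous f -> measurable [set t | derivable f t 1].
  move=> cf; have -> : [set t | derivable f t 1] = \bigcap_(j in [set: 'I_k])
      [set t | derivable (fun t => f t 0 j : R^o) t 1].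
    apply/seteqP; split => t /=.
      by move=> /derivable_mxP H j _; exact: H.
    by move=> H; apply/derivable_mxP => i j; rewrite ord1; exact: H.
  apply: fin_bigcap_measurable => // j _; apply: measurable_derivable => t.
  by apply: (continuous_comp (f := f) (g := fun M => M 0 j)); [exact: cf|exact: coord_continuous].
have : measurable_fun setT (fun t => `|derive1 (fun t => ((x \o c) t, (p \o c) t)) t|).
  apply: measurable_norm_derive1 => [t|]; first exact: (cvg_pair (cx t) (cp t)).
  have -> : [set t | derivable (fun t => ((x \o c) t, (p \o c) t)) t 1] =
    [set t | derivable (x \o c) t 1] `&` [set t | derivable (p \o c) t 1].
    by apply/seteqP; split => t /= /derivable1_pairP.
  by apply: measurableI; exact: mD.
move=> /(measurable_funS measurableT (@subsetT _ `]a, b[%classic)) H.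
apply/measurable_fun_itv_bndo_bndcP.
apply/measurable_fun_itv_obnd_cbndP.
apply: eq_measurable_fun H => t; rewrite inE/= in_itv/= => tab.
apply: f_equal; rewrite !derive1E; apply: near_eq_derive.
by have := near_clamp tab; apply: filterS => s cs; rewrite /= /c cs.
Qed.

(** Integrability comprises measurability, which no bound provides; it comes from
    [measurable_norm_derive1_pair]. The bound then compares the integrals. *)
Lemma L2_derivative_pair n m a b (x : R -> 'rV[R]_n) (p : R -> 'rV[R]_m) (C : R) :
  a <= b -> abs_continuous a b x -> abs_continuous a b p -> L2_derivative a b x ->
  ae_on a b (fun t => derivable x t 1 -> derivable p t 1 ->
    `|derive1 p t| <= C * `|derive1 x t|) ->
  L2_derivative a b (fun t => (x t, p t)).
Proof.
move=> ab acx acp L2x aeC.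
have dx := ac_derivable ab acx; have dp := ac_derivable ab acp.
have mP := measurable_norm_derive1_pair ab acx acp.
(* The norm of a pair is the maximum of the two norms, hence here at most [1 + |C|] times the norm
   of x'. *)
pose K := (1 + `|C|) ^+ 2.
have mab : measurable (`[a, b]%classic : set (measurableTypeR R)).
  exact: (@measurable_itv R).
have L2K : mu.-integrable `[a, b] (fun t => (K * `|derive1 x t| ^+ 2)%:E).
  have -> : (fun t => (K * `|derive1 x t| ^+ 2)%:E) =
            (fun t => K%:E * (`|derive1 x t| ^+ 2)%:E)%E.
    by apply/funext => t; rewrite EFinM.
  exact: integrableZl.
apply/integrableP; split.
  apply/measurable_EFinP; exact: measurable_funX.
have := L2K => /integrableP[mK]; apply: le_lt_trans.
apply: ae_ge0_le_integral => //=.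
- by apply/measurable_EFinP/measurableT_comp => //; exact: measurable_funX.
- by apply/measurable_EFinP/measurableT_comp => //; exact/measurable_EFinP.
- have := ae_onI aeC (ae_onI dx dp).
  apply: (@filterS _ _ (ae_filter_ringOfSetsType mu)) => t H.
  rewrite in_itv/= => /H[HC [dxt dpt]]; rewrite lee_fin.
  rewrite derive1_pair//.
  rewrite !ger0_norm ?mulr_ge0 ?sqr_ge0//.
  rewrite /K -exprMn ler_sqr ?nnegrE ?mulr_ge0 ?addr_ge0//.
  have H2 := HC dxt dpt; rewrite prod_normE /=.
  rewrite ge_max; apply/andP; split.
    by rewrite mulrDl mul1r lerDl mulr_ge0.
  apply: (le_trans H2); rewrite mulrDl mul1r.
  apply: ler_wpDl => //; apply: ler_wpM2r => //; exact: ler_norm.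
Qed.

End DeriveMeasurable.

(** * Calculus of maps of class C^k *)

Section NearDiff.
Context {R : realType} {V W : normedModType R}.
Implicit Types (f g : V -> W) (x v : V) (U : set V).

Lemma near_eq_diff f g x : (\near x, f x = g x) -> differentiable f x ->
  differentiable g x /\ 'd g x = 'd f x :> (V -> W).
Proof.
move=> fg df; have /diff_locallyP[cdf Ef] := df.
have Eg : g \o shift x = cst (g x) + 'd f x +o_ 0 id.
  apply/eqaddoP => e e0; move/eqaddoP : Ef => /(_ e e0).
  have nfg : \forall h \near (0 : V), f (h + x) = g (h + x).
    by move: fg; rewrite (near_shift 0 x); apply: filterS => h; rewrite /= subr0.
  apply: filterS2 nfg => h fgh.
  by rewrite -![(_ - _) h]/(_ - _) -![(_ + _) h]/(_ + _) /= /cst -fgh -(nbhs_singleton fg).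
have Ed : 'd g x = 'd f x :> (V -> W) by exact: diff_unique.
split; last exact: Ed.
by apply/diff_locallyP; rewrite Ed; split; [exact: cdf|exact: Eg].
Qed.

Lemma open_near (U : set V) x : open U -> U x -> \near x, U x.
Proof. by move=> oU Ux; exact: open_nbhs_nbhs. Qed.

End NearDiff.

Section Ck.
Context {R : realType}.
Implicit Types (V W : normedModType R) (k : nat).

Lemma Ck_continuous V W k (U : set V) (f : V -> W) x : Ck_on k U f -> U x ->
  {for x, continuous f}.
Proof.
case: k => [|k] /=; first by move=> + Ux; exact.
by move=> [df _] Ux; apply: differentiable_continuous; exact: df.
Qed.

Lemma Ck_S V W k (U : set V) (f : V -> W) : Ck_on k.+1 U f -> Ck_on k U f.
Proof.
elim: k f => [|k IH] f /=; first by move=> [df _] x Ux; apply: differentiable_continuous; exact: df.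
by move=> [df Df]; split => // v; apply: IH; exact: Df.
Qed.

Lemma Ck_sub V W k (U U' : set V) (f : V -> W) : U' `<=` U -> Ck_on k U f -> Ck_on k U' f.
Proof.
move=> UU; elim: k f => [|k IH] f /=; first by move=> cf x /UU; exact: cf.
by move=> [df Df]; split => [x /UU|v]; [exact: df|exact: IH].
Qed.

Lemma Ck_eq V W k (U : set V) (f g : V -> W) : open U -> {in U, f =1 g} ->
  Ck_on k U f -> Ck_on k U g.
Proof.
move=> oU; elim: k f g => [|k IH] f g fg /=.
  move=> cf x Ux; rewrite /prop_for /continuous_at -(fg x) ?inE//.
  apply: cvg_trans (cf x Ux); apply: near_eq_cvg.
  by have := open_near oU Ux; apply: filterS => y Uy; rewrite fg ?inE.
have nfg x : U x -> \near x, f x = g x.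
  move=> Ux; have := open_near oU Ux.
  by apply: filterS => y Uy; rewrite fg ?inE.
move=> [df Df]; split => [x Ux|v].
  by have [] := near_eq_diff (nfg x Ux) (df x Ux).
apply: IH (Df v) => x; rewrite inE => Ux.
by apply: near_eq_derive; exact: nfg.
Qed.

Lemma Ck_cst V W k (U : set V) (w : W) : Ck_on k U (cst w).
Proof.
elim: k w => [|k IH] w /=; first by move=> x _; exact: cst_continuous.
split => [x _|v]; first exact: differentiable_cst.
have -> : 'D_v (cst w) = cst 0 :> (V -> W) by apply/funext => x; rewrite derive_cst.
exact: IH.
Qed.

Lemma Ck_lincomp V W W' k (U : set V) (f : V -> W) (L : {linear W -> W'}) : open U ->
  continuous L -> Ck_on k U f -> Ck_on k U (L \o f).
Proof.
move=> oU cL; elim: k f => [|k IH] f /=.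
  by move=> cf x Ux; apply: continuous_comp; [exact: cf|exact: cL].
move=> [df Df]; have dL y : differentiable L y by exact: linear_differentiable.
split => [x Ux|v]; first by apply: differentiable_comp => //; exact: df.
apply: Ck_eq (IH _ (Df v)) => // x; rewrite inE => Ux /=.
have dLf : differentiable (L \o f) x by apply: differentiable_comp; [exact: df|].
rewrite (deriveE v (df x Ux)) (deriveE v dLf) (diff_comp (df x Ux) (dL _)) /=.
by rewrite diff_lin.
Qed.

Lemma Ck_lincomp_unbundled V W W' k (U : set V) (f : V -> W) (L : W -> W') : open U ->
  linear L -> continuous L -> Ck_on k U f -> Ck_on k U (fun x => L (f x)).
Proof.
move=> oU linL; pose L' : {linear W -> W'} :=
  HB.pack_for {linear W -> W'} L (GRing.isLinear.Build R W W' *:%R L linL).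
exact: (@Ck_lincomp _ _ _ _ _ _ L').
Qed.

Lemma Ck_lin V W k (U : set V) (L : {linear V -> W}) : continuous L -> Ck_on k U L.
Proof.
move=> cL; case: k => [|k] /=; first by move=> x _; exact: cL.
split => [x _|v]; first exact: linear_differentiable.
have -> : 'D_v L = cst (L v) :> (V -> W); last exact: Ck_cst.
by apply/funext => x; rewrite deriveE ?diff_lin//; exact: linear_differentiable.
Qed.

Lemma Ck_add V W k (U : set V) (f g : V -> W) : open U ->
  Ck_on k U f -> Ck_on k U g -> Ck_on k U (fun x => f x + g x).
Proof.
move=> oU; elim: k f g => [|k IH] f g /=.
  by move=> cf cg x Ux; apply: continuousD; [exact: cf|exact: cg].
move=> [df Df] [dg Dg]; split => [x Ux|v].
  by apply: differentiableD; [exact: df|exact: dg].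
apply: Ck_eq (IH _ _ (Df v) (Dg v)) => // x; rewrite inE => Ux /=.
by rewrite deriveD//; apply: diff_derivable; [exact: df|exact: dg].
Qed.

Lemma Ck_sum V W k (U : set V) (I : Type) (r : seq I) (f : I -> V -> W) : open U ->
  (forall i, Ck_on k U (f i)) -> Ck_on k U (fun x => \sum_(i <- r) f i x).
Proof.
move=> oU cf; elim: r => [|i r IH].
  by apply: Ck_eq (Ck_cst _ _ 0) => // x _; rewrite big_nil.
by apply: Ck_eq (Ck_add oU (cf i) IH) => // x _; rewrite big_cons.
Qed.

Lemma Ck_mul V k (U : set V) (f g : V -> R^o) : open U ->
  Ck_on k U f -> Ck_on k U g -> Ck_on k U (fun x => f x * g x : R^o).
Proof.
move=> oU; elim: k f g => [|k IH] f g.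
  by move=> cf cg x Ux; apply: continuousM; [exact: cf|exact: cg].
move=> cf cg; have [cf' cg'] := (Ck_S cf, Ck_S cg).
case: cf cg => [df Df] [dg Dg]; split => [x Ux|v].
  by apply: differentiableM; [exact: df|exact: dg].
apply: Ck_eq (Ck_add oU (IH _ _ cf' (Dg v)) (IH _ _ cg' (Df v))) => // x.
rewrite inE => Ux /=.
by rewrite deriveM//; apply: diff_derivable; [exact: df|exact: dg].
Qed.

Lemma Ck_inv V k (U : set V) (f : V -> R^o) : open U ->
  (forall x, U x -> f x != 0) -> Ck_on k U f -> Ck_on k U (fun x => (f x)^-1 : R^o).
Proof.
move=> oU f0; elim: k => [|k IH] cf.
  by move=> x Ux; apply: continuousV; [exact: f0|exact: cf].
have cV := IH (Ck_S cf); case: cf => [df Df]; split => [x Ux|v].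
  by apply: differentiableV; [exact: df|exact: f0].
have H := Ck_mul oU (Ck_mul oU (Ck_cst _ _ (-1 : R^o)) (Ck_mul oU cV cV)) (Df v).
apply: Ck_eq H => // x; rewrite inE => Ux.
rewrite (deriveV (f0 x Ux) (diff_derivable (df x Ux))).
by rewrite mulN1r -expr2 exprVn.
Qed.

Lemma Ck_mx V m n k (U : set V) (f : V -> 'M[R]_(m, n)) : open U ->
  (forall i j, Ck_on k U (fun x => f x i j : R^o)) -> Ck_on k U f.
Proof.
move=> oU cf.
have H : Ck_on k U (fun x => \sum_i \sum_j (f x i j) *: (delta_mx i j : 'M[R]_(m, n))).
  apply: Ck_sum => // i; apply: Ck_sum => // j.
  apply: (@Ck_lincomp_unbundled V R^o _ k U (fun x => f x i j)
    (fun r => r *: (delta_mx i j : 'M[R]_(m, n))) oU) => //.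
    by move=> a u v; rewrite scalerDl scalerA.
  exact: scalel_continuous.
by apply: Ck_eq H => // x _; rewrite -matrix_sum_delta.
Qed.

Lemma Ck_coord V m n k (U : set V) (f : V -> 'M[R]_(m, n)) i j : open U ->
  Ck_on k U f -> Ck_on k U (fun x => f x i j : R^o).
Proof.
move=> oU; apply: (@Ck_lincomp_unbundled V 'M[R]_(m, n) R^o k U f
  (fun M => M i j : R^o) oU).
  by move=> a u v; rewrite !mxE.
exact: coord_continuous.
Qed.

Lemma Ck_pair V W W' k (U : set V) (f : V -> W) (g : V -> W') : open U ->
  Ck_on k U f -> Ck_on k U g -> Ck_on k U (fun x => (f x, g x)).
Proof.
move=> oU; elim: k f g => [|k IH] f g /=.
  by move=> cf cg x Ux; apply: cvg_pair; [exact: cf|exact: cg].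
move=> [df Df] [dg Dg]; split => [x Ux|v].
  by apply: differentiable_pair; [exact: df|exact: dg].
apply: Ck_eq (IH _ _ (Df v) (Dg v)) => // x; rewrite inE => Ux.
rewrite (deriveE v (df x Ux)) (deriveE v (dg x Ux)).
rewrite (deriveE v (differentiable_pair (df x Ux) (dg x Ux))).
by rewrite (diff_pair (df x Ux) (dg x Ux)).
Qed.

Lemma derive_comp_rV V n (W : normedModType R) (f : V -> 'rV[R]_n)
    (g : 'rV[R]_n -> W) x v :
  differentiable f x -> differentiable g (f x) ->
  'D_v (g \o f) x = \sum_i 'D_v f x 0 i *: 'D_(delta_mx 0 i) g (f x).
Proof.
move=> df dg; rewrite (deriveE v (differentiable_comp df dg)) (diff_comp df dg) /=.
rewrite -(deriveE v df) [in LHS](row_sum_delta ('D_v f x)) linear_sum.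
by apply: eq_bigr => i _; rewrite linearZ /= (deriveE _ dg).
Qed.

(** [Ck_on] differentiates in fixed directions, while the chain rule produces the direction
    ['D_v f x], which moves with [x]. Its expansion in the standard basis yields products to which
    the induction hypothesis applies. *)
Lemma Ck_comp V n k (U : set V) (U' : set 'rV[R]_n) (f : V -> 'rV[R]_n)
    (g : 'rV[R]_n -> R^o) : open U -> (forall x, U x -> U' (f x)) ->
  Ck_on k U f -> Ck_on k U' g -> Ck_on k U (g \o f).
Proof.
move=> oU fU; elim: k f g fU => [|k IH] f g fU.
  by move=> cf cg x Ux; apply: continuous_comp; [exact: cf|apply: cg; exact: fU].
move=> cf cg; have cf' := Ck_S cf; case: cf cg => [df Df] [dg Dg].
split => [x Ux|v].
  by apply: differentiable_comp; [exact: df|apply: dg; exact: fU].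
have H : Ck_on k U (fun x => \sum_i 'D_v f x 0 i * 'D_(delta_mx 0 i) g (f x) : R^o).
  apply: Ck_sum => // i; apply: Ck_mul => //.
    exact: Ck_coord (Df v).
  exact: IH (Dg _).
apply: Ck_eq H => // x; rewrite inE => Ux.
by rewrite derive_comp_rV//; [exact: df|apply: dg; exact: fU].
Qed.

Lemma Ck_comp_mx V n p q k (U : set V) (U' : set 'rV[R]_n) (f : V -> 'rV[R]_n)
    (g : 'rV[R]_n -> 'M[R]_(p, q)) : open U -> open U' ->
  (forall x, U x -> U' (f x)) ->
  Ck_on k U f -> Ck_on k U' g -> Ck_on k U (g \o f).
Proof.
move=> oU oU' fU cf cg; apply: Ck_mx => // i j.
exact: (Ck_comp (g := fun y => g y i j) oU fU cf (Ck_coord i j oU' cg)).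
Qed.

Lemma Ck_prod V k (U : set V) (I : Type) (r : seq I) (f : I -> V -> R^o) : open U ->
  (forall i, Ck_on k U (f i)) -> Ck_on k U (fun x => \prod_(i <- r) f i x : R^o).
Proof.
move=> oU cf; elim: r => [|i r IH].
  by apply: Ck_eq (Ck_cst _ _ (1 : R^o)) => // x _; rewrite big_nil.
by apply: Ck_eq (Ck_mul oU (cf i) IH) => // x _; rewrite big_cons.
Qed.

Lemma Ck_mulmx V m n p k (U : set V) (A : V -> 'M[R]_(m, n)) (B : V -> 'M[R]_(n, p)) :
  open U -> Ck_on k U A -> Ck_on k U B -> Ck_on k U (fun x => A x *m B x).
Proof.
move=> oU cA cB; apply: Ck_mx => // i j.
have H : Ck_on k U (fun x => \sum_l A x i l * B x l j : R^o).
  by apply: Ck_sum => // l; apply: Ck_mul => //; exact: Ck_coord.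
by apply: Ck_eq H => // x _; rewrite mxE.
Qed.

Lemma Ck_det V n k (U : set V) (A : V -> 'M[R]_n) :
  open U -> Ck_on k U A -> Ck_on k U (fun x => \det (A x) : R^o).
Proof.
move=> oU cA; rewrite /determinant; apply: Ck_sum => // s.
apply: (Ck_mul oU); first exact: Ck_cst.
by apply: Ck_prod => // i; exact: Ck_coord.
Qed.

(** Cramer's rule: the entries of the inverse are cofactors divided by the determinant. *)
Lemma Ck_invmx V n k (U : set V) (A : V -> 'M[R]_n) : open U ->
  (forall x, U x -> A x \in unitmx) -> Ck_on k U A -> Ck_on k U (fun x => invmx (A x)).
Proof.
move=> oU uA cA; apply: Ck_mx => // i j.
have cdet : Ck_on k U (fun x => (\det (A x))^-1 : R^o).
  apply: (Ck_inv oU _ (Ck_det oU cA)) => x /uA.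
  by rewrite unitmxE unitfE.
have cadj : Ck_on k U (fun x => \adj (A x) i j : R^o).
  have H : Ck_on k U (fun x => (-1) ^+ (j + i) * \det (row' j (col' i (A x))) : R^o).
    apply: (@Ck_mul V k U (cst ((-1) ^+ (j + i)))
      (fun x => \det (row' j (col' i (A x)))) oU); first exact: Ck_cst.
    apply: Ck_det => //; apply: Ck_mx => // u v.
    apply: Ck_eq (Ck_coord (lift j u) (lift i v) oU cA) => // x _.
    by rewrite !mxE.
  by apply: Ck_eq H => // x _; rewrite mxE.
apply: Ck_eq (Ck_mul oU cdet cadj) => // x; rewrite inE => Ux.
by rewrite /invmx uA// !mxE.
Qed.

End Ck.

(** * Mean value theorem along segments and symmetry of second derivatives *)

Section C1.
Context {R : realType}.
Implicit Types (V W : normedModType R).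

Lemma is_derive_line V W (g : V -> W) (x w : V) (s : R) : differentiable g (x + s *: w) ->
  is_derive (s : R^o) (1 : R^o) (fun s => g (x + s *: w)) ('D_w g (x + s *: w)).
Proof.
move=> dg; pose l (s : R^o) : V := x + s *: w.
have dz : differentiable (fun s : R^o => s *: w) (s : R^o) by [].
have dz1 : 'D_1 (fun s : R^o => s *: w) (s : R^o) = w.
  by rewrite (deriveE _ dz) diff_val scale1r.
have dl : differentiable l (s : R^o).
  by apply: differentiableD => //; exact: differentiable_cst.
have dl1 : 'D_1 l (s : R^o) = w.
  rewrite /l deriveD; [|exact: derivable_cst|exact: diff_derivable].
  by rewrite derive_cst add0r dz1.
have dgl : differentiable (g \o l) (s : R^o) by exact: differentiable_comp.
apply: DeriveDef; first exact/diff_derivable.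
rewrite -[LHS]/('D_1 (g \o l) (s : R^o)).
by rewrite (deriveE _ dgl) (diff_comp dl dg) /= -(deriveE _ dl) dl1 (deriveE _ dg).
Qed.

Lemma MVT_line V (g : V -> R^o) (x w : V) (h : R) : 0 < h ->
  (forall s, 0 <= s <= h -> differentiable g (x + s *: w)) ->
  exists2 s, 0 < s < h &
    (g (x + h *: w) : R) - (g x : R) = h * ('D_w g (x + s *: w) : R).
Proof.
move=> h0 dg.
have [||s sh E] := @MVT R (fun s => g (x + s *: w)) (fun s => 'D_w g (x + s *: w)) 0 h h0.
- move=> s; rewrite in_itv/= => /andP[s0 sh]; apply: is_derive_line; apply: dg.
  by rewrite !ltW.
- apply/subspace_continuousP => s /=; rewrite in_itv/= => sh.
  apply: cvg_within_filter.
  have [ds _] := is_derive_line (dg s sh).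
  by apply/differentiable_continuous/derivable1_diffP.
exists s; first by move: sh; rewrite in_itv.
by move: E; rewrite scale0r addr0 subr0 mulrC.
Qed.

Lemma dist_half (r s t e : R) : `|r - t| < e / 2 -> `|s - t| < e / 2 -> `|r - s| <= e.
Proof.
move=> rt st; rewrite -[r - s](subrKA t) (splitr e) (le_trans (ler_normD _ _))//.
by rewrite ltW// ltrD// distrC.
Qed.

Lemma derive_translate V W (f : V -> W) (c x u : V) :
  'D_u (fun y => f (y + c)) x = 'D_u f (x + c).
Proof.
rewrite /derive; set F := (fun h => _); set G := (fun h => _ : W).
by suff -> : F = G by []; apply/funext => h; rewrite /F /G /= addrA.
Qed.

(** Schwarz's theorem. By two applications of the mean value theorem, the second difference of [f]
    over the parallelogram with sides [h *: u] and [h *: v] is [h ^+ 2] times a mixed derivative at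
    a nearby point. It is symmetric in [u] and [v], and both mixed derivatives are continuous at
    [x]. *)
Lemma derive_comm V (f : V -> R^o) (U : set V) (x u v : V) : open U -> U x ->
  Ck_on 2 U f -> 'D_u ('D_v f) x = 'D_v ('D_u f) x.
Proof.
move=> oU Ux [df Df].
have key : forall (u v : V) (d : R), 0 < d -> ball x d `<=` U ->
    forall h : R, 0 < h -> h * (`|u| + `|v|) < d ->
    exists2 y, ball x d y & (f (x + h *: u + h *: v) : R) - (f (x + h *: u) : R)
      - (f (x + h *: v) : R) + (f x : R) = h ^+ 2 * ('D_v ('D_u f) y : R).
  move=> {}u {}v d d0 bU h h0 hd.
  have B s t : 0 <= s <= h -> 0 <= t <= h -> ball x d (x + s *: u + t *: v).
    move=> /andP[s0 sh] /andP[t0 th]; rewrite -ball_normE /= -addrA opprD addrA subrr add0r normrN.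
    apply: le_lt_trans hd; apply: (le_trans (ler_normD _ _)).
    by rewrite !normrZ !ger0_norm// mulrDr lerD// ler_wpM2r.
  have h00 : 0 <= (0 : R) <= h by rewrite lexx ltW.
  have hh : 0 <= h <= h by rewrite lexx ltW.
  have B1 s : 0 <= s <= h -> ball x d (x + s *: u).
    by move=> sh; have := B s 0 sh h00; rewrite scale0r addr0.
  pose g y := f (y + h *: v) - f y : R^o.
  have dgv s : 0 <= s <= h -> differentiable (fun y => f (y + h *: v)) (x + s *: u).
    move=> sh; apply: (@differentiable_comp _ _ _ _ (fun y => y + h *: v) f).
      by apply: differentiableD.
    by apply/df/bU/B.
  have [s sh gE] : exists2 s, 0 < s < h &
      (g (x + h *: u) : R) - (g x : R) = h * ('D_u g (x + s *: u) : R).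
    apply: MVT_line => // s sh; apply: differentiableB; first exact: dgv.
    exact/df/bU/B1.
  have {}sh : 0 <= s <= h by move: sh => /andP[? ?]; rewrite !ltW.
  have DgE : 'D_u g (x + s *: u) =
      ('D_u f (x + s *: u + h *: v) : R) - ('D_u f (x + s *: u) : R).
    have df1 : differentiable f (x + s *: u) by exact/df/bU/B1.
    rewrite /g deriveB; [|exact/diff_derivable/dgv|exact: diff_derivable].
    by rewrite derive_translate.
  have [t th E2] : exists2 t, 0 < t < h &
      ('D_u f (x + s *: u + h *: v) : R) - ('D_u f (x + s *: u) : R)
      = h * ('D_v ('D_u f) (x + s *: u + t *: v) : R).
    have [dDf _] := Df u; apply: (@MVT_line V ('D_u f) (x + s *: u) v h h0) => t th.
    by apply: dDf; apply: bU; apply: B.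
  exists (x + s *: u + t *: v).
    by apply: B => //; move: th => /andP[? ?]; rewrite !ltW.
  rewrite expr2 -mulrA -E2 -DgE -gE /g.
  by rewrite opprB [x + h *: v]addrC; ring.
apply/eqP; rewrite -subr_eq0 -normr_le0; apply/ler_addgt0Pr => e e0; rewrite add0r.
have e2 : 0 < e / 2 by rewrite divr_gt0.
have cD : forall u v : V, {for x, continuous ('D_u ('D_v f))}.
  by move=> u' v'; have [_ DD] := Df v'; exact: DD.
have /cvgrPdist_lt/(_ _ e2)/nbhs_ballP[d1 d10 H1] := cD u v.
have /cvgrPdist_lt/(_ _ e2)/nbhs_ballP[d2 d20 H2] := cD v u.
have [d3 d30 H3] : nbhs_ball x U by apply/nbhs_ballP; exact: open_near.
pose d := Num.min d1 (Num.min d2 d3).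
have d0 : 0 < d by rewrite !lt_min d10 d20.
have bd e' : d <= e' -> ball x d `<=` ball x e' by exact: le_ball.
(* The summand 1 keeps the denominator positive when [u] and [v] vanish. *)
pose h := d / (2 * (`|u| + `|v| + 1)).
have n0 : 0 < `|u| + `|v| + 1 by rewrite ltr_wpDl.
have h0 : 0 < h by rewrite divr_gt0// mulr_gt0.
have hd : h * (`|u| + `|v|) < d.
  rewrite /h -mulrA gtr_pMr// mulrC ltr_pdivrMr ?mulr_gt0// mul1r.
  have := normr_ge0 u; have := normr_ge0 v; lra.
have bU : ball x d `<=` U.
  by apply: subset_trans H3; apply: bd; rewrite !ge_min lexx !orbT.
have [y1 b1 E1] := key u v d d0 bU h h0 hd.
have [y2 b2 E2] : exists2 y, ball x d y &
    (f (x + h *: v + h *: u) : R) - (f (x + h *: v) : R)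
      - (f (x + h *: u) : R) + (f x : R) = h ^+ 2 * ('D_u ('D_v f) y : R).
  by apply: key => //; rewrite addrC.
have EE : 'D_v ('D_u f) y1 = 'D_u ('D_v f) y2.
  have hn : h ^+ 2 != 0 by rewrite expf_neq0// gt_eqF.
  rewrite [x + h *: v + _]addrAC [X in X + _ = _]addrAC in E2.
  exact: (mulfI hn (etrans (esym E1) E2)).
have D1 : `|'D_u ('D_v f) x - 'D_u ('D_v f) y2| < e / 2.
  by apply: H1; apply: bd b2; rewrite ge_min lexx.
have D2 : `|'D_v ('D_u f) x - 'D_v ('D_u f) y1| < e / 2.
  by apply: H2; apply: bd b1; rewrite !ge_min lexx orbT.
rewrite EE in D2; exact: dist_half D1 D2.
Qed.

End C1.

(** * Composition of curves with maps of class C^1 *)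

Section CurveCalculus.
Context {R : realType}.
Implicit Types (U V W : normedModType R) (a b c d t : R).

Lemma derive_rV_sum n W (g : 'rV[R]_n -> W) (x w : 'rV[R]_n) : differentiable g x ->
  'D_w g x = \sum_l w 0 l *: 'D_(delta_mx 0 l) g x.
Proof.
move=> dg; rewrite (deriveE w dg) [in LHS](row_sum_delta w) linear_sum.
by apply: eq_bigr => l _; rewrite linearZ (deriveE _ dg).
Qed.

Lemma derive_chain U V W (f : U -> V) (g : V -> W) x v : differentiable f x ->
  differentiable g (f x) -> 'D_v (g \o f) x = 'D_('D_v f x) g (f x).
Proof.
move=> df dg; rewrite (deriveE v (differentiable_comp df dg)) (diff_comp df dg) /=.
by rewrite -(deriveE v df) -(deriveE _ dg).
Qed.

Lemma norm_le_near V (u v : V) (r : R) : `|u - v| < r -> `|v| <= `|u| + r.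
Proof.
move=> uv; rewrite -[X in `|X|](subrK u) addrC (le_trans (ler_normD _ _))// lerD2l.
by rewrite ltW// distrC.
Qed.

(** Near [x] the partial derivatives are bounded by continuity; since balls are convex, the mean
    value theorem applies along segments, entry by entry. *)
Lemma Ck1_lipschitz n p q (U : set 'rV[R]_n) (g : 'rV[R]_n -> 'M[R]_(p, q)) x :
  open U -> U x -> Ck_on 1 U g ->
  exists2 d : R, 0 < d & exists K : R, forall y z, ball x d y -> ball x d z ->
    `|g y - g z| <= K * `|y - z|.
Proof.
move=> oU Ux [dg Dg].
have H : \forall y \near x, forall l,
    `|'D_(delta_mx 0 l) g y| <= `|'D_(delta_mx 0 l) g x| + 1.
  have := @filter_forall _ 'I_n (fun l y =>
    `|'D_(delta_mx 0 l) g y| <= `|'D_(delta_mx 0 l) g x| + 1) (nbhs x) _.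
  apply=> l.
  have /cvgrPdist_lt/(_ _ ltr01) := Dg (delta_mx 0 l) x Ux.
  by apply: filterS => y; exact: norm_le_near.
have : \forall y \near x, U y /\ forall l,
    `|'D_(delta_mx 0 l) g y| <= `|'D_(delta_mx 0 l) g x| + 1.
  by apply: filterS2 (open_near oU Ux) H => y; split.
move=> /nbhs_ballP[d /= d0 dP].
exists d => //; exists (\sum_l (`|'D_(delta_mx 0 l) g x| + 1)) => y z by_ bz.
have seg s : 0 <= s <= 1 -> ball x d (z + s *: (y - z)).
  move=> /andP[s0 s1]; move: by_ bz; rewrite -!ball_normE /= => by_ bz.
  have -> : x - (z + s *: (y - z)) = (1 - s) *: (x - z) + s *: (x - y).
    have -> : s *: (x - y) = s *: (x - z) - s *: (y - z).
      by rewrite -scalerBr opprB addrA subrK.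
    by rewrite scalerBl scale1r addrA subrK opprD addrA.
  have : s = 0 \/ 0 < s by case: ltgtP s0 => // [? _|->]; [right|left].
  move=> [->|s0'].
    by rewrite subr0 scale1r scale0r addr0.
  apply: (le_lt_trans (ler_normD _ _)); rewrite !normrZ ger0_norm ?subr_ge0// gtr0_norm//.
  have : (1 - s) * `|x - z| <= (1 - s) * d by rewrite ler_wpM2l ?subr_ge0// ltW.
  have : s * `|x - y| < s * d by rewrite ltr_pM2l.
  lra.
rewrite mulr_suml.
apply: norm_mx_le => [|i j].
  by apply: sumr_ge0 => l _; rewrite mulr_ge0// addr_ge0.
have dgs s : 0 <= s <= 1 -> differentiable g (z + s *: (y - z)).
  by move=> /seg/dP[Us _]; exact: dg.
have [s s01] : exists2 s, 0 < s < 1 &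
    (g (z + 1 *: (y - z)) i j : R) - g z i j = 1 * 'D_(y - z) (fun x => g x i j : R^o) (z + s *: (y - z)).
  apply: (@MVT_line _ _ (fun x => g x i j : R^o)) => // s /dgs gs.
  by apply: (@differentiable_comp _ _ _ _ g (fun M => M i j : R^o)) => //; exact: differentiable_coord.
have {}s01 : 0 <= s <= 1 by move: s01 => /andP[? ?]; rewrite !ltW.
rewrite scale1r [z + (y - z)]addrC subrK mul1r.
have -> : (g y - g z) i j = g y i j - g z i j by rewrite !mxE.
move=> ->.
have -> : 'D_(y - z) (fun x => g x i j : R^o) (z + s *: (y - z)) =
  ('D_(y - z) g (z + s *: (y - z))) i j.
  by rewrite [in RHS]derive_mx ?mxE//; exact/diff_derivable/dgs.
apply: (le_trans (norm_mx_coord _ _ _)); rewrite (derive_rV_sum _ (dgs _ s01)).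
apply: (le_trans (ler_norm_sum _ _ _)); apply: ler_sum => l _.
rewrite normrZ mulrC; apply: ler_pM => //; last exact: norm_mx_coord.
by have [_] := dP _ (seg _ s01); exact.
Qed.

(** A C^1 map is only locally Lipschitz, so absolute continuity is obtained on short intervals and
    glued. *)
Lemma ac_comp n p q (U : set 'rV[R]_n) (g : 'rV[R]_n -> 'M[R]_(p, q))
    (x : R -> 'rV[R]_n) a b : a <= b -> open U -> Ck_on 1 U g ->
  abs_continuous a b x -> (forall t, a <= t <= b -> U (x t)) ->
  abs_continuous a b (g \o x).
Proof.
move=> ab oU cg acx xU.
apply: (@interval_ind _ (fun c d => abs_continuous c d (g \o x))) => //.
  by move=> c d e ac cd de eb; exact: ac_cat.
move=> t tab; have [d d0 [K gK]] := Ck1_lipschitz oU (xU t tab) cg.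
have [r r0 xr] := ac_continuous_at acx tab d0.
exists r => // c e ac ce eb ct et.
apply: (ac_dom1 (K := K) _ (ac_sub ac eb acx)) => s u cs su ue.
have B v : c <= v -> v <= e -> ball (x t) d (x v).
  move=> cv ve; rewrite -ball_normE /= distrC; apply: xr.
    by rewrite (le_trans ac cv) (le_trans ve eb).
  move: ct et; rewrite !ltr_norml => /andP[? ?] /andP[? ?].
  by apply/andP; split; lra.
by apply: gK; apply: B => //; [exact: le_trans su|exact: le_trans ue].
Qed.

Lemma bounded_along (F : R -> R) a b : a <= b ->
  (forall t, a <= t <= b -> exists2 r : R, 0 < r & exists M, forall s,
    a <= s <= b -> `|s - t| < r -> F s <= M) ->
  exists M, forall t, a <= t <= b -> F t <= M.
Proof.
move=> ab H.
apply: (@interval_ind _ (fun c d => exists M, forall t, c <= t <= d -> F t <= M)) => //.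
  move=> c d e ac cd de eb [M1 H1] [M2 H2]; exists (Num.max M1 M2) => t /andP[ct te].
  rewrite le_max; have [td|/ltW dt] := leP t d; first by rewrite H1// ct.
  by rewrite H2 ?orbT// dt.
move=> t /H[r r0 [M HM]]; exists r => // c d ac cd db ct dt; exists M => s /andP[cs sd].
apply: HM; first by rewrite (le_trans ac cs) (le_trans sd db).
move: ct dt; rewrite !ltr_norml => /andP[? ?] /andP[? ?].
by apply/andP; split; lra.
Qed.

Lemma bounded_comp V W (U : set V) (g : V -> W) (x : R -> V) a b : a <= b ->
  (forall y, U y -> {for y, continuous g}) ->
  abs_continuous a b x -> (forall t, a <= t <= b -> U (x t)) ->
  exists M, forall t, a <= t <= b -> `|g (x t)| <= M.
Proof.
move=> ab cg acx xU; apply: bounded_along => // t tab.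
have /cvgrPdist_lt/(_ _ ltr01)/nbhs_ballP[d /= d0 dP] := cg _ (xU t tab).
have [r r0 xr] := ac_continuous_at acx tab d0.
exists r => //; exists (`|g (x t)| + 1) => s sab st.
apply: norm_le_near; apply: dP; rewrite -ball_normE /= distrC; exact: xr.
Qed.

Lemma curve_comp V W (x : R -> V) (g : V -> W) t : derivable x t 1 ->
  differentiable g (x t) ->
  derivable (g \o x) t 1 /\ derive1 (g \o x) t = 'D_(derive1 x t) g (x t).
Proof.
move=> /derivable1_diffP dx dg.
have dgx : differentiable (g \o x) t by exact: differentiable_comp.
split; first exact/derivable1_diffP.
by rewrite (derive1E' dgx) (diff_comp dx dg) /= -(derive1E' dx) (deriveE _ dg).
Qed.

End CurveCalculus.

(** * Product rule for matrices *)

Section DeriveMulmx.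
Context {R : realType} {V : normedModType R}.

Lemma is_derive_mulmx m n p (A : V -> 'M[R]_(m, n)) (B : V -> 'M[R]_(n, p)) (x v : V) :
  derivable A x v -> derivable B x v ->
  is_derive x v (fun y => A y *m B y) ('D_v A x *m B x + A x *m 'D_v B x).
Proof.
move=> dA dB.
have dAij i l : derivable (fun y => A y i l : R^o) x v by move/derivable_mxP : dA; exact.
have dBij l j : derivable (fun y => B y l j : R^o) x v by move/derivable_mxP : dB; exact.
have aux (r s t u : R) : r * s + t * u = u * t + r * s by ring.
have H i j : is_derive x v (fun y => (A y *m B y) i j : R^o)
    (('D_v A x *m B x + A x *m 'D_v B x) i j).
  have E : (fun y => (A y *m B y) i j : R^o) =
      \sum_(l < n) ((fun y => A y i l : R^o) * (fun y => B y l j : R^o)).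
    by apply/funext => y; rewrite mxE fct_sumE.
  rewrite E; apply: DeriveDef.
    by apply: derivable_sum => l; exact: derivableM.
  rewrite derive_sum; last by move=> l; exact: derivableM.
  rewrite !mxE -big_split /=; apply: eq_bigr => l _.
  rewrite deriveM// !derive_mx// !mxE.
  exact: aux.
have dM : derivable (fun y => A y *m B y) x v.
  by apply/derivable_mxP => i j; have [] := H i j.
apply: DeriveDef => //; rewrite derive_mx//.
by apply/matrixP => i j; rewrite mxE; exact: derive_val.
Qed.

Lemma derive_mulmx m n p (A : V -> 'M[R]_(m, n)) (B : V -> 'M[R]_(n, p)) (x v : V) :
  derivable A x v -> derivable B x v ->
  'D_v (fun y => A y *m B y) x = 'D_v A x *m B x + A x *m 'D_v B x.
Proof. by move=> dA dB; have [] := is_derive_mulmx dA dB. Qed.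

Lemma derivable_trmx m n (A : V -> 'M[R]_(m, n)) (x v : V) :
  derivable A x v -> derivable (fun y => (A y)^T) x v.
Proof.
move=> /derivable_mxP dA; apply/derivable_mxP => i j.
suff -> : (fun y => (A y)^T i j) = (fun y => A y j i) by exact: dA.
by apply/funext => y; rewrite mxE.
Qed.

Lemma derive_trmx m n (A : V -> 'M[R]_(m, n)) (x v : V) :
  derivable A x v -> 'D_v (fun y => (A y)^T) x = ('D_v A x)^T.
Proof.
move=> dA; rewrite !derive_mx//; last exact: derivable_trmx.
apply/matrixP => i j; rewrite !mxE; congr ('D_v _ x).
by apply/funext => y; rewrite mxE.
Qed.

Lemma derive_mulmxl m n p (C : 'M[R]_(m, n)) (B : V -> 'M[R]_(n, p)) (x v : V) :
  derivable B x v -> 'D_v (fun y => C *m B y) x = C *m 'D_v B x.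
Proof.
move=> dB; have := derive_mulmx (derivable_cst C x v) dB.
by rewrite derive_cst mul0mx add0r.
Qed.

End DeriveMulmx.

(** * Charts and the vertical projection in coordinates *)

Section ChartTopology.
Context {R : realType} {M : topologicalType} {n : nat}.
Implicit Types (phi psi : chart R M n) (q : M).

Definition cimg phi : set 'rV[R]_n := cmap phi @` cdom phi.

Lemma cimgP phi q : cdom phi q -> cimg phi (cmap phi q).
Proof. by exists q. Qed.

Lemma cinv_dom phi y : cimg phi y -> cdom phi (cinv phi y).
Proof. by move=> [q dq <-]; rewrite cmapK. Qed.

Lemma cinvK phi y : cimg phi y -> cmap phi (cinv phi y) = y.
Proof. by move=> [q dq <-]; rewrite cmapK. Qed.

Lemma cinv_continuous phi y : cimg phi y -> {for y, continuous (cinv phi)}.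
Proof.
move=> iy; have /subspace_continuousP/(_ y iy) := @cinv_cont _ _ _ phi.
rewrite /prop_for /continuous_at within_interior//.
exact: open_nbhs_nbhs (conj (@cimg_open _ _ _ phi) iy).
Qed.

Lemma near_cimg phi q : cdom phi q -> \forall y \near cmap phi q, cimg phi y.
Proof. by move=> dq; apply: (open_near (@cimg_open _ _ _ phi)); exists q. Qed.

Lemma near_cdom phi q : cdom phi q -> \forall q' \near q, cdom phi q'.
Proof. by move=> dq; exact: open_nbhs_nbhs (conj (@cdom_open _ _ _ phi) dq). Qed.

Lemma near_cinv phi q (A : set M) : cdom phi q -> nbhs q A ->
  \forall y \near cmap phi q, A (cinv phi y).
Proof.
move=> dq; have := cinv_continuous (cimgP dq).
by rewrite /prop_for /continuous_at cmapK// => /[apply].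
Qed.

Lemma cimg_sub_open phi (A : set M) : open A -> open (cmap phi @` (cdom phi `&` A)).
Proof.
move=> oA; rewrite openE => _ [q [dq Aq] <-].
have nA : nbhs q A by exact: open_nbhs_nbhs.
apply: filterS2 (near_cinv dq nA) (near_cimg dq) => y Ay iy.
by exists (cinv phi y); [split => //; exact: cinv_dom|exact: cinvK].
Qed.

End ChartTopology.

(** * Transition maps and their Jacobians *)

Section Transitions.
Context {R : realType} {Q : manifold R}.
Notation n := (Defs.dim Q).
Implicit Types (phi psi chi : chart R Q n) (q : Q) (v : 'rV[R]_n).

Definition trans phi psi : 'rV[R]_n -> 'rV[R]_n := cmap psi \o cinv phi.

Definition overlap phi psi : set 'rV[R]_n := cmap phi @` (cdom phi `&` cdom psi).

Lemma overlap_open phi psi : open (overlap phi psi).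
Proof. exact/cimg_sub_open/cdom_open. Qed.

Lemma overlapP phi psi q : cdom phi q -> cdom psi q -> overlap phi psi (cmap phi q).
Proof. by move=> dq dq'; exists q. Qed.

Lemma trans_smooth phi psi : atlas Q phi -> atlas Q psi ->
  smooth_on (overlap phi psi) (trans phi psi).
Proof. exact: transition_smooth. Qed.

Lemma transE phi psi q : cdom phi q -> trans phi psi (cmap phi q) = cmap psi q.
Proof. by move=> dq; rewrite /trans /= cmapK. Qed.

Lemma trans_differentiable phi psi q : atlas Q phi -> atlas Q psi -> cdom phi q ->
  cdom psi q -> differentiable (trans phi psi) (cmap phi q).
Proof.
move=> aphi apsi dphi dpsi; have [d _] := trans_smooth aphi apsi 1.
exact/d/overlapP.
Qed.

Definition jacf phi psi (y : 'rV[R]_n) : 'M[R]_n := lin1_mx ('d (trans phi psi) y).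

Lemma mul_jacf_diff phi psi (y v : 'rV[R]_n) :
  v *m jacf phi psi y = 'd (trans phi psi) y v.
Proof. by rewrite /jacf mul_rV_lin1. Qed.

Lemma mul_jacf phi psi (y v : 'rV[R]_n) : differentiable (trans phi psi) y ->
  v *m jacf phi psi y = 'D_v (trans phi psi) y.
Proof. by move=> d; rewrite (deriveE v d) mul_jacf_diff. Qed.

Definition jac phi psi q : 'M[R]_n := jacf phi psi (cmap phi q).

Lemma jacE phi psi q : jac phi psi q = jacf phi psi (cmap phi q).
Proof. by []. Qed.

Lemma mul_jac phi psi q v : differentiable (trans phi psi) (cmap phi q) ->
  v *m jac phi psi q = 'D_v (trans phi psi) (cmap phi q).
Proof. exact: mul_jacf. Qed.

Lemma tcoordE phi q v : tcoord phi q v = v *m jac (chart_at q) phi q.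
Proof. by rewrite mul_jacf_diff. Qed.

Lemma of_tcoordE phi q v : of_tcoord phi q v = v *m jac phi (chart_at q) q.
Proof. by rewrite mul_jacf_diff. Qed.

Lemma jacf_coord phi psi y i j : differentiable (trans phi psi) y ->
  jacf phi psi y i j = 'D_(delta_mx 0 i) (trans phi psi) y 0 j.
Proof. by move=> /(mul_jacf (delta_mx 0 i)) E; rewrite -E -rowE [RHS]mxE. Qed.

(* Keeps the unifier from unfolding differentials. *)
Opaque jac jacf.

Lemma jac_id phi q : cdom phi q -> jac phi phi q = 1%:M.
Proof.
move=> dq; apply/row_matrixP => i; rewrite !rowE mulmx1.
have nid : \forall y \near cmap phi q, trans phi phi y = id y.
  by apply: filterS (near_cimg dq) => y iy; rewrite /trans /= cinvK.
have dt : differentiable (trans phi phi) (cmap phi q).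
  by have [] := near_eq_diff (filterS (fun _ => esym) nid) (ex_diff (is_diff_def := is_diff_id _)).
by rewrite mul_jac// (near_eq_derive _ nid) derive_id.
Qed.

(** The chain rule; as row vectors are multiplied on the right, charts compose from left to
    right. *)
Lemma jac_mul phi psi chi q : atlas Q phi -> atlas Q psi -> atlas Q chi ->
  cdom phi q -> cdom psi q -> cdom chi q ->
  jac phi psi q *m jac psi chi q = jac phi chi q.
Proof.
move=> aphi apsi achi dphi dpsi dchi.
have d1 := trans_differentiable aphi apsi dphi dpsi.
have d2 : differentiable (trans psi chi) (trans phi psi (cmap phi q)).
  by rewrite transE//; exact: trans_differentiable.
have nE : \forall y \near cmap phi q, trans phi chi y = (trans psi chi \o trans phi psi) y.
  apply: filterS2 (near_cimg dphi) (near_cinv dphi (near_cdom dpsi)) => y iy dy.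
  by rewrite /trans /= cmapK.
apply/row_matrixP => i; rewrite [LHS]rowE [RHS]rowE mulmxA; set u := delta_mx 0 i.
have E1 : u *m jac phi psi q = 'D_u (trans phi psi) (cmap phi q) by exact: mul_jac.
have E2 : u *m jac phi chi q = 'D_u (trans phi chi) (cmap phi q).
  by apply: mul_jac; exact: trans_differentiable.
rewrite [RHS]E2.
rewrite [RHS](near_eq_derive u nE).
rewrite [RHS](derive_chain u d1 d2).
rewrite -E1 (transE psi dphi).
by apply: mul_jac; exact: trans_differentiable.
Qed.

Lemma jacf_smooth phi psi : atlas Q phi -> atlas Q psi ->
  smooth_on (overlap phi psi) (jacf phi psi).
Proof.
move=> aphi apsi k; have oO := @overlap_open phi psi.
have [d D] := trans_smooth aphi apsi k.+1.
apply: Ck_mx => // i j; apply: (Ck_eq oO) (Ck_coord 0 j oO (D (delta_mx 0 i))) => y.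
by rewrite inE => Oy; rewrite jacf_coord//; exact: d.
Qed.

(* Symmetry of the second derivatives of the transition map. *)
Lemma jacf_sym phi psi y (u v : 'rV[R]_n) : atlas Q phi -> atlas Q psi -> overlap phi psi y ->
  u *m 'D_v (jacf phi psi) y = v *m 'D_u (jacf phi psi) y.
Proof.
move=> aphi apsi Oy; have oO := @overlap_open phi psi.
have C2 := trans_smooth aphi apsi 2.
have [d1 _] := trans_smooth aphi apsi 1.
have [dJ _] := jacf_smooth aphi apsi 1.
apply/rowP => j.
suff E u' v' : (u' *m 'D_v' (jacf phi psi) y) 0 j =
    'D_v' ('D_u' (fun y => trans phi psi y 0 j : R^o)) y.
  apply: (etrans (E u v)); apply: (etrans _ (esym (E v u))).
  exact: (derive_comm _ _ oO Oy (Ck_coord 0 j oO C2)).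
have dJv : derivable (jacf phi psi) y v' by exact/diff_derivable/dJ.
have dc (f : 'rV[R]_n -> 'rV[R]_n) w : derivable f y w ->
    ('D_w f y) 0 j = 'D_w (fun y => f y 0 j : R^o) y.
  by move=> df; rewrite derive_mx// mxE.
rewrite -(derive_mulmxl u' dJv) dc; last first.
  by have [] := is_derive_mulmx (derivable_cst u' y v') dJv.
apply: near_eq_derive; apply: filterS (open_near oO Oy) => z Oz.
rewrite (mul_jacf _ (d1 z Oz)).
by rewrite derive_mx ?mxE//; exact/diff_derivable/d1.
Qed.

End Transitions.

Lemma mulmx_conj (R : comPzRingType) n (a b g a' b' L : 'M[R]_n) :
  b *m g = b' -> g *m a' = a -> a *m L *m b *m g = g *m (a' *m L *m b').
Proof. by move=> <- <-; rewrite !mulmxA. Qed.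

Section TangentCoordinates.
Context {R : realType} {Q : manifold R}.
Notation n := (Defs.dim Q).
Implicit Types (phi psi : chart R Q n) (q : Q).

Lemma tcoordK phi q : atlas Q phi -> cdom phi q ->
  cancel (tcoord phi q) (of_tcoord phi q).
Proof.
move=> aphi dq v; have [ac dc] := (chart_at_atlas q, chart_at_dom q).
by rewrite of_tcoordE tcoordE -mulmxA jac_mul ?jac_id ?mulmx1.
Qed.

Lemma of_tcoordK phi q : atlas Q phi -> cdom phi q ->
  cancel (of_tcoord phi q) (tcoord phi q).
Proof.
move=> aphi dq v; have [ac dc] := (chart_at_atlas q, chart_at_dom q).
by rewrite of_tcoordE tcoordE -mulmxA jac_mul ?jac_id ?mulmx1.
Qed.

Lemma tcoord_center q v : tcoord (chart_at q) q v = v.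
Proof. by rewrite tcoordE jac_id ?mulmx1//; exact: chart_at_dom. Qed.

Lemma of_tcoord_center q v : of_tcoord (chart_at q) q v = v.
Proof. by rewrite of_tcoordE jac_id ?mulmx1//; exact: chart_at_dom. Qed.

Lemma of_tcoordB phi q u v :
  of_tcoord phi q (u - v) = of_tcoord phi q u - of_tcoord phi q v.
Proof. by rewrite !of_tcoordE mulmxBl. Qed.

End TangentCoordinates.

(** * The vertical projection and local splittings *)

Section Splitting.
Context {R : realType} {Q M : manifold R} (pi : Q -> M).
Variable H : Q -> {vspace tangent R Q}.
Hypothesis pi_sub : surjective_submersion pi.
Hypothesis H_conn : ehresmann_connection pi H.
Notation n := (Defs.dim Q).
Notation m := (Defs.dim M).
Notation vert := (vertical pi).
Notation prV := (prV pi H).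
Implicit Types (phi psi : chart R Q n) (q : Q) (v : 'rV[R]_n).

Lemma prV_unique q u v : v \in vert q -> u - v \in H q -> prV q u = v.
Proof.
move=> vV uvH; have [_ _ HV0] := H_conn.
have VH0 : (vert q :&: H q)%VS = 0%VS by rewrite capvC.
rewrite -[u](subrK v) /Defs.prV linearD /= (daddv_pi_id VH0 vV).
have HE := daddv_pi_add (HV0 q) (subvP (addvSl _ _) _ uvH).
rewrite (daddv_pi_id (HV0 q) uvH) in HE.
suff -> : daddv_pi (vert q) (H q) (u - v) = 0 by rewrite add0r.
by apply: (addrI (u - v)); rewrite addr0.
Qed.

Lemma prV_vert q u : prV q u \in vert q.
Proof. exact: memv_pi. Qed.

Lemma prV_hor q u : u - prV q u \in H q.
Proof.
have [_ HV HV0] := H_conn.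
have := daddv_pi_add (HV0 q) (w := u); rewrite HV memvf => /(_ isT) e.
rewrite -[X in X - _]e addrK; exact: memv_pi.
Qed.

Definition PV phi q : 'M[R]_n :=
  jac phi (chart_at q) q *m lin1_mx (daddv_pi (vert q) (H q)) *m jac (chart_at q) phi q.

Lemma mul_PV phi q v : v *m PV phi q = tcoord phi q (prV q (of_tcoord phi q v)).
Proof. rewrite /PV !mulmxA tcoordE of_tcoordE /Defs.prV; congr (_ *m _). exact: mul_rV_lin1. Qed.

Lemma PV_jac phi psi q : atlas Q phi -> atlas Q psi -> cdom phi q -> cdom psi q ->
  PV phi q *m jac phi psi q = jac phi psi q *m PV psi q.
Proof.
move=> aphi apsi dphi dpsi.
have [ac dc] := (chart_at_atlas q, chart_at_dom q).
have E1 := jac_mul ac aphi apsi dc dphi dpsi.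
have E2 := jac_mul aphi apsi ac dphi dpsi dc.
exact: mulmx_conj E1 E2.
Qed.

Lemma mulPV_eq0 phi q v : atlas Q phi -> cdom phi q ->
  v *m PV phi q = 0 <-> of_tcoord phi q v \in H q.
Proof.
move=> aphi dq; rewrite mul_PV; split => [E|hv].
  have := prV_hor q (of_tcoord phi q v).
  have -> : prV q (of_tcoord phi q v) = 0; last by rewrite subr0.
  by rewrite -(tcoordK aphi dq (prV _ _)) E of_tcoordE mul0mx.
by rewrite (prV_unique (mem0v _)) ?subr0// tcoordE mul0mx.
Qed.

Lemma mulPV_id phi q v : atlas Q phi -> cdom phi q ->
  v *m PV phi q = v <-> of_tcoord phi q v \in vert q.
Proof.
move=> aphi dq; rewrite mul_PV; split => [E|hv].
  by rewrite -{1}E tcoordK//; exact: prV_vert.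
by rewrite (prV_unique hv) ?subrr ?mem0v// of_tcoordK.
Qed.

Lemma PV_idem phi q : atlas Q phi -> cdom phi q -> PV phi q *m PV phi q = PV phi q.
Proof.
move=> aphi dq; apply/row_matrixP => i; rewrite [LHS]rowE [RHS]rowE mulmxA.
apply/(mulPV_id _ aphi dq); rewrite mul_PV tcoordK//; exact: prV_vert.
Qed.

Definition picoord psi (chi : chart R M m) : 'rV[R]_n -> 'rV[R]_m :=
  cmap chi \o pi \o cinv psi.

Lemma pi_continuous q : {for q, continuous pi}.
Proof. by have [[cpi _] _ _] := pi_sub; exact: cpi. Qed.

Lemma tangent_mapE q v : tangent_map pi q v =
  'D_v (picoord (chart_at q) (chart_at (pi q))) (cmap (chart_at q) q).
Proof.
have [[_ spi] _ _] := pi_sub.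
have [U [oU Uq] /(_ 1)[d _]] := spi q.
by rewrite /tangent_map lfunE /= (deriveE v (d _ Uq)).
Qed.

(** Smoothness of [pi] is given in the central charts at [q] and [pi q]; the chain rule through them
    yields the differential in arbitrary charts. *)
Lemma derive_picoord psi (chi : chart R M m) q v : atlas Q psi -> atlas M chi ->
  cdom psi q -> cdom chi (pi q) ->
  differentiable (picoord psi chi) (cmap psi q) /\
  'D_v (picoord psi chi) (cmap psi q) =
    tcoord chi (pi q) (tangent_map pi q (of_tcoord psi q v)).
Proof.
move=> apsi achi dpsi dchi.
have [ac dc] := (chart_at_atlas q, chart_at_dom q).
have [acm dcm] := (chart_at_atlas (pi q), chart_at_dom (pi q)).
set c := chart_at q in ac dc; set cm := chart_at (pi q) in acm dcm.
have [[_ spi] _ _] := pi_sub.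
have [U [oU Uq] /(_ 1)[d _]] := spi q.
have d1 := trans_differentiable apsi ac dpsi dc.
have d2 : differentiable (picoord c cm) (trans psi c (cmap psi q)).
  by rewrite transE//; exact: d.
have d3 : differentiable (trans cm chi) ((picoord c cm \o trans psi c) (cmap psi q)).
  rewrite /= transE// /picoord /= cmapK//.
  exact: trans_differentiable.
have d12 := differentiable_comp d1 d2.
have nE : \forall y \near cmap psi q,
    (trans cm chi \o (picoord c cm \o trans psi c)) y = picoord psi chi y.
  have n1 : \forall q' \near q, cdom cm (pi q') by exact: pi_continuous (near_cdom dcm).
  apply: filterS2 (near_cinv dpsi (near_cdom dc)) (near_cinv dpsi n1) => y cy cmy.
  by rewrite /picoord /trans /= !cmapK.
split; first by have [] := near_eq_diff nE (differentiable_comp d12 d3).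
rewrite -(near_eq_derive v nE) (derive_chain v d12 d3) (derive_chain v d1 d2).
rewrite tcoordE of_tcoordE tangent_mapE (mul_jac _ d1) transE//.
rewrite /= transE// /picoord /= cmapK//.
symmetry; apply: mul_jac; exact: trans_differentiable.
Qed.

Lemma frame_span (k : nat) (X : 'I_k -> 'rV[R]_n) (U : {vspace 'rV[R]_n}) :
  basis_of U [seq X i | i : 'I_k] ->
  (forall u, u \in U <-> exists c : 'rV[R]_k, u = \sum_i c 0 i *: X i) /\
  (forall c : 'rV[R]_k, \sum_i c 0 i *: X i = 0 -> c = 0).
Proof.
have E : [seq X i | i : 'I_k] = [tuple X i | i < k] :> seq _.
  by rewrite /image_mem /=; congr (map _ _); rewrite val_ord_tuple.
rewrite E => bX; have XE (i : 'I_k) : [tuple X i | i < k]`_i = X i by rewrite -tnth_nth tnth_mktuple.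
split=> [u|c c0].
  split=> [|[c ->]].
    rewrite -(span_basis bX) => /coord_span uE.
    exists (\row_i coord [tuple X i | i < k] i u); rewrite [LHS]uE.
    by apply: eq_bigr => i _; rewrite mxE XE.
  apply: memv_suml => i _; apply: memvZ; rewrite -(span_basis bX).
  by apply: memv_span; apply/mapP; exists i => //; rewrite val_ord_tuple mem_enum.
have /freeP fX := basis_free bX; apply/rowP => i; rewrite mxE; apply: fX.
by rewrite -[RHS]c0; apply: eq_bigr => j _; rewrite XE.
Qed.

(* [D] is the differential of pi in the charts, and [G] a horizontal right inverse
   of it, so that [w *m G] is the horizontal lift of [w] and [1 - D G] the vertical
   projection. *)
Definition local_splitting q0 (W : set 'rV[R]_n) (D : 'rV[R]_n -> 'M[R]_(n, m))
    (G : 'rV[R]_n -> 'M[R]_(m, n)) : Prop :=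
  let psi := chart_at q0 in let chi := chart_at (pi q0) in
  [/\ open_nbhs (cmap psi q0) W, W `<=` cimg psi, smooth_on W D, smooth_on W G
    & forall y, W y -> let q := cinv psi y in
      [/\ cdom chi (pi q),
        forall u, u *m D y = tcoord chi (pi q) (tangent_map pi q (of_tcoord psi q u)),
        forall w, of_tcoord psi q (w *m G y) \in H q
      & D y *m G y *m D y = D y]].

(** The rows of [A] form a local frame of [H], and [A D] has independent rows because [H] meets the
    vertical space in 0. A right inverse [B] of [A D] at the base point remains one nearby up to the
    invertible factor [E = A D B], which suggests [G = B E^-1 A]. Then [D G D = D]: the row [u D]
    depends only on the horizontal part [c A] of [u], and [c A D G = c E E^-1 A = c A]. The ranks
    [k] and [m] are never compared. *)
Lemma local_splitting_exists q0 : exists W D G, local_splitting q0 W D G.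
Proof.
have [sH HV HV0] := H_conn.
have [[cpi spi] _ limgT] := pi_sub.
pose psi := chart_at q0; pose chi := chart_at (pi q0); pose x0 := cmap psi q0.
have [ac dc] : atlas Q psi /\ cdom psi q0.
  by split; [exact: chart_at_atlas|exact: chart_at_dom].
have [am dm] : atlas M chi /\ cdom chi (pi q0).
  by split; [exact: chart_at_atlas|exact: chart_at_dom].
have [U [k [X [[oU Uq0] sX bX]]]] := sH q0.
have /choice[UX UXP] : forall i, exists V : set 'rV[R]_n,
    open_nbhs x0 V /\ smooth_on V (vrep psi (X i)).
  by move=> i; have [V oV sV] := sX i q0 Uq0; exists V.
have [UF oUF sF] := spi q0.
pose A y : 'M[R]_(k, n) := \matrix_i vrep psi (X i) y.
pose D y : 'M[R]_(n, m) := \matrix_i 'D_(delta_mx 0 i) (picoord psi chi) y.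
have frame y : cimg psi y -> U (cinv psi y) ->
    (forall u, of_tcoord psi (cinv psi y) u \in H (cinv psi y) <->
       exists c : 'rV[R]_k, u = c *m A y) /\
    (forall c : 'rV[R]_k, c *m A y = 0 -> c = 0).
  move=> iy Uy; have [F1 F2] := frame_span (bX _ Uy); have dy := cinv_dom iy.
  have AE (c : 'rV[R]_k) :
      c *m A y = tcoord psi (cinv psi y) (\sum_i c 0 i *: X i (cinv psi y)).
    rewrite tcoordE mulmx_suml [LHS]mulmx_sum_row; apply: eq_bigr => i _.
    by rewrite rowK /vrep tcoordE scalemxAl.
  split=> [u|c]; first rewrite F1.
    split=> -[c uE]; exists c; first by rewrite AE -uE of_tcoordK.
    by rewrite uE AE tcoordK.
  rewrite AE => E; apply: F2.
  by rewrite -(tcoordK ac dy (\sum_i _)) E of_tcoordE mul0mx.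
(* All that is asked of a point near the base point; the interior [W1] makes this an open set, as
   smoothness requires. *)
pose P y := [/\ cimg psi y, U (cinv psi y), forall i, UX i y, UF y & cdom chi (pi (cinv psi y))].
have nP : \forall y \near x0, P y.
  have n1 : \forall y \near x0, forall i, UX i y.
    have := @filter_forall _ 'I_k (fun i y => UX i y) (nbhs x0) _; apply=> i.
    by have [ou _] := UXP i; exact: open_nbhs_nbhs.
  have n2 : \forall y \near x0, UF y by exact: open_nbhs_nbhs.
  have n3 : \forall y \near x0, cdom chi (pi (cinv psi y)).
    exact: (near_cinv (A := [set q | cdom chi (pi q)]) dc (pi_continuous (near_cdom dm))).
  have n4 : \forall y \near x0, U (cinv psi y).
    by apply: (near_cinv (A := U) dc); exact: open_nbhs_nbhs.
  have n5 := near_cimg dc.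
  by near=> y; split; near: y.
pose W1 := [set y | P y]°.
have oW1 : open W1 by exact: open_interior.
have W1P y : W1 y -> P y by exact: interior_subset.
have DE y : W1 y -> forall u, u *m D y =
    tcoord chi (pi (cinv psi y)) (tangent_map pi (cinv psi y) (of_tcoord psi (cinv psi y) u)).
  move=> /W1P[iy _ _ _ cy] u; have dy := cinv_dom iy.
  have [dpi Epi] := derive_picoord u ac am dy cy; rewrite cinvK// in dpi Epi.
  rewrite -Epi (derive_rV_sum u dpi) [LHS]mulmx_sum_row.
  by apply: eq_bigr => i _; rewrite rowK.
have sA : smooth_on W1 A.
  move=> j; apply: Ck_mx => // i l.
  apply: (@Ck_eq _ _ _ _ _ (fun y => vrep psi (X i) y 0 l : R^o)) => //.
    by move=> y _; rewrite mxE.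
  apply: Ck_coord => //; have [_ sXi] := UXP i.
  by apply: (Ck_sub _ (sXi j)) => y /W1P[_ _ + _ _]; exact.
have sD : smooth_on W1 D.
  move=> j; apply: Ck_mx => // i l.
  apply: (@Ck_eq _ _ _ _ _ (fun y => 'D_(delta_mx 0 i) (picoord psi chi) y 0 l : R^o)) => //.
    by move=> y _; rewrite mxE.
  apply: Ck_coord => //; have [_ dF] := sF j.+1.
  by apply: (Ck_sub _ (dF _)) => y /W1P[].
have W1x0 : W1 x0 by exact: nP.
have inj y : W1 y -> forall c : 'rV[R]_k, c *m (A y *m D y) = 0 -> c = 0.
  move=> Wy c; have [iy Uy _ _ cy] := W1P y Wy; have [F1 F2] := frame y iy Uy.
  have dy := cinv_dom iy.
  rewrite mulmxA (DE y Wy) => E; apply: F2.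
  have hH : of_tcoord psi (cinv psi y) (c *m A y) \in H (cinv psi y) by apply/F1; exists c.
  have : of_tcoord psi (cinv psi y) (c *m A y) \in (H (cinv psi y) :&: vert (cinv psi y))%VS.
    rewrite memv_cap hH memv_ker; apply/eqP.
    by rewrite -(tcoordK am cy (tangent_map _ _ _)) E of_tcoordE mul0mx.
  rewrite HV0 memv0 => /eqP E0.
  by rewrite -(of_tcoordK ac dy (c *m A y)) E0 tcoordE mul0mx.
pose B : 'M[R]_(m, k) := pinvmx (A x0 *m D x0).
pose E y : 'M[R]_k := A y *m D y *m B.
have Ex0 : E x0 = 1%:M by rewrite /E mulmxVp//; apply: inj_row_free; exact: inj.
have cB j : Ck_on j W1 (fun _ : 'rV[R]_n => B) by exact: Ck_cst.
have sE : smooth_on W1 E.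
  by move=> j; apply: (Ck_mulmx oW1 (Ck_mulmx oW1 (sA j) (sD j)) (cB j)).
have nE : \forall y \near x0, \det (E y) != 0.
  have cE := Ck_continuous (Ck_det oW1 (sE 0%N)) W1x0.
  have : \forall z \near (\det (E x0) : R^o), z != 0.
    by apply: open_near; [exact: open_neq|rewrite Ex0 det1 /= oner_eq0].
  exact: cE.
pose W := [set y | W1 y /\ \det (E y) != 0]°.
have oW : open W by exact: open_interior.
have WP y : W y -> W1 y /\ \det (E y) != 0 by exact: interior_subset.
have WW1 : W `<=` W1 by move=> y /WP[].
have Wx0 : W x0 by apply: filterS2 (open_near oW1 W1x0) nE => y.
have uE y : W y -> E y \in unitmx by move=> /WP[_]; rewrite unitmxE unitfE.
pose G y : 'M[R]_(m, n) := B *m invmx (E y) *m A y.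
exists W, D, G; split => //.
- by move=> y /WW1/W1P[].
- by move=> j; exact: Ck_sub WW1 (sD j).
- move=> j; apply: Ck_mulmx => //; last exact: Ck_sub WW1 (sA j).
  apply: Ck_mulmx => //; first exact: Ck_cst.
  by apply: Ck_invmx => //; exact: Ck_sub WW1 (sE j).
move=> y Wy; have [iy Uy _ _ cy] := W1P y (WW1 y Wy).
have [F1 _] := frame y iy Uy; have dy := cinv_dom iy; have DEy := DE y (WW1 y Wy).
split => //.
  by move=> w; apply/F1; exists (w *m (B *m invmx (E y))); rewrite /G !mulmxA.
apply/row_matrixP => i; rewrite (rowE i (_ *m D y)) (rowE i (D y)); set u := delta_mx 0 i.
have [c cE] : exists c : 'rV[R]_k, u *m D y = c *m (A y *m D y).
  pose v := prV (cinv psi y) (of_tcoord psi (cinv psi y) u).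
  have /F1[c cE] : of_tcoord psi (cinv psi y) (u - tcoord psi (cinv psi y) v) \in H (cinv psi y).
    by rewrite of_tcoordB tcoordK//; exact: prV_hor.
  exists c; rewrite mulmxA -cE mulmxBl (DEy (tcoord _ _ _)) tcoordK//.
  have /eqP-> : tangent_map pi (cinv psi y) v == 0 by rewrite -memv_ker; exact: prV_vert.
  by rewrite [X in _ - X]tcoordE mul0mx subr0.
have -> : u *m (D y *m G y *m D y) = u *m D y *m G y *m D y by rewrite !mulmxA.
rewrite cE; have -> : c *m (A y *m D y) *m G y = c *m (E y *m invmx (E y)) *m A y.
  by rewrite /G /E !mulmxA.
by rewrite mulmxV ?uE// mulmx1 mulmxA.
Unshelve. all: by end_near. Qed.

End Splitting.

Lemma Ck_local (R : realType) (V W : normedModType R) k (U : set V) (f : V -> W) :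
  (forall x, U x -> exists2 U' : set V, open_nbhs x U' & Ck_on k U' f) -> Ck_on k U f.
Proof.
elim: k f => [|k IH] f H /=.
  by move=> x /H[U' [_ U'x]]; exact.
split=> [x /H[U' [_ U'x] [d _]]|v]; first exact: d.
by apply: IH => x /H[U' oU' [_ D]]; exists U'; [|exact: D].
Qed.

Lemma mulmx_eq_conj (R : comPzRingType) n (A B J K : 'M[R]_n) :
  A *m J = J *m B -> J *m K = 1%:M -> A = J *m B *m K.
Proof. by move=> <- JK; rewrite -mulmxA JK mulmx1. Qed.

(** * Smoothness of the vertical projection and of horizontal lifts *)

Section VerticalProjection.
Context {R : realType} {Q M : manifold R} (pi : Q -> M).
Variable H : Q -> {vspace tangent R Q}.
Hypothesis pi_sub : surjective_submersion pi.
Hypothesis H_conn : ehresmann_connection pi H.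
Notation n := (Defs.dim Q).
Notation m := (Defs.dim M).
Notation vert := (vertical pi).
Notation prV := (prV pi H).
Notation PV := (PV pi H).
Implicit Types (phi psi : chart R Q n) (q : Q) (u v : 'rV[R]_n).

(* [PV] is the matrix of the vertical projection at a point, [PVf] the same as a
   function of the coordinates; likewise for [jac] and [jacf].  They multiply row
   vectors on the right. *)
Definition PVf phi (y : 'rV[R]_n) : 'M[R]_n := PV phi (cinv phi y).

Lemma PVfE phi q : cdom phi q -> PVf phi (cmap phi q) = PV phi q.
Proof. by move=> dq; rewrite /PVf cmapK. Qed.

Lemma PVf_local q0 W D G : local_splitting pi H q0 W D G ->
  forall y, W y -> PVf (chart_at q0) y = 1%:M - D y *m G y.
Proof.
move=> [oW Wi _ _ WP] y Wy; have [cy DE GH DGD] := WP y Wy.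
have ac := chart_at_atlas q0; have dy := cinv_dom (Wi _ Wy).
apply/row_matrixP => i; rewrite [LHS]rowE [RHS]rowE; set u := delta_mx 0 i.
rewrite /PVf mul_PV mulmxBr mulmx1 mulmxA; set v := u - _.
rewrite (@prV_unique _ _ _ _ _ H_conn _ _ (of_tcoord (chart_at q0) (cinv (chart_at q0) y) v)).
- by rewrite of_tcoordK.
- rewrite memv_ker; apply/eqP.
  rewrite -(tcoordK (chart_at_atlas (pi q0)) cy (tangent_map _ _ _)) -DE /v mulmxBl.
  have -> : u *m D y *m G y *m D y = u *m (D y *m G y *m D y) by rewrite !mulmxA.
  by rewrite DGD subrr of_tcoordE mul0mx.
- by rewrite -of_tcoordB /v subKr.
Qed.

Lemma PVf_jac phi psi y : atlas Q phi -> atlas Q psi -> overlap phi psi y ->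
  PVf phi y *m jacf phi psi y = jacf phi psi y *m PVf psi (trans phi psi y).
Proof.
move=> aphi apsi [q [dphi dpsi] <-].
by rewrite transE// !PVfE// -!jacE PV_jac.
Qed.

Lemma PVf_trans phi psi y : atlas Q phi -> atlas Q psi -> overlap phi psi y ->
  PVf phi y = jacf phi psi y *m PVf psi (trans phi psi y) *m jacf psi phi (trans phi psi y).
Proof.
move=> aphi apsi Oy; apply: mulmx_eq_conj (PVf_jac aphi apsi Oy) _.
case: Oy => q [dphi dpsi] <-; rewrite (transE psi dphi) -!jacE.
by rewrite (jac_mul aphi apsi aphi dphi dpsi dphi) jac_id.
Qed.

(** Around each point, the chart centred there has the formula [1 - D G]; a change of charts carries
    it over to [phi]. *)
Lemma PVf_smooth phi : atlas Q phi -> smooth_on (cimg phi) (PVf phi).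
Proof.
move=> aphi k; apply: Ck_local => _ [q dq <-].
have [W [D [G LS]]] := local_splitting_exists pi_sub H_conn q.
have PL := PVf_local LS; case: LS => [[oW Wx0] Wi sD sG _].
have [ac dc] : atlas Q (chart_at q) /\ cdom (chart_at q) q.
  by split; [exact: chart_at_atlas|exact: chart_at_dom].
set psi := chart_at q in ac dc oW Wx0 Wi PL *.
have oO := @overlap_open _ _ phi psi.
have tc : forall y, overlap phi psi y -> {for y, continuous (trans phi psi)}.
  by move=> y Oy; apply: (Ck_continuous (trans_smooth aphi ac 0)).
pose U := [set y | overlap phi psi y /\ W (trans phi psi y)].
have oU : open U.
  rewrite openE => y [Oy Wy].
  apply: filterS2 (open_near oO Oy) (tc y Oy _ (open_nbhs_nbhs (conj oW Wy))) => z Oz Wz.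
  by split.
have UO : U `<=` overlap phi psi by move=> y [].
exists U; first by split => //; split; [exact: overlapP|rewrite /= transE].
have sP : Ck_on k W (PVf psi).
  have H1 : Ck_on k W (fun y => 1%:M + (-1)%:M *m (D y *m G y)).
    apply: Ck_add => //; first exact: Ck_cst.
    apply: Ck_mulmx => //; first exact: Ck_cst.
    exact: Ck_mulmx.
  apply: Ck_eq H1 => // y; rewrite inE => Wy; rewrite PL//.
  by rewrite mul_scalar_mx scaleN1r.
have st : Ck_on k U (trans phi psi) by apply: (Ck_sub UO); exact: trans_smooth.
have UW y : U y -> W (trans phi psi y) by case.
have UO' y : U y -> overlap psi phi (trans phi psi y).
  by move=> [[q' [d1 d2] <-] _]; rewrite transE//; exact: overlapP.
have c1 : Ck_on k U (jacf phi psi) := Ck_sub UO (jacf_smooth aphi ac k).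
have c2 := Ck_comp_mx oU oW UW st sP.
have c3 := Ck_comp_mx oU (@overlap_open _ _ psi phi) UO' st (jacf_smooth ac aphi k).
apply: (Ck_eq oU _ (Ck_mulmx oU (Ck_mulmx oU c1 c2) c3)) => y.
by rewrite inE => /UO Oy; symmetry; exact: PVf_trans.
Qed.

Lemma PVf_differentiable phi y : atlas Q phi -> cimg phi y -> differentiable (PVf phi) y.
Proof. by move=> aphi iy; have [d _] := PVf_smooth aphi 1; exact: d. Qed.

(** A splitting provides only [D G D = D]. As the differential of [pi] is surjective, [z] is an
    image, and this becomes [z G D = z] in coordinates; uniqueness of the horizontal lift
    concludes. *)
Lemma hlift_local q0 W D G : local_splitting pi H q0 W D G ->
  forall y, W y -> forall z, tcoord (chart_at q0) (cinv (chart_at q0) y)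
      (hlift pi H (cinv (chart_at q0) y) z) =
    tcoord (chart_at (pi q0)) (pi (cinv (chart_at q0) y)) z *m G y.
Proof.
move=> [oW Wi _ _ WP] y Wy z; have [cy DE GH DGD] := WP y Wy.
have ac := chart_at_atlas q0; have dy := cinv_dom (Wi _ Wy).
have am := chart_at_atlas (pi q0).
set q := cinv _ y in cy DE GH dy *; set zc := tcoord _ _ z.
have [_ _ limgT] := pi_sub.
have [t zE] : exists t, z = tangent_map pi q t.
  have : z \in limg (tangent_map pi q) by rewrite limgT memvf.
  by move=> /memv_imgP[t _ ->]; exists t.
have zcE : zc *m G y *m D y = zc.
  have -> : zc = tcoord (chart_at q0) q t *m D y by rewrite DE tcoordK// -zE.
  have -> : tcoord (chart_at q0) q t *m D y *m G y *m D y =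
    tcoord (chart_at q0) q t *m (D y *m G y *m D y) by rewrite !mulmxA.
  by rewrite DGD.
rewrite -(of_tcoordK ac dy (zc *m G y)); congr tcoord; symmetry.
apply: hlift_unique => //.
by rewrite -(tcoordK am cy (tangent_map _ _ _)) -DE zcE tcoordK.
Qed.

Lemma hlift_vfield_differentiable q (w : 'rV[R]_m) :
  differentiable (vrep (chart_at q) (hlift_vfield pi H (extend (pi q) w)))
    (cmap (chart_at q) q).
Proof.
have [W [D [G LS]]] := local_splitting_exists pi_sub H_conn q.
have HL := hlift_local LS; case: LS => [[oW Wx0] Wi _ sG WP].
have [dG _] : Ck_on 1 W (fun y => w *m G y).
  by apply: Ck_mulmx => //; exact: Ck_cst.
have E : \forall y \near cmap (chart_at q) q,
    w *m G y = vrep (chart_at q) (hlift_vfield pi H (extend (pi q) w)) y.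
  apply: filterS (open_near oW Wx0) => y Wy; rewrite /vrep HL//.
  by have [cy _ _ _] := WP y Wy; rewrite /extend of_tcoordK//; exact: chart_at_atlas.
by have [] := near_eq_diff E (dG _ Wx0).
Qed.

End VerticalProjection.

(** * Covectors in coordinates *)

Section Dot.
Context {R : realType} {n : nat}.
Implicit Types (u v p r : 'rV[R]_n) (A : 'M[R]_n).

(** The pairing of vector components with covector components. A matrix acting on vectors from the
    right acts on covectors through its transpose. *)
Definition dot u p : R := (u *m p^T) 0 0.

Lemma dotE u p : dot u p = \sum_i u 0 i * p 0 i.
Proof. by rewrite /dot mxE; apply: eq_bigr => i _; rewrite !mxE. Qed.

Lemma dotC u p : dot u p = dot p u.
Proof. by rewrite !dotE; apply: eq_bigr => i _; rewrite mulrC. Qed.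

Lemma dotDl u v p : dot (u + v) p = dot u p + dot v p.
Proof. by rewrite /dot mulmxDl mxE. Qed.

Lemma dotDr u p r : dot u (p + r) = dot u p + dot u r.
Proof. by rewrite dotC dotDl !(dotC u). Qed.

Lemma dotNl u p : dot (- u) p = - dot u p.
Proof. by rewrite /dot mulNmx mxE. Qed.

Lemma dotBl u v p : dot (u - v) p = dot u p - dot v p.
Proof. by rewrite dotDl dotNl. Qed.

Lemma dotZl c u p : dot (c *: u) p = c * dot u p.
Proof. by rewrite /dot -scalemxAl mxE. Qed.

Lemma dot0l p : dot 0 p = 0.
Proof. by rewrite /dot mul0mx mxE. Qed.

Lemma dot_mul u A p : dot (u *m A) p = dot u (p *m A^T).
Proof. by rewrite /dot trmx_mul trmxK mulmxA. Qed.

Lemma dot_delta i p : dot (delta_mx 0 i) p = p 0 i.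
Proof. by rewrite /dot -rowE !mxE. Qed.

Lemma dot_inj p r : (forall u, dot u p = dot u r) -> p = r.
Proof. by move=> H; apply/rowP => i; rewrite -!dot_delta. Qed.

(** Rows carry the maximum norm, whence the factor [n]. *)
Lemma dot_le u p : `|dot u p| <= n%:R * (`|u| * `|p|).
Proof.
rewrite dotE (le_trans (ler_norm_sum _ _ _))//.
have -> : n%:R * (`|u| * `|p|) = \sum_(i < n) `|u| * `|p| :> R.
  by rewrite sumr_const card_ord mulr_natl.
apply: ler_sum => i _; rewrite normrM ler_pM//; exact: norm_mx_coord.
Qed.

Lemma is_derive_dot (f g : R -> 'rV[R]_n) t : derivable f t 1 -> derivable g t 1 ->
  @is_derive R R^o R^o t 1 (fun s => dot (f s) (g s))
    (dot (derive1 f t) (g t) + dot (f t) (derive1 g t)).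
Proof.
move=> df dg; have dgT := derivable_trmx dg.
have [dM dME] := is_derive_mulmx df dgT.
apply: DeriveDef; first by move/derivable_mxP : dM; exact.
have -> : 'D_1 (fun s => dot (f s) (g s) : R^o) (t : R^o) =
    ('D_1 (fun s => f s *m (g s)^T) t) 0 0 by rewrite derive_mx// mxE.
by rewrite dME (derive_trmx dg) mxE !derive1E.
Qed.

End Dot.

Section Covectors.
Context {R : realType} {Q : manifold R}.
Notation n := (Defs.dim Q).
Implicit Types (phi psi : chart R Q n) (q : Q) (v p : 'rV[R]_n) (beta : cotangent R Q).

Lemma of_tcoord_pair phi q beta v :
  beta (of_tcoord phi q v) = dot v (ccoord phi q beta).
Proof.
rewrite dotE {1}(row_sum_delta v) of_tcoordE mulmx_suml linear_sum.
by apply: eq_bigr => i _; rewrite -scalemxAl linearZ mxE of_tcoordE.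
Qed.

Lemma ccoord_pair phi q beta v : atlas Q phi -> cdom phi q ->
  beta v = dot (tcoord phi q v) (ccoord phi q beta).
Proof. by move=> aphi dq; rewrite -of_tcoord_pair tcoordK. Qed.

Lemma ccoord_inj phi q : atlas Q phi -> cdom phi q -> injective (ccoord phi q).
Proof.
by move=> aphi dq b1 b2 E; apply/lfunP => v; rewrite !(ccoord_pair _ _ aphi dq) E.
Qed.

Lemma ccoord_eq0 phi q beta : atlas Q phi -> cdom phi q ->
  (ccoord phi q beta == 0) = (beta == 0).
Proof.
move=> aphi dq; have E0 : ccoord phi q 0 = 0 by apply/rowP => i; rewrite !mxE lfunE.
by rewrite -E0 (inj_eq (ccoord_inj aphi dq)).
Qed.

Lemma ccoord_jac phi psi q beta : atlas Q phi -> atlas Q psi -> cdom phi q -> cdom psi q ->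
  ccoord phi q beta = ccoord psi q beta *m (jac phi psi q)^T.
Proof.
move=> aphi apsi dphi dpsi; apply: dot_inj => u.
rewrite -dot_mul -of_tcoord_pair (ccoord_pair _ _ apsi dpsi); congr (dot _ _).
have [ac dc] := (chart_at_atlas q, chart_at_dom q).
rewrite tcoordE of_tcoordE -mulmxA; congr (_ *m _).
exact: jac_mul.
Qed.

Lemma ccoord_surj phi q p : atlas Q phi -> cdom phi q ->
  exists beta, ccoord phi q beta = p.
Proof.
move=> aphi dq; pose f v : R^o := dot (tcoord phi q v) p.
have linf : linear f.
  by move=> c u v; rewrite /f !tcoordE mulmxDl -scalemxAl dotDl dotZl.
pose L : {linear 'rV[R]_n -> R^o} :=
  HB.pack_for {linear 'rV[R]_n -> R^o} f (GRing.isLinear.Build R 'rV[R]_n R^o *:%R f linf).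
exists (linfun L); apply/rowP => i.
by rewrite mxE lfunE /= /f of_tcoordK// dot_delta.
Qed.

End Covectors.

(** * Change of charts along a curve *)

Section CurvesInCharts.
Context {R : realType} {Q : manifold R}.
Notation n := (Defs.dim Q).
Implicit Types (phi psi : chart R Q n) (q : Q) (v p : 'rV[R]_n) (beta : R -> cotangent R Q).
Implicit Types (gamma : R -> Q) (t : R).

Definition curve_coord phi gamma : R -> 'rV[R]_n := cmap phi \o gamma.

Definition cov_coord phi gamma beta : R -> 'rV[R]_n :=
  fun s => ccoord phi (gamma s) (beta s).

Lemma derive1_mulmx_tr (f : R -> 'rV[R]_n) (A : R -> 'M[R]_n) t :
  derivable f t 1 -> derivable A t 1 ->
  derivable (fun s => f s *m (A s)^T) t 1 /\
  derive1 (fun s => f s *m (A s)^T) t = derive1 f t *m (A t)^T + f t *m (derive1 A t)^T.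
Proof.
move=> df dA; have [d dE] := is_derive_mulmx df (derivable_trmx dA); split => //.
by rewrite !derive1E -(derive_trmx dA).
Qed.

Lemma curve_near gamma t (A : set Q) : {for t, continuous gamma} -> nbhs (gamma t) A ->
  \near t, A (gamma t).
Proof. by move=> cg; exact: cg. Qed.

Lemma curve_coord_trans phi psi gamma t : {for t, continuous gamma} ->
  cdom phi (gamma t) -> \forall s \near t,
    (trans phi psi \o curve_coord phi gamma) s = curve_coord psi gamma s.
Proof.
move=> cg dphi; apply: filterS (curve_near cg (near_cdom dphi)) => s ds.
by rewrite /= /curve_coord /= transE.
Qed.

Lemma curve_coord_derive phi psi gamma t : {for t, continuous gamma} ->
  atlas Q phi -> atlas Q psi -> cdom phi (gamma t) -> cdom psi (gamma t) ->
  derivable (curve_coord phi gamma) t 1 ->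
  derivable (curve_coord psi gamma) t 1 /\
  derive1 (curve_coord psi gamma) t =
    derive1 (curve_coord phi gamma) t *m jac phi psi (gamma t).
Proof.
move=> cg aphi apsi dphi dpsi dx.
have dt := trans_differentiable aphi apsi dphi dpsi.
have [d dE] := curve_comp dx dt.
have nE := curve_coord_trans psi cg dphi.
split; first by apply: near_eq_derivable d.
by rewrite (mul_jac _ dt) -dE; apply: near_eq_derive1; apply: filterS nE.
Qed.

Lemma cov_coord_trans phi psi gamma beta t : {for t, continuous gamma} ->
  atlas Q phi -> atlas Q psi -> cdom phi (gamma t) -> cdom psi (gamma t) ->
  \forall s \near t, cov_coord phi gamma beta s =
    cov_coord psi gamma beta s *m ((jacf phi psi \o curve_coord phi gamma) s)^T.
Proof.
move=> cg aphi apsi dphi dpsi.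
apply: filterS2 (curve_near cg (near_cdom dphi)) (curve_near cg (near_cdom dpsi)) => s d1 d2.
by rewrite /cov_coord (ccoord_jac _ aphi apsi d1 d2).
Qed.

(** The last term, the derivative of the Jacobian along the curve, prevents p' from transforming as
    a covector; it is compensated in [covector_equation_transfer]. *)
Lemma cov_coord_derive phi psi gamma beta t : {for t, continuous gamma} ->
  atlas Q phi -> atlas Q psi -> cdom phi (gamma t) -> cdom psi (gamma t) ->
  derivable (curve_coord phi gamma) t 1 -> derivable (cov_coord psi gamma beta) t 1 ->
  derivable (cov_coord phi gamma beta) t 1 /\
  derive1 (cov_coord phi gamma beta) t =
    derive1 (cov_coord psi gamma beta) t *m (jac phi psi (gamma t))^T +
    cov_coord psi gamma beta t *m
      ('D_(derive1 (curve_coord phi gamma) t) (jacf phi psi) (cmap phi (gamma t)))^T.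
Proof.
move=> cg aphi apsi dphi dpsi dx dp.
have [dJ _] := jacf_smooth aphi apsi 1.
have [dJx dJxE] := curve_comp dx (dJ _ (overlapP dphi dpsi)).
have [d dE] := derive1_mulmx_tr dp dJx.
have nE := cov_coord_trans beta cg aphi apsi dphi dpsi.
split; first by apply: near_eq_derivable d; apply: filterS nE => s ->.
have E1 := near_eq_derive1 nE.
have E2 := etrans E1 dE.
rewrite dJxE in E2.
exact: E2.
Qed.

End CurvesInCharts.

(** * The covector equation and its independence of the chart *)

Section AbnormalEquation.
Context {R : realType} {Q M : manifold R} (pi : Q -> M).
Variable H : Q -> {vspace tangent R Q}.
Hypothesis pi_sub : surjective_submersion pi.
Hypothesis H_conn : ehresmann_connection pi H.
Notation n := (Defs.dim Q).
Notation m := (Defs.dim M).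
Notation PV := (PV pi H).
Notation PVf := (PVf pi H).
Implicit Types (phi psi : chart R Q n) (q : Q) (u v : 'rV[R]_n).
Implicit Types (gamma : R -> Q) (beta : R -> cotangent R Q) (t : R).

Lemma AnnP phi q (b : cotangent R Q) : atlas Q phi -> cdom phi q ->
  Ann H q b <->
  forall u, dot (u *m PV phi q) (ccoord phi q b) = dot u (ccoord phi q b).
Proof.
move=> aphi dq; split=> [Ab u|E v vH].
  have : of_tcoord phi q (u - u *m PV phi q) \in H q.
    apply/(mulPV_eq0 H_conn _ aphi dq); rewrite mulmxBl -mulmxA.
    by rewrite (PV_idem H_conn aphi dq) subrr.
  by move=> /Ab; rewrite of_tcoord_pair dotBl => /eqP; rewrite subr_eq0 => /eqP ->.
rewrite (ccoord_pair _ _ aphi dq) -E.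
have -> : tcoord phi q v *m PV phi q = 0; last exact: dot0l.
by apply/(mulPV_eq0 H_conn _ aphi dq); rewrite tcoordK.
Qed.

Lemma PVf_derivable phi q v : atlas Q phi -> cdom phi q -> derivable (PVf phi) (cmap phi q) v.
Proof.
move=> aphi dq; apply/diff_derivable/(PVf_differentiable pi_sub H_conn aphi).
exact: cimgP.
Qed.

(** Derivative of the identity [PVf_jac], which intertwines the vertical projections in two charts
    by the Jacobian. *)
Lemma PVf_jac_derive phi psi q v : atlas Q phi -> atlas Q psi -> cdom phi q -> cdom psi q ->
  'D_v (PVf phi) (cmap phi q) *m jac phi psi q +
    PV phi q *m 'D_v (jacf phi psi) (cmap phi q) =
  'D_v (jacf phi psi) (cmap phi q) *m PV psi q +
    jac phi psi q *m 'D_(v *m jac phi psi q) (PVf psi) (cmap psi q).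
Proof.
move=> aphi apsi dphi dpsi; have Oq := overlapP dphi dpsi.
have [dJ _] := jacf_smooth aphi apsi 1.
have dJv : derivable (jacf phi psi) (cmap phi q) v by exact/diff_derivable/dJ.
have dt := trans_differentiable aphi apsi dphi dpsi.
have dPp : differentiable (PVf psi) (trans phi psi (cmap phi q)).
  rewrite transE//; apply: (PVf_differentiable pi_sub H_conn apsi); exact: cimgP.
have dPv : derivable (PVf psi \o trans phi psi) (cmap phi q) v.
  by apply/diff_derivable; exact: differentiable_comp.
have E1 := derive_mulmx (@PVf_derivable phi q v aphi dphi) dJv.
have E2 := derive_mulmx dJv dPv.
have nE : \forall y \near cmap phi q, PVf phi y *m jacf phi psi y =
    jacf phi psi y *m (PVf psi \o trans phi psi) y.
  apply: filterS (open_near (@overlap_open _ _ phi psi) Oq) => y Oy.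
  exact: PVf_jac.
have E3 := near_eq_derive v nE.
have E4 := derive_chain v dt dPp.
have E5 := mul_jac v dt.
have E := etrans (esym E1) (etrans E3 E2).
move: E E4; rewrite /= -E5 -jacE (PVfE pi H dphi) (transE psi dphi) (PVfE pi H dpsi).
move=> E E4.
exact: (etrans E (congr1 (fun Z => 'D_v (jacf phi psi) (cmap phi q) *m PV psi q + jac phi psi q *m Z) E4)).
Qed.

Definition covector_equation phi gamma beta t : Prop := forall v,
  dot v (derive1 (cov_coord phi gamma beta) t) =
  dot (derive1 (curve_coord phi gamma) t *m 'D_v (PVf phi) (cmap phi (gamma t)))
      (cov_coord phi gamma beta t).

(** Here [J] is the Jacobian, [DvJ] and [DxJ] are its derivatives along [v] and the velocity [x],
    and [DP], [DPp] are derivatives of the projections [P], [Pp] in the two charts. The derivatives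
    of [J] cancel: symmetry turns [v *m DxJ] into [x *m DvJ], the term with [P] vanishes as [x] is
    horizontal, and [p] absorbs [Pp] as it annihilates [H]. *)
Lemma covector_equation_transfer_mx (v x p p' : 'rV[R]_n) (J DP DvJ DxJ DPp P Pp : 'M[R]_n) :
  dot (v *m J) p' = dot (x *m J *m DPp) p -> x *m P = 0 -> v *m DxJ = x *m DvJ ->
  DP *m J + P *m DvJ = DvJ *m Pp + J *m DPp ->
  (forall u, dot (u *m Pp) p = dot u p) ->
  dot v (p' *m J^T) + dot v (p *m DxJ^T) = dot (x *m DP) (p *m J^T).
Proof.
move=> Ev hx sym PE AE; rewrite -!dot_mul sym Ev -mulmxA.
rewrite -[x *m DP *m J]mulmxA; have -> : DP *m J = DvJ *m Pp + J *m DPp - P *m DvJ by rewrite -PE addrK.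
rewrite mulmxBr mulmxDr [x *m (P *m DvJ)]mulmxA hx mul0mx subr0 !mulmxA !dotDl AE.
exact: addrC.
Qed.

(** Passes from [chart_at (gamma t)], where the pointwise equivalences live, to a chart that serves
    for a whole interval. *)
Lemma covector_equation_transfer phi psi gamma beta t : {for t, continuous gamma} ->
  atlas Q phi -> atlas Q psi -> cdom phi (gamma t) -> cdom psi (gamma t) ->
  derivable (curve_coord phi gamma) t 1 -> derivable (cov_coord psi gamma beta) t 1 ->
  derive1 (curve_coord phi gamma) t *m PV phi (gamma t) = 0 ->
  Ann H (gamma t) (beta t) ->
  covector_equation psi gamma beta t -> covector_equation phi gamma beta t.
Proof.
move=> cg aphi apsi dphi dpsi dx dp hx Ab Epsi v.
have [_ p'E] := cov_coord_derive cg aphi apsi dphi dpsi dx dp.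
have [_ x'E] := curve_coord_derive cg aphi apsi dphi dpsi dx.
have sym := jacf_sym v (derive1 (curve_coord phi gamma) t) aphi apsi (overlapP dphi dpsi).
have PE := PVf_jac_derive v aphi apsi dphi dpsi.
have pE : cov_coord phi gamma beta t = cov_coord psi gamma beta t *m (jac phi psi (gamma t))^T.
  exact: ccoord_jac.
have AE u := (AnnP (beta t) apsi dpsi).1 Ab u.
have Ev := Epsi (v *m jac phi psi (gamma t)).
rewrite x'E in Ev; rewrite p'E pE dotDr.
exact: (covector_equation_transfer_mx Ev hx sym PE AE).
Qed.

End AbnormalEquation.

Lemma Ck_trmx (R : realType) (V : normedModType R) m n k (U : set V) (A : V -> 'M[R]_(m, n)) :
  open U -> Ck_on k U A -> Ck_on k U (fun x => (A x)^T).
Proof.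
move=> oU sA; apply: Ck_mx => // i j.
have -> : (fun x => (A x)^T i j : R^o) = (fun x => A x j i : R^o) by apply/funext => x; rewrite mxE.
exact: Ck_coord.
Qed.

(** * The pointwise equivalences *)

Section TangentAnn.
Context {R : realType} {Q M : manifold R} (pi : Q -> M).
Variable H : Q -> {vspace tangent R Q}.
Hypothesis pi_sub : surjective_submersion pi.
Hypothesis H_conn : ehresmann_connection pi H.
Notation n := (Defs.dim Q).
Notation m := (Defs.dim M).
Notation PV := (PV pi H).
Notation PVf := (PVf pi H).
Notation canonical := (Defs.canonical).
Implicit Types (phi psi : chart R Q n) (q : Q) (u v : 'rV[R]_n).
Implicit Types (gamma : R -> Q) (beta : R -> cotangent R Q) (t : R).

Lemma Ann_ccoord phi q (b : cotangent R Q) : atlas Q phi -> cdom phi q ->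
  Ann H q b <-> ccoord phi q b *m (PVf phi (cmap phi q))^T = ccoord phi q b.
Proof.
move=> aphi dq; rewrite (AnnP H_conn b aphi dq) (PVfE pi H dq); split=> [E|E u].
  by apply: dot_inj => u; rewrite -dot_mul E.
by rewrite dot_mul E.
Qed.

(** Derivative at 0 of the relation [r = r P(y)^T] along the curve that realises [w]. *)
Lemma tangent_Ann_eq q (b : cotangent R Q) w :
  tangent_Ann H (q, b) w ->
  w.2 = w.2 *m (PV (chart_at q) q)^T +
    ccoord (chart_at q) q b *m ('D_(w.1) (PVf (chart_at q)) (cmap (chart_at q) q))^T.
Proof.
case=> c [c0 cA [U U0 sU] ->]; have aphi := chart_at_atlas q.
move: aphi cA U0 sU => /=; have dq := chart_at_dom q.
move: (chart_at q) dq => phi dq aphi cA [oU U0] sU.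
have [dc _] := sU 1; have dc1 := @diff_derivable _ _ _ _ _ (1 : R^o) (dc _ U0).
pose y s := cmap phi (c s).1; pose r s := ccoord phi (c s).1 (c s).2.
have /derivable1_pairP[dy dr] : derivable (fun s => (y s, r s)) 0 1 by exact: dc1.
have -> : derive1 (canonical phi \o c) 0 = (derive1 y 0, derive1 r 0).
  exact: (derive1_pair dy dr).
have y0 : y 0 = cmap phi q by rewrite /y c0.
have r0 : r 0 = ccoord phi q b by rewrite /r c0.
have dP : differentiable (PVf phi) (y 0).
  by rewrite y0; apply: (PVf_differentiable pi_sub H_conn aphi); exact: cimgP.
have [dPy dPyE] := curve_comp dy dP.
have [_ dE] := derive1_mulmx_tr dr dPy.
have nE : \forall s \near (0 : R), r s = r s *m ((PVf phi \o y) s)^T.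
  by apply: filterS cA => s [ds /(Ann_ccoord _ aphi ds) As]; exact: esym As.
have E1 := etrans (near_eq_derive1 nE) dE.
rewrite dPyE in E1; move: E1.
by rewrite /= y0 r0 (PVfE pi H dq).
Qed.

(** The curve follows the line [x0 + s v] and carries the covector [p P^T] there, which annihilates
    [H] because [P] is idempotent. One tangent vector over each [v] is enough: two of them differ by
    a covector of Ann(H), which a horizontal velocity does not see. *)
Lemma tangent_Ann_exists q (b : cotangent R Q) v : Ann H q b ->
  tangent_Ann H (q, b) (v, ccoord (chart_at q) q b *m
    ('D_v (PVf (chart_at q)) (cmap (chart_at q) q))^T).
Proof.
move=> Ab; rewrite /tangent_Ann /=; have [aphi dq] := (chart_at_atlas q, chart_at_dom q).
move: (chart_at q) aphi dq => phi aphi dq.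
pose x0 := cmap phi q; pose p := ccoord phi q b.
pose L (s : R) : 'rV[R]_n := x0 + s *: v.
have oI : open (cimg phi) by exact: cimg_open.
have cL : continuous (L : R^o -> _).
  by move=> s; apply: cvgD; [exact: cvg_cst|apply: cvgZl; exact: cvg_id].
pose U : set R^o := L @^-1` cimg phi.
have oU : open U by apply: open_comp => // s _; exact: cL.
have L0 : L 0 = x0 by rewrite /L scale0r addr0.
have U0 : U 0 by rewrite /U /= L0; exact: cimgP.
(* Covectors with the prescribed components, chosen time by time; once the line has left the chart
   they are set to 0. *)
have [B BP] : exists B : R -> cotangent R Q, forall s, U s ->
    ccoord phi (cinv phi (L s)) (B s) = p *m (PVf phi (L s))^T.
  have /choice[B BP] : forall s, exists B, U s ->
      ccoord phi (cinv phi (L s)) B = p *m (PVf phi (L s))^T.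
    move=> s; have [Us|nU] := pselect (U s); last by exists 0.
    have [B BE] := ccoord_surj (p *m (PVf phi (L s))^T) aphi (cinv_dom Us).
    by exists B.
  by exists B.
have B0 : B 0 = b.
  have := BP _ U0; rewrite L0 (cmapK dq) (Ann_ccoord _ aphi dq).1// => E.
  exact: (ccoord_inj aphi dq).
pose c s : cotangent_bundle Q := (cinv phi (L s), B s).
have cE s : U s -> canonical phi (c s) = (L s, p *m (PVf phi (L s))^T).
  by move=> Us; rewrite /canonical /c /= BP// (cinvK Us).
have nU : \forall s \near (0 : R), U s by exact: (open_near oU U0).
have sP := PVf_smooth pi_sub H_conn aphi.
exists c; split.
- by rewrite /c L0 (cmapK dq) B0.
- apply: filterS nU => s Us; have ds := cinv_dom Us; split => //.
  have idem : PVf phi (L s) *m PVf phi (L s) = PVf phi (L s) by exact: PV_idem.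
  apply: (Ann_ccoord (B s) aphi ds).2.
  have -> : cmap phi (cinv phi (L s)) = L s by exact: cinvK.
  move: idem (BP s Us); move: (PVf phi (L s)) (ccoord phi _ _) => P r idem ->.
  by rewrite -mulmxA -trmx_mul idem.
- exists U; first by split.
  move=> k; apply: (@Ck_eq _ _ _ _ _ (fun s => (L s, p *m (PVf phi (L s))^T))) => //.
    by move=> s /set_mem Us; rewrite /= cE.
  have sL : Ck_on k U (L : R^o -> _).
    apply: Ck_add => //; first exact: Ck_cst.
    apply: (@Ck_lincomp_unbundled _ _ _ _ _ _ (idfun : R^o -> R^o) (fun s => s *: v)) => //.
    - by move=> k' s1 s2; rewrite scalerDl scalerA.
    - by move=> s; apply: cvgZl; exact: cvg_id.
    - by apply: Ck_lin => s; exact: cvg_id.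
  apply: Ck_pair => //; apply: Ck_mulmx => //; first exact: Ck_cst.
  apply: Ck_trmx => //.
  exact: (Ck_comp_mx oU oI _ sL (sP k)).
- have [dL dLE] : is_derive (0 : R) 1 L v.
    have := @is_derive_line R 'rV[R]_n 'rV[R]_n id x0 v 0 _.
    by rewrite derive_id; apply.
  have dP : differentiable (PVf phi) (L 0).
    by rewrite L0; apply: (PVf_differentiable pi_sub H_conn aphi); exact: cimgP.
  have [dPL dPLE] := curve_comp dL dP.
  have dp : derivable (cst p : R -> 'rV[R]_n) 0 1 by exact: derivable_cst.
  have [dr drE] := derive1_mulmx_tr dp dPL.
  have nE : \forall s \near (0 : R), (canonical phi \o c) s =
      (L s, p *m ((PVf phi \o L) s)^T).
    by apply: filterS nU => s Us; exact: cE.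
  have E1 := etrans (near_eq_derive1 nE) (derive1_pair dL dr).
  have E2 := congr1 (pair (derive1 L 0)) drE.
  apply: esym; apply: etrans E1 (etrans E2 _).
  have dL1 : derive1 L 0 = v by rewrite derive1E.
  have dp0 : derive1 (cst p : R -> 'rV[R]_n) 0 = 0 by rewrite derive1E derive_cst.
  have E3 := etrans dPLE (congr2 (fun w y => 'D_w (PVf phi) y) dL1 L0).
  move: dL1 dp0 E3; move: (derive1 L 0) (derive1 (cst p) 0) (derive1 _ 0) => w z Z -> -> ->.
  by rewrite mul0mx add0r.
Qed.

Lemma symplE (v w : 'rV[R]_n * 'rV[R]_n) : sympl v w = dot v.1 w.2 - dot v.2 w.1.
Proof. by rewrite /sympl !dotE -sumrB. Qed.

(** From left to right the vectors of [tangent_Ann_exists] are inserted. Conversely, the part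
    [w.2 *m P^T] of an arbitrary tangent vector pairs to 0 with the velocity, which is
    horizontal. *)
Lemma abnormal_covector_equation (lam : R -> cotangent_bundle Q) t :
  let gamma := fst \o lam in let beta := snd \o lam in
  let phi := chart_at (lam t).1 in
  Ann H (lam t).1 (lam t).2 ->
  derivable (curve_coord phi gamma) t 1 -> derivable (cov_coord phi gamma beta) t 1 ->
  derive1 (curve_coord phi gamma) t *m PV phi (lam t).1 = 0 ->
  (forall w, tangent_Ann H (lam t) w -> sympl (cotangent_velocity lam t) w = 0) <->
  covector_equation pi H phi gamma beta t.
Proof.
move=> gamma beta phi Ab dx dp hx.
have -> : cotangent_velocity lam t =
    (derive1 (curve_coord phi gamma) t, derive1 (cov_coord phi gamma beta) t).
  exact: (derive1_pair dx dp).
have Ew := @tangent_Ann_eq (lam t).1 (lam t).2; have Eex := @tangent_Ann_exists (lam t).1 (lam t).2.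
rewrite -surjective_pairing -/phi in Ew Eex; rewrite /covector_equation /cov_coord /=.
move: Ew Eex hx; rewrite -[(gamma t)]/((lam t).1) -[beta t]/((lam t).2).
move: (derive1 (curve_coord phi gamma) t) (derive1 (fun s => ccoord phi (gamma s) (beta s)) t).
move=> x' p' Ew Eex hx.
split=> [E v|E w Tw].
  have := E _ (Eex v Ab); rewrite symplE /= -dot_mul => /eqP.
  by rewrite subr_eq0 (dotC p') => /eqP ->.
rewrite symplE /= (Ew _ Tw) dotDr -!dot_mul hx dot0l add0r.
by rewrite -E (dotC p') subrr.
Qed.

End TangentAnn.

(** * Brackets, transport and curvature in coordinates *)

Section Brackets.
Context {R : realType} {Q M : manifold R} (pi : Q -> M).
Variable H : Q -> {vspace tangent R Q}.
Hypothesis pi_sub : surjective_submersion pi.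
Hypothesis H_conn : ehresmann_connection pi H.
Notation n := (Defs.dim Q).
Notation m := (Defs.dim M).
Notation PV := (PV pi H).
Notation PVf := (PVf pi H).
Implicit Types (q : Q) (u v h : 'rV[R]_n) (b : cotangent R Q) (w : 'rV[R]_m).

Lemma dot_center q b v : b v = dot v (ccoord (chart_at q) q b).
Proof.
by rewrite (ccoord_pair b v (chart_at_atlas q) (chart_at_dom q)) tcoord_center.
Qed.

Lemma vrep_center (X : vfield Q) q : vrep (chart_at q) X (cmap (chart_at q) q) = X q.
Proof. by rewrite /vrep (cmapK (chart_at_dom q)) tcoord_center. Qed.

Lemma lie_center (X Y : vfield Q) q :
  differentiable (vrep (chart_at q) X) (cmap (chart_at q) q) ->
  differentiable (vrep (chart_at q) Y) (cmap (chart_at q) q) ->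
  lie X Y q = 'D_(X q) (vrep (chart_at q) Y) (cmap (chart_at q) q) -
              'D_(Y q) (vrep (chart_at q) X) (cmap (chart_at q) q).
Proof.
move=> dX dY; rewrite /lie.
have E1 := deriveE (X q) dY; have E2 := deriveE (Y q) dX.
by rewrite E1 E2 !vrep_center.
Qed.

Lemma center_hor q v : v *m PV (chart_at q) q = 0 <-> v \in H q.
Proof.
by rewrite (mulPV_eq0 H_conn _ (chart_at_atlas q) (chart_at_dom q)) of_tcoord_center.
Qed.

Lemma Ann_center q b v : Ann H q b ->
  dot (v *m PV (chart_at q) q) (ccoord (chart_at q) q b) = dot v (ccoord (chart_at q) q b).
Proof. by move=> Ab; apply: (AnnP H_conn b (chart_at_atlas q) (chart_at_dom q)).1. Qed.

Lemma PVf_center_derivable q v : derivable (PVf (chart_at q)) (cmap (chart_at q) q) v.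
Proof. exact: PVf_derivable (chart_at_atlas q) (chart_at_dom q). Qed.

Lemma hlift_in q w : hlift pi H q w \in H q.
Proof. exact: memv_pi. Qed.

Lemma derive_hlift q w b v : Ann H q b ->
  let c := chart_at q in
  let X := vrep c (hlift_vfield pi H (extend (pi q) w)) in
  [/\ differentiable X (cmap c q), X (cmap c q) = hlift pi H q w &
    dot ('D_v X (cmap c q)) (ccoord c q b) =
    - dot (hlift pi H q w *m 'D_v (PVf c) (cmap c q)) (ccoord c q b)].
Proof.
move=> Ab c X; have [aphi dq] := (chart_at_atlas q, chart_at_dom q).
have dX : differentiable X (cmap c q) by exact: hlift_vfield_differentiable.
have X0 : X (cmap c q) = hlift pi H q w.
  by rewrite /X vrep_center /hlift_vfield /extend of_tcoord_center.
split => //.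
have XP : \forall y \near cmap c q, X y *m PVf c y = 0.
  apply: filterS (near_cimg dq) => y iy; have dy := cinv_dom iy.
  apply/(mulPV_eq0 H_conn _ aphi dy).
  have -> : of_tcoord c (cinv c y) (X y) =
      hlift_vfield pi H (extend (pi q) w) (cinv c y) by exact: tcoordK.
  exact: hlift_in.
have dXv := @diff_derivable _ _ _ _ _ v dX.
have E1 := derive_mulmx dXv (@PVf_center_derivable q v).
have E2 := near_eq_derive v XP.
have E3 := etrans (esym E1) E2; rewrite derive_cst X0 (PVfE pi H dq) in E3.
move: E3; move: ('D_v X _) ('D_v (PVf c) _) => DX DP E3.
rewrite -(Ann_center DX Ab) -dotNl; congr (dot _ _); apply/eqP.
by rewrite -addr_eq0 E3.
Qed.

Lemma transport_pair q w b (E : vfield Q) : Ann H q b ->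
  differentiable (vrep (chart_at q) E) (cmap (chart_at q) q) ->
  b (transport_at pi H q w E) =
    dot ('D_(hlift pi H q w) (vrep (chart_at q) E) (cmap (chart_at q) q)) (ccoord (chart_at q) q b) +
    dot (hlift pi H q w *m 'D_(E q) (PVf (chart_at q)) (cmap (chart_at q) q)) (ccoord (chart_at q) q b).
Proof.
move=> Ab dE; have [dX X0 DX] := derive_hlift w (E q) Ab.
have L := lie_center dX dE; rewrite (dot_center q).
have h0 : hlift_vfield pi H (extend (pi q) w) q = hlift pi H q w.
  by rewrite -X0 vrep_center.
rewrite h0 in L; have L' := congr1 (fun z => dot z (ccoord (chart_at q) q b)) L.
apply: (etrans L'); rewrite dotBl.
by apply: (etrans (congr1 (GRing.add _) (congr1 -%R DX))); rewrite opprK.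
Qed.

Lemma prHE q v : prH pi H q v = v - Defs.prV pi H q v.
Proof.
have [_ HV HV0] := H_conn.
have := daddv_pi_add (HV0 q) (w := v); rewrite HV memvf => /(_ isT) e.
by rewrite -{2}e addrK.
Qed.

Lemma derive_prH q h v : let c := chart_at q in
  let X := vrep c (fun q' => prH pi H q' (extend q h q')) in
  [/\ differentiable X (cmap c q), X (cmap c q) = h - h *m PV c q &
      'D_v X (cmap c q) = - (h *m 'D_v (PVf c) (cmap c q))].
Proof.
move=> c X; have [aphi dq] := (chart_at_atlas q, chart_at_dom q).
have XE : \forall y \near cmap c q, h + (- h) *m PVf c y = X y.
  apply: filterS (near_cimg dq) => y iy; have dy := cinv_dom iy.
  rewrite /X /vrep prHE tcoordE mulmxBl -!tcoordE /extend mulNmx.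
  by rewrite /PVf (mul_PV pi H c) of_tcoordK.
have [dE _] : Ck_on 1 (cimg c) (fun y => h + (- h) *m PVf c y).
  have oI : open (cimg c) by exact: cimg_open.
  apply: Ck_add => //; first exact: Ck_cst.
  by apply: Ck_mulmx => //; [exact: Ck_cst|exact: PVf_smooth].
have [dX _] := near_eq_diff XE (dE _ (cimgP dq)).
split => //; first by rewrite -(nbhs_singleton XE) mulNmx (PVfE pi H dq).
have dP := @PVf_center_derivable q v.
have dc : derivable (cst h : 'rV[R]_n -> 'rV[R]_n) (cmap c q) v by exact: derivable_cst.
have dNh : derivable (cst (- h) : 'rV[R]_n -> 'rV[R]_n) (cmap c q) v by exact: derivable_cst.
have dhP : derivable (fun y => (- h) *m PVf c y) (cmap c q) v.
  by have [] := is_derive_mulmx dNh dP.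
have E1 := near_eq_derive v XE.
have E2 := deriveD dc dhP.
have E3 := derive_mulmxl (- h) dP.
rewrite derive_cst add0r in E2.
apply: (etrans (esym E1)); apply: (etrans E2); apply: (etrans E3).
exact: mulNmx.
Qed.

Lemma curvature_pair q b h u : Ann H q b -> h \in H q -> u \in H q ->
  let D v := 'D_v (PVf (chart_at q)) (cmap (chart_at q) q) in
  b (curvature_at pi H q h u) =
    dot (h *m D u) (ccoord (chart_at q) q b) - dot (u *m D h) (ccoord (chart_at q) q b).
Proof.
move=> Ab hH uH D; rewrite /curvature_at /curvature.
set Z := lie _ _ q.
(* The covector annihilates the horizontal part, so the bracket itself can replace its vertical
   projection. *)
have -> : b (Defs.prV pi H q Z) = b Z.
  have := Ab _ (prV_hor H_conn q Z); rewrite linearB /= => /eqP.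
  by rewrite subr_eq0 => /eqP ->.
have [dX X0 DX] := derive_prH q h u; have [dY Y0 DY] := derive_prH q u h.
move/center_hor: (hH) => hP; move/center_hor: (uH) => uP.
rewrite vrep_center hP subr0 in X0; rewrite vrep_center uP subr0 in Y0.
have L := lie_center dX dY; rewrite X0 Y0 in L.
rewrite (dot_center q); apply: (etrans (congr1 (fun z => dot z (ccoord (chart_at q) q b)) L)).
have L2 := congr2 (fun y z => dot (y - z) (ccoord (chart_at q) q b)) DY DX.
apply: (etrans L2); rewrite opprK dotDl dotNl addrC; exact: erefl.
Qed.

(** Transport and curvature are formulated with vectors on [M]; uniqueness of the lift lets them be
    computed with the velocity in [Q]. *)
Lemma hlift_velocity gamma t : {for t, continuous gamma} ->
  derivable (curve_coord (chart_at (gamma t)) gamma) t 1 ->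
  velocity gamma t \in H (gamma t) ->
  hlift pi H (gamma t) (velocity (pi \o gamma) t) = velocity gamma t.
Proof.
move=> cg dx vH; symmetry; have [_ _ limgT] := pi_sub.
apply: hlift_unique => //; rewrite tangent_mapE//.
set q := gamma t in dx vH *.
have dq := chart_at_dom q; have dm := chart_at_dom (pi q).
have [dp _] := derive_picoord pi_sub (velocity gamma t) (chart_at_atlas q)
  (chart_at_atlas (pi q)) dq dm.
have [_ E] := curve_comp dx dp.
apply: (etrans (esym E)); apply: near_eq_derive1.
apply: filterS (curve_near cg (near_cdom dq)) => s ds.
by rewrite /picoord /curve_coord /= cmapK.
Qed.

End Brackets.

(** * The defect of the covector equation *)

Section Defect.
Context {R : realType} {Q M : manifold R} (pi : Q -> M).
Variable H : Q -> {vspace tangent R Q}.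
Hypothesis pi_sub : surjective_submersion pi.
Hypothesis H_conn : ehresmann_connection pi H.
Notation n := (Defs.dim Q).
Notation m := (Defs.dim M).
Notation PV := (PV pi H).
Notation PVf := (PVf pi H).
Variables (gamma : R -> Q) (beta : R -> cotangent R Q) (t : R).
Notation q := (gamma t).
Notation c := (chart_at (gamma t)).
Notation x := (curve_coord (chart_at (gamma t)) gamma).
Notation p := (cov_coord (chart_at (gamma t)) gamma beta).
Hypothesis cg : {for t, continuous gamma}.
Hypothesis dx : derivable x t 1.
Hypothesis dp : derivable p t 1.
Hypothesis vel : velocity gamma t \in H q.
Implicit Types (u v h : 'rV[R]_n) (w : 'rV[R]_m).

(* By [transport_defect] and [curvature_defect], the failure of the transport equation
   on vertical vectors and of the curvature equation on horizontal ones. *)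
Definition defect v : R :=
  dot v (derive1 p t) - dot (velocity gamma t *m 'D_v (PVf c) (cmap c q)) (p t).

Lemma derive_dir_linear (V W : normedModType R) (f : V -> W) y a (v w : V) :
  differentiable f y -> 'D_(a *: v + w) f y = a *: 'D_v f y + 'D_w f y.
Proof.
move=> df; have E1 := deriveE (a *: v + w) df; have E2 := deriveE v df.
by have E3 := deriveE w df; rewrite E1 E2 E3 linearP.
Qed.

Lemma dot_linear_sub a u v (y r r' : 'rV[R]_n) (A B : 'M[R]_n) :
  dot (a *: u + v) r' - dot (y *m (a *: A + B)) r =
  a * (dot u r' - dot (y *m A) r) + (dot v r' - dot (y *m B) r).
Proof. by rewrite mulmxDr -scalemxAr !dotDl !dotZl mulrBr opprD addrACA. Qed.

Lemma defect_linear a u v : defect (a *: u + v) = a * defect u + defect v.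
Proof.
have dP := PVf_differentiable pi_sub H_conn (chart_at_atlas q) (cimgP (chart_at_dom q)).
have E := derive_dir_linear a u v dP.
apply: etrans (dot_linear_sub a u v (velocity gamma t) (p t) (derive1 p t) _ _).
exact: (congr1 (fun A => dot (a *: u + v) (derive1 p t) - dot (velocity gamma t *m A) (p t)) E).
Qed.

Lemma defect0 : defect 0 = 0.
Proof. by have := defect_linear (-1) 0 0; rewrite scaler0 addr0 mulN1r addNr. Qed.

Lemma defect_sum k (f : 'I_k -> R) (v : 'I_k -> 'rV[R]_n) :
  defect (\sum_i f i *: v i) = \sum_i f i * defect (v i).
Proof.
elim/big_ind2 : _ => [|r u s v' <- <-|i _]; first exact: defect0.
  by have := defect_linear 1 u v'; rewrite scale1r mul1r.
by have := defect_linear (f i) (v i) 0; rewrite !addr0 defect0 addr0.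
Qed.

Lemma covector_equation_defect : covector_equation pi H c gamma beta t <-> forall v, defect v = 0.
Proof.
split=> E v; last by apply/eqP; rewrite -subr_eq0; apply/eqP; exact: E.
by rewrite /defect E subrr.
Qed.

(** Differentiate [p = p P^T] along the curve and pair with a horizontal [h]: the term with [p' P^T]
    drops out, and p'(h) becomes [p] applied to [h] times the derivative of [P] along the velocity.
    The defect on [h] is then a difference of two derivatives of [P], which [curvature_pair]
    identifies. *)
Lemma curvature_defect w : (\near t, Ann H (gamma t) (beta t)) ->
  covector_curvature pi H q (beta t) (velocity (pi \o gamma) t) w =
  - defect (hlift pi H q w).
Proof.
move=> nA; have A := nbhs_singleton nA.
have hH : hlift pi H q w \in H q by exact: memv_pi.
rewrite /covector_curvature (hlift_velocity pi_sub H_conn cg dx vel).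
rewrite (curvature_pair pi_sub H_conn A vel hH) /defect opprB; congr (_ - _).
have dP := PVf_differentiable pi_sub H_conn (chart_at_atlas q) (cimgP (chart_at_dom q)).
have [dPx dPxE] := curve_comp dx dP.
have [_ dE] := derive1_mulmx_tr dp dPx.
have nE : \forall s \near t, p s = p s *m ((PVf c \o x) s)^T.
  apply: filterS2 nA (curve_near cg (near_cdom (chart_at_dom q))) => s As ds.
  by apply: esym; apply: (Ann_ccoord H_conn (beta s) (chart_at_atlas q) ds).1.
have E := etrans (near_eq_derive1 nE) dE; rewrite dPxE in E.
move: hH => /(center_hor H_conn) hP.
have E2 := congr1 (dot (hlift pi H q w)) E.
rewrite dotDr -!dot_mul /= (PVfE pi H (chart_at_dom q)) hP dot0l add0r in E2.
by rewrite E2.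
Qed.

Lemma defect_ring (f f' D d r b B T g : R) : g = b -> T = D + r -> B = f' * b + f * T ->
  f * (D + d) + g * f' = B + f * (d - r).
Proof. by move=> -> -> ->; ring. Qed.

(** Leibniz rule for [V] as a combination of the [E i]; for each of these, [transport_pair] splits
    the derivative of its pairing with [beta] into the transport term and the defect. In particular
    [beta t W] is the same for all representations of [V]. *)
Lemma transport_defect V W : (\near t, Ann H (gamma t) (beta t)) ->
  transport_along pi H gamma V t W ->
  @is_derive R R^o R^o t 1 (fun s => beta s (V s)) (beta t W + defect (V t)).
Proof.
move=> nA [k [E [f [sE df VE ->]]]]; have A := nbhs_singleton nA.
pose e i := vrep c (E i).
have de i : differentiable (e i) (cmap c q).
  by have [[U [oU Uq] sU] _] := sE i; have [d _] := sU 1; exact: d.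
pose g i s : R^o := dot ((e i \o x) s) (p s).
have dg i : is_derive (t : R^o) 1 (g i)
    (dot ('D_(velocity gamma t) (e i) (cmap c q)) (p t) + dot (E i q) (derive1 p t)).
  have [dex dexE] := curve_comp dx (de i).
  have := is_derive_dot dex dp.
  rewrite dexE /= /e vrep_center; exact.
have fE i : is_derive (t : R^o) 1 (f i : R^o -> R^o) (derive1 (f i) t).
  by rewrite derive1E; apply/derivableP; exact: df.
have dfg i := is_deriveM (fE i) (dg i).
have nE : \forall s \near t, (\sum_i (f i : R^o -> R^o) * g i) s = beta s (V s).
  apply: filterS2 VE (curve_near cg (near_cdom (chart_at_dom q))) => s -> ds.
  rewrite linear_sum fct_sumE; apply: eq_bigr => i _; rewrite linearZ /=.
  rewrite (ccoord_pair (beta s) _ (chart_at_atlas q) ds).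
  have eE : (e i \o x) s = tcoord c (gamma s) (E i (gamma s)).
    by rewrite /e /vrep /curve_coord /= (cmapK ds).
  by rewrite -eE.
apply: (near_eq_is_derive nE); apply: is_derive_eq (is_derive_sum dfg) _.
rewrite (nbhs_singleton VE) defect_sum linear_sum -big_split; apply: eq_bigr => i _.
have TP := transport_pair pi_sub H_conn (velocity (pi \o gamma) t) A (de i).
rewrite (hlift_velocity pi_sub H_conn cg dx vel) in TP.
have gE : g i t = beta t (E i q) by rewrite (dot_center q) /g /e /= vrep_center.
apply: defect_ring gE TP _.
have := linearP (beta t) (derive1 (f i) t) (E i q)
  (f i t *: transport_at pi H q (velocity (pi \o gamma) t) (E i)).
by rewrite linearZ => ->.
Qed.

Lemma prV_frame phi q0 v : atlas Q phi -> cdom phi q0 -> Defs.prV pi H q0 v =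
  \sum_j tcoord phi q0 v 0 j *: Defs.prV pi H q0 (of_tcoord phi q0 (delta_mx 0 j)).
Proof.
move=> aphi dq; rewrite -{1}(tcoordK aphi dq v) {1}(row_sum_delta (tcoord phi q0 v)).
rewrite of_tcoordE mulmx_suml /Defs.prV linear_sum; apply: eq_bigr => j _.
by rewrite -scalemxAl linearZ of_tcoordE.
Qed.

(** [cotransport_along] says something only about those [W] that exist. The vertical projections of
    the coordinate fields span the vertical spaces, and for a vertical [V] its own components serve
    as coefficients. *)
Lemma transport_along_exists V : (\forall s \near t, V s \in vertical pi (gamma s)) ->
  derivable (fun s => tcoord c (gamma s) (V s)) t 1 ->
  exists W, transport_along pi H gamma V t W.
Proof.
move=> nV dV; have aphi := chart_at_atlas q.
pose E (j : 'I_n) : vfield Q := fun q' => Defs.prV pi H q' (extend q (delta_mx 0 j) q').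
pose f (j : 'I_n) s : R := tcoord c (gamma s) (V s) 0 j.
eexists; exists n, E, f; split; last exact: erefl.
- move=> j; split; last by apply: nearW => q'; exact: memv_pi.
  exists (cimg c); first by split; [exact: cimg_open|exact: cimgP (chart_at_dom q)].
  move=> k; have -> : vrep c (E j) = (fun y => delta_mx 0 j *m PVf c y).
    by apply/funext => y; rewrite /PVf mul_PV.
  apply: Ck_mulmx; [exact: cimg_open|exact: Ck_cst|exact: PVf_smooth].
- by move=> j; move/derivable_mxP : dV; exact.
- apply: filterS2 nV (curve_near cg (near_cdom (chart_at_dom q))) => s Vs ds.
  rewrite /f /E /extend -(prV_frame _ aphi ds).
  by rewrite (prV_unique H_conn Vs) ?subrr ?mem0v.
Qed.

Lemma covector_equation_transport V W : (\near t, Ann H (gamma t) (beta t)) ->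
  covector_equation pi H c gamma beta t -> transport_along pi H gamma V t W ->
  @is_derive R R^o R^o t 1 (fun s => beta s (V s)) ((0 : cotangent R Q) (V t) + beta t W).
Proof.
move=> nA /covector_equation_defect E VW; have := transport_defect nA VW.
by rewrite E addr0 lfunE /= add0r.
Qed.

Lemma covector_equation_curvature w : (\near t, Ann H (gamma t) (beta t)) ->
  covector_equation pi H c gamma beta t ->
  covector_curvature pi H q (beta t) (velocity (pi \o gamma) t) w = 0.
Proof. by move=> nA /covector_equation_defect E; rewrite curvature_defect// E oppr0. Qed.

Lemma defect_transport V : (\near t, Ann H (gamma t) (beta t)) ->
  (\forall s \near t, V s \in vertical pi (gamma s)) ->
  derivable (fun s => tcoord c (gamma s) (V s)) t 1 ->
  (forall W, transport_along pi H gamma V t W ->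
    @is_derive R R^o R^o t 1 (fun s => beta s (V s)) ((0 : cotangent R Q) (V t) + beta t W)) ->
  defect (V t) = 0.
Proof.
move=> nA nV dV HW; have [W VW] := transport_along_exists nV dV.
have [_ E1] := transport_defect nA VW; have [_ E2] := HW W VW.
have := etrans (esym E1) E2; rewrite lfunE /= add0r => /eqP.
by rewrite -subr_eq0 addrAC subrr add0r => /eqP.
Qed.

(** The horizontal part of a vector is the lift of its own image in [M] and falls under the
    curvature condition; the vertical part is a combination of the projected coordinate vectors. *)
Lemma covector_equation_of_parts phi : atlas Q phi -> cdom phi q -> (\near t, Ann H (gamma t) (beta t)) ->
  (forall w, covector_curvature pi H q (beta t) (velocity (pi \o gamma) t) w = 0) ->
  (forall j, defect (Defs.prV pi H q (of_tcoord phi q (delta_mx 0 j))) = 0) ->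
  covector_equation pi H c gamma beta t.
Proof.
move=> aphi dq nA C D; apply/covector_equation_defect => v.
have [_ _ limgT] := pi_sub.
have hv : v - Defs.prV pi H q v = hlift pi H q (tangent_map pi q (v - Defs.prV pi H q v)).
  by apply: hlift_unique => //; exact: prV_hor.
rewrite -[v](subrK (Defs.prV pi H q v)) -[X in defect (X + _)]scale1r defect_linear mul1r.
have -> : defect (v - Defs.prV pi H q v) = 0.
  rewrite hv; apply/eqP; rewrite -oppr_eq0 -curvature_defect//; apply/eqP; exact: C.
by rewrite (prV_frame v aphi dq) defect_sum add0r big1// => j _; rewrite D mulr0.
Qed.

End Defect.

(** * From pointwise to almost everywhere *)

Section ChartwiseArguments.
Context {R : realType} {Q : manifold R}.
Notation n := (Defs.dim Q).
Implicit Types (phi psi : chart R Q n) (a b c d t : R) (gamma : R -> Q).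

Lemma within_continuous_near gamma a b t (A : set Q) :
  {within `[a, b], continuous gamma} -> a <= t <= b -> nbhs (gamma t) A ->
  exists2 r : R, 0 < r & forall s, a <= s <= b -> `|s - t| < r -> A (gamma s).
Proof.
move=> /subspace_continuousP cg tab nA; have := cg t tab A nA.
move=> [r /= r0 rA]; exists r => // s sab st.
by apply: rA => //=; rewrite distrC.
Qed.

Lemma within_continuous_interior gamma a b t : {within `[a, b], continuous gamma} ->
  a < t < b -> {for t, continuous gamma}.
Proof.
move=> cg tab A nA; have tab' : a <= t <= b by case/andP: tab => /ltW -> /ltW ->.
have [r r0 rA] := within_continuous_near cg tab' nA.
case/andP: tab => at_ tb.
have nab : \forall s \near t, a < s < b.
  by apply: filterS2 (lt_nbhsr at_) (lt_nbhsl tb) => s -> ->.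
have nr : \forall s \near t, `|s - t| < r.
  by apply/nbhs_ballP; exists r => // s; rewrite /ball /= distrC.
apply: filterS2 nab nr => s /andP[s1 s2] sr /=.
by apply: rA => //; rewrite (ltW s1) (ltW s2).
Qed.

(** Near each time the curve stays in one chart, so compactness reduces an additive property to
    pieces within a single chart. *)
Lemma chart_ind gamma a b (P : R -> R -> Prop) : a <= b ->
  {within `[a, b], continuous gamma} ->
  (forall c d e, a <= c -> c <= d -> d <= e -> e <= b -> P c d -> P d e -> P c e) ->
  chartwise a b gamma (fun=> P) -> P a b.
Proof.
move=> ab cg glue HP; apply: interval_ind => // t tab.
have [r r0 rA] := within_continuous_near cg tab (near_cdom (chart_at_dom (gamma t))).
exists r => // c d ac cd db ct dt.
apply: (HP _ (chart_at_atlas (gamma t))) => // s /andP[cs sd].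
apply: rA; first by rewrite (le_trans ac cs) (le_trans sd db).
move: ct dt; rewrite !ltr_norml => /andP[c1 c2] /andP[d1 d2].
by apply/andP; split; lra.
Qed.

Lemma ae_chart_ind gamma a b (P : R -> Prop) : a <= b ->
  {within `[a, b], continuous gamma} ->
  chartwise a b gamma (fun _ c d => ae_on c d P) -> ae_on a b P.
Proof.
move=> ab cg; apply: (chart_ind ab cg) => c d e _ _ _ _.
apply: (@filterS2 _ _ (ae_filter_ringOfSetsType (@lebesgue_measure R))) => t H1 H2 /andP[ct te].
by have [td|dt] := leP t d; [apply: H1|apply: H2]; apply/andP; split=> //; exact: ltW.
Qed.

Lemma ae_interior a b : ae_on a b (fun t => a < t < b).
Proof. by apply: ae_on_oo; apply: aeW. Qed.

End ChartwiseArguments.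

Section RegularTimes.
Context {R : realType} {Q : manifold R}.
Notation n := (Defs.dim Q).
Implicit Types (phi psi : chart R Q n) (a b c d t : R) (gamma : R -> Q).
Implicit Types (beta : R -> cotangent R Q) (V : R -> tangent R Q).

(** Stated in the central chart; by [regular_chart] every other chart around [gamma t] gives the
    same differentiability. *)
Definition regular gamma beta t :=
  [/\ {for t, continuous gamma},
      derivable (curve_coord (chart_at (gamma t)) gamma) t 1 &
      derivable (cov_coord (chart_at (gamma t)) gamma beta) t 1].

Lemma regular_chart gamma beta t phi : regular gamma beta t -> atlas Q phi ->
  cdom phi (gamma t) ->
  derivable (curve_coord phi gamma) t 1 /\ derivable (cov_coord phi gamma beta) t 1.
Proof.
move=> [cg dx dp] aphi dphi; have [ac dc] := (chart_at_atlas (gamma t), chart_at_dom (gamma t)).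
have [dx' _] := curve_coord_derive cg ac aphi dc dphi dx.
by have [dp' _] := cov_coord_derive cg aphi ac dphi dc dx' dp.
Qed.

Lemma ae_regular gamma beta a b : a <= b -> ac_L2_curve a b gamma ->
  ac_covector_along a b gamma beta -> ae_on a b (regular gamma beta).
Proof.
move=> ab [cg gA] bA; apply: (ae_chart_ind ab cg) => phi aphi c d ac cd db dphi.
have [gAC _] := gA _ aphi _ _ ac cd db dphi.
have bAC := bA _ aphi _ _ ac cd db dphi.
have H := ae_onI (ae_interior c d) (ae_onI (ac_derivable cd gAC) (ac_derivable cd bAC)).
apply: ae_onS H => t tcd [/andP[ct td] [dx dp]].
have ct' : {for t, continuous gamma}.
  by apply: (within_continuous_interior cg); rewrite (le_lt_trans ac ct) (lt_le_trans td db).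
have dt := dphi _ tcd; have [ac' dc'] := (chart_at_atlas (gamma t), chart_at_dom (gamma t)).
have [dx' _] := curve_coord_derive ct' aphi ac' dt dc' dx.
by have [dp' _] := cov_coord_derive ct' ac' aphi dc' dt dx' dp; split.
Qed.

Lemma velocity_chart phi gamma t : {for t, continuous gamma} -> atlas Q phi ->
  cdom phi (gamma t) -> derivable (curve_coord (chart_at (gamma t)) gamma) t 1 ->
  of_tcoord phi (gamma t) (derive1 (curve_coord phi gamma) t) = velocity gamma t.
Proof.
move=> cg aphi dphi dx.
have [_ E] := curve_coord_derive cg (chart_at_atlas _) aphi (chart_at_dom _) dphi dx.
by rewrite E -tcoordE tcoordK.
Qed.

Lemma tcoord_derivable phi psi gamma V t : {for t, continuous gamma} -> atlas Q phi ->
  atlas Q psi -> cdom phi (gamma t) -> cdom psi (gamma t) ->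
  derivable (curve_coord phi gamma) t 1 ->
  derivable (fun s => tcoord phi (gamma s) (V s)) t 1 ->
  derivable (fun s => tcoord psi (gamma s) (V s)) t 1.
Proof.
move=> cg aphi apsi dphi dpsi dx dV.
have [dJ _] := jacf_smooth aphi apsi 1.
have [dJx _] := curve_comp dx (dJ _ (overlapP dphi dpsi)).
have [d _] := is_derive_mulmx dV dJx.
apply: near_eq_derivable d.
apply: filterS2 (curve_near cg (near_cdom dphi)) (curve_near cg (near_cdom dpsi)) => s d1 d2.
have J : jac (chart_at (gamma s)) phi (gamma s) *m jac phi psi (gamma s) =
    jac (chart_at (gamma s)) psi (gamma s).
  by apply: jac_mul => //; [exact: chart_at_atlas|exact: chart_at_dom].
by rewrite !tcoordE -J mulmxA.
Qed.

End RegularTimes.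

(** * From abnormal extremals to parallel covectors *)

Section AbnormalToTransport.
Context {R : realType} {Q M : manifold R} (pi : Q -> M).
Variable H : Q -> {vspace tangent R Q}.
Hypothesis pi_sub : surjective_submersion pi.
Hypothesis H_conn : ehresmann_connection pi H.
Notation n := (Defs.dim Q).
Variables (a b : R) (gamma : R -> Q).
Hypothesis ab : a < b.
Hypothesis gamma_hor : horizontal_curve H a b gamma.
Implicit Types (beta : R -> cotangent R Q) (t : R).

Definition transport_equations beta : Prop :=
  cotransport_along pi H a b gamma beta (fun=> 0) /\
  ae_on a b (fun t => forall u : tangent R M,
    covector_curvature pi H (gamma t) (beta t) (velocity (pi \o gamma) t) u = 0).

Definition regular_horizontal beta t := [/\ a < t < b, regular gamma beta t & velocity gamma t \in H (gamma t)].

Lemma ae_regular_horizontal beta : ac_covector_along a b gamma beta -> ae_on a b (regular_horizontal beta).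
Proof.
move=> bA; have [gA gH] := gamma_hor.
have := ae_onI (ae_interior a b) (ae_onI (ae_regular (ltW ab) gA bA) gH).
by apply: ae_onS => t _ [? []]; split.
Qed.

Lemma near_interior t : a < t < b -> \forall s \near t, a <= s <= b.
Proof.
case/andP=> at_ tb; apply: filterS2 (lt_nbhsr at_) (lt_nbhsl tb) => s s1 s2.
by rewrite (ltW s1) (ltW s2).
Qed.

Lemma covector_equation_equations beta : (forall t, a <= t <= b -> Ann H (gamma t) (beta t)) ->
  ac_covector_along a b gamma beta ->
  ae_on a b (fun t => covector_equation pi H (chart_at (gamma t)) gamma beta t) ->
  transport_equations beta.
Proof.
move=> bH bA E; have G := ae_onI (ae_regular_horizontal bA) E.
have nA t : a < t < b -> \near t, Ann H (gamma t) (beta t).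
  by move=> /near_interior; apply: filterS => s; exact: bH.
split; first split; first by move=> t _ v _; rewrite lfunE.
  move=> V _ _; apply: ae_onS G => t _ [[tab [cg dx dp] vH] Et] W VW.
  exact: (covector_equation_transport pi_sub H_conn cg dx dp vH (nA t tab) Et VW).
apply: ae_onS G => t _ [[tab [cg dx dp] vH] Et] u.
exact: (covector_equation_curvature pi_sub H_conn cg dx dp vH u (nA t tab) Et).
Qed.

Lemma abnormal_equations (S : subRiemannian Q) : hdistr S = H ->
  abnormal_curve S a b gamma -> exists beta : R -> cotangent R Q,
    [/\ (forall t, a <= t <= b -> Ann H (gamma t) (beta t)),
        ac_covector_along a b gamma beta,
        (exists2 t, a <= t <= b & beta t != 0) & transport_equations beta].
Proof.
move=> SH [lam [[_ lamA] lamH lam0 lamE] lamg]; rewrite SH in lamH lamE.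
pose beta t := (lam t).2; exists beta.
have aab : a <= a <= b by rewrite lexx (ltW ab).
have bH t : a <= t <= b -> Ann H (gamma t) (beta t).
  by move=> tab; rewrite -lamg//; exact: lamH.
have bA : ac_covector_along a b gamma beta.
  move=> phi aphi c d ac cd db dphi.
  have inab t : c <= t <= d -> a <= t <= b.
    by move=> /andP[ct td]; rewrite (le_trans ac ct) (le_trans td db).
  have dl t : c <= t <= d -> cdom phi ((fst \o lam) t).
    by move=> tcd; rewrite /= lamg ?inab//; exact: dphi.
  have [lamAC _] := lamA _ aphi _ _ ac cd db dl.
  apply: (@ac_ext _ _ _ _ (fun t => ccoord phi (lam t).1 (lam t).2)).
    by move=> t tcd; rewrite lamg ?inab.
  apply: (ac_dom1 (K := 1)) lamAC => s t _ _ _; rewrite mul1r.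
  by rewrite prod_normE /= le_max lexx orbT.
split => //; first by exists a => //; exact: lam0.
apply: covector_equation_equations => //.
(* [lam] lies over [gamma] only on [[a, b]]. The curve [lam'] does so for all times and agrees with
   [lam] near interior ones, so the velocities there coincide. *)
pose lam' t : cotangent_bundle Q := (gamma t, beta t).
have G := ae_onI (ae_regular_horizontal bA) lamE.
apply: ae_onS G => t tab [[tab' [cg dx dp] vH] Et].
have lE : lam t = lam' t by rewrite /lam' -lamg// -surjective_pairing.
have lN : \forall s \near t, lam s = lam' s.
  apply: filterS (near_interior tab') => s sab.
  by rewrite /lam' -lamg// -surjective_pairing.
have vE : cotangent_velocity lam t = cotangent_velocity lam' t.
  rewrite /cotangent_velocity lE; apply: near_eq_derive1.
  by apply: filterS lN => s /= ->.
rewrite vE lE in Et.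
have hx := (center_hor H_conn (gamma t) (velocity gamma t)).2 vH.
exact: (@abnormal_covector_equation _ _ _ _ _ pi_sub H_conn lam' t (bH _ tab) dx dp hx).1 Et.
Qed.

End AbnormalToTransport.

(** * Cut-off of fields along a curve *)

Section TestFields.
Context {R : realType}.
Implicit Types (a b c d t : R).

Lemma ac_bounded (V : normedModType R) a b (f : R -> V) : a <= b -> abs_continuous a b f ->
  exists2 K : R, 0 <= K & forall t, a <= t <= b -> `|f t| <= K.
Proof.
move=> ab fA.
have [|K KP] := bounded_comp (U := setT) (g := (id : V -> V)) ab _ fA (fun _ _ => I).
  by move=> y _; exact: cvg_id.
by exists `|K| => // t tab; rewrite (le_trans (KP _ tab))// ler_norm.
Qed.

Lemma scale_bound (K L A B x y : R) : 0 <= A -> 0 <= B -> 0 <= K -> 0 <= L ->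
  x <= L -> y <= K -> A * x + y * B <= K * A + K * B + (L * A + L * B).
Proof. by move=> *; nra. Qed.

Lemma ac_scale (V : normedModType R) a b (f : R -> R) (g : R -> V) : a <= b ->
  @abs_continuous R R^o a b f -> abs_continuous a b g ->
  abs_continuous a b (fun t => f t *: g t).
Proof.
move=> ab fA gA.
have [K K0 fK] := ac_bounded ab fA; have [L L0 gL] := ac_bounded ab gA.
apply: (ac_dom (K := K + L) _ fA gA) => s t sa st tb.
have sab : a <= s <= b by rewrite sa (le_trans st tb).
have tab : a <= t <= b by rewrite (le_trans sa st) tb.
have -> : f t *: g t - f s *: g s = (f t - f s) *: g t + f s *: (g t - g s).
  by rewrite scalerBl scalerBr addrA subrK.
rewrite (le_trans (ler_normD _ _))// !normrZ mulrDl !mulrDr.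
exact: (scale_bound (normr_ge0 _) (normr_ge0 _) K0 L0 (gL _ tab) (fK _ sab)).
Qed.

(* Vanishing at both ends of [c, d] makes the extension by 0 absolutely
   continuous. *)
Definition bump c d t : R := if c <= t <= d then (t - c) * (d - t) else 0.

Lemma bump_out c d t : t <= c \/ d <= t -> bump c d t = 0.
Proof.
rewrite /bump; case: ifP => // /andP[ct td] [tc|dt].
  by have -> : t = c; [apply/eqP; rewrite eq_le tc ct|rewrite subrr mul0r].
by have -> : t = d; [apply/eqP; rewrite eq_le td dt|rewrite subrr mulr0].
Qed.

Lemma bump_gt0 c d t : c < t < d -> 0 < bump c d t.
Proof.
by move=> /andP[ct td]; rewrite /bump (ltW ct) (ltW td) mulr_gt0// subr_gt0.
Qed.

(** [f] is controlled only within [[c, d]], as is a field defined through a chart. Cutting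
    [[c', d']] at [c] and [d] leaves outer pieces on which the product is 0. *)
Lemma ac_bump_scale (V : normedModType R) c d c' d' (f : R -> V) : c <= d -> c' <= d' ->
  (forall u v, c' <= u -> u <= v -> v <= d' -> c <= u -> v <= d -> abs_continuous u v f) ->
  abs_continuous c' d' (fun t => bump c d t *: f t).
Proof.
move=> cd cd' fA; set F := fun t => _.
have F0 u v : (forall t, u <= t <= v -> t <= c \/ d <= t) -> abs_continuous u v F.
  move=> O; apply: (@ac_ext _ _ _ _ (fun=> 0)); last exact: ac_cst.
  by move=> t /O tO; rewrite /F bump_out// scale0r.
have Fin u v : c' <= u -> u <= v -> v <= d' -> c <= u -> v <= d -> abs_continuous u v F.
  move=> c'u uv vd' cu vd.
  apply: (@ac_ext _ _ _ _ (fun t => (t - c) *: ((d - t) *: f t))).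
    move=> t /andP[ut tv]; rewrite /F /bump (le_trans cu ut) (le_trans tv vd).
    by rewrite scalerA.
  have lin (k : R) : @abs_continuous R R^o u v (fun t => t - k).
    by apply: (ac_dom1 (K := 1)) (ac_id u v) => s t _ _ _; rewrite mul1r opprB addrA subrK.
  apply: ac_scale => //; apply: ac_scale => //; last exact: fA.
  apply: (ac_dom1 (K := 1)) (ac_id u v) => s t _ _ _; rewrite mul1r.
  have E : `|(d - t) - (d - s)| = `|t - s| by rewrite -[RHS]normrN; congr (`|_|); ring.
  by have -> := E.
have [d'c|cd'c] := leP d' c.
  by apply: F0 => t /andP[_ td']; left; exact: le_trans td' d'c.
have [dc'|c'd] := leP d c'.
  by apply: F0 => t /andP[ct _]; right; exact: le_trans dc' ct.
have right u : c' <= u -> u <= d -> u <= d' -> c <= u -> abs_continuous u d' F.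
  move=> c'u ud ud' cu; have [d'd|dd'] := leP d' d; first exact: Fin.
  apply: (ac_cat ud (ltW dd')); first by apply: Fin => //; exact: ltW.
  by apply: F0 => t /andP[dt _]; right.
have [c'c|cc'] := leP c' c; last by apply: right => //; exact: ltW.
apply: (ac_cat c'c (ltW cd'c)); last by apply: right => //; exact: ltW.
by apply: F0 => t /andP[_ tc]; left.
Qed.

End TestFields.

Lemma ae_on_sub (R : realType) (a b c d : R) (P : R -> Prop) : a <= c -> d <= b ->
  ae_on a b P -> ae_on c d P.
Proof.
move=> ac db; apply: (@filterS _ _ (ae_filter_ringOfSetsType (@lebesgue_measure R))).
by move=> t Pt /andP[ct td]; apply: Pt; rewrite (le_trans ac ct) (le_trans td db).
Qed.

(** * From parallel covectors to abnormal extremals *)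

Section TransportToAbnormal.
Context {R : realType} {Q M : manifold R} (pi : Q -> M).
Variable H : Q -> {vspace tangent R Q}.
Hypothesis pi_sub : surjective_submersion pi.
Hypothesis H_conn : ehresmann_connection pi H.
Notation n := (Defs.dim Q).
Notation PVf := (PVf pi H).
Notation PV := (PV pi H).
Variables (a b : R) (gamma : R -> Q) (beta : R -> cotangent R Q).
Hypothesis ab : a < b.
Hypothesis gamma_hor : horizontal_curve H a b gamma.
Hypothesis beta_ann : forall t, a <= t <= b -> Ann H (gamma t) (beta t).
Hypothesis beta_ac : ac_covector_along a b gamma beta.
Implicit Types (phi psi : chart R Q n) (t : R).

(** Outside [[c, d]] the curve may leave [phi], and [of_tcoord phi] loses its meaning; the factor
    [bump] is 0 there. *)
Definition test_field phi c d (j : 'I_n) t : tangent R Q :=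
  bump c d t *: Defs.prV pi H (gamma t) (of_tcoord phi (gamma t) (delta_mx 0 j)).

Lemma test_field_vert phi c d j t : test_field phi c d j t \in vertical pi (gamma t).
Proof. by apply: memvZ; exact: memv_pi. Qed.

(** Absolute continuity is required in every chart [psi]. Apart from the cut-off, the field is there
    a C^1 function of the coordinates in [phi] on the overlap of both charts. *)
Lemma test_field_ac phi c d j : atlas Q phi -> a <= c -> c <= d -> d <= b ->
  (forall t, c <= t <= d -> cdom phi (gamma t)) ->
  ac_vfield_along a b gamma (test_field phi c d j).
Proof.
move=> aphi ac cd db dphi psi apsi c' d' ac' cd' db' dpsi.
have [[_ gA] _] := gamma_hor.
have -> : (fun t => tcoord psi (gamma t) (test_field phi c d j t)) =
    (fun t => bump c d t *: tcoord psi (gamma t)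
      (Defs.prV pi H (gamma t) (of_tcoord phi (gamma t) (delta_mx 0 j)))).
  by apply/funext => t; rewrite /test_field !tcoordE -scalemxAl.
apply: ac_bump_scale => // u v c'u uv vd' cu vd.
have dphi' t : u <= t <= v -> cdom phi (gamma t).
  by move=> /andP[ut tv]; apply: dphi; rewrite (le_trans cu ut) (le_trans tv vd).
have dpsi' t : u <= t <= v -> cdom psi (gamma t).
  by move=> /andP[ut tv]; apply: dpsi; rewrite (le_trans c'u ut) (le_trans tv vd').
have oO : open (overlap phi psi) by exact: overlap_open.
have sO : overlap phi psi `<=` cimg phi by move=> _ [q [d1 d2] <-]; exact: cimgP.
pose g y : 'rV[R]_n := (delta_mx 0 j *m PVf phi y) *m jacf phi psi y.
have sg : Ck_on 1 (overlap phi psi) g.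
  apply: Ck_mulmx => //; last exact: jacf_smooth.
  apply: Ck_mulmx => //; first exact: Ck_cst.
  by apply: (Ck_sub sO); exact: PVf_smooth.
have [xA _] := gA _ aphi _ _ (le_trans ac cu) uv (le_trans vd db) dphi'.
apply: ac_ext (ac_comp uv oO sg xA _) => t tuv; have [d1 d2] := (dphi' t tuv, dpsi' t tuv).
  rewrite /= /g (PVfE pi H d1) mul_PV !tcoordE -mulmxA -jacE.
  by rewrite (jac_mul (chart_at_atlas _) aphi apsi (chart_at_dom _) d1 d2).
exact: overlapP.
Qed.

Hypothesis beta_eqs : transport_equations pi H a b gamma beta.

Lemma near_ann t : a < t < b -> \near t, Ann H (gamma t) (beta t).
Proof. by move=> /near_interior; apply: filterS => s; exact: beta_ann. Qed.

(** On a piece within one chart, the exceptional sets of the [n] test fields have a null union. At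
    the other interior times the defect vanishes on the test fields, and by linearity the positive
    value of the cut-off can be divided out. *)
Lemma ae_covector_equation : ae_on a b (fun t => covector_equation pi H (chart_at (gamma t)) gamma beta t).
Proof.
have [[cg gA] _] := gamma_hor; have [[_ T] C] := beta_eqs.
apply: (ae_chart_ind (ltW ab) cg) => phi aphi c d ac cd db dphi.
pose V j := test_field phi c d j.
have VA j : abs_continuous c d (fun t => tcoord phi (gamma t) (V j t)).
  exact: (test_field_ac j aphi ac cd db dphi aphi).
have VT j := T (V j) (fun t _ => test_field_vert phi c d j t) (test_field_ac j aphi ac cd db dphi).
have G1 := ae_on_sub ac db (ae_onI (ae_regular_horizontal ab gamma_hor beta_ac) C).
have G2 := ae_on_all (fun j => ae_onI (ac_derivable cd (VA j)) (ae_on_sub ac db (VT j))).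
have G := ae_onI (ae_interior c d) (ae_onI G1 G2).
apply: ae_onS G => t tcd [tcd' [[[tab reg vH] Ct] VG]].
have dt := dphi _ tcd; have nA := near_ann tab.
have [dxphi _] := regular_chart reg aphi dt; have [cgt dx dp] := reg.
apply: (covector_equation_of_parts pi_sub H_conn cgt dx dp vH aphi dt nA Ct) => j.
have [dV VW] := VG j.
have dV' := tcoord_derivable cgt aphi (chart_at_atlas _) dt (chart_at_dom _) dxphi dV.
have nV : \forall s \near t, V j s \in vertical pi (gamma s).
  by apply: filterS nA => s _; exact: test_field_vert.
have := defect_transport pi_sub H_conn cgt dx dp vH nA nV dV' VW.
rewrite /V /test_field -[bump c d t *: _]addr0 defect_linear// defect0// addr0.
by move=> /eqP; rewrite mulf_eq0 gt_eqF ?bump_gt0// => /eqP.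
Qed.

Lemma mulmx_norm_le m (u : 'rV[R]_n) (A : 'M[R]_(n, m)) : `|u *m A| <= n%:R * (`|u| * `|A|).
Proof.
apply: norm_mx_le => [|i j]; first by rewrite !mulr_ge0.
have -> : (u *m A) i j = dot u (col j A)^T.
  by rewrite ord1 /dot trmxK !mxE; apply: eq_bigr => k _; rewrite mxE.
rewrite (le_trans (dot_le _ _))// ler_wpM2l// ler_wpM2l//.
by apply: norm_mx_le => // k l; rewrite !mxE norm_mx_coord.
Qed.

Lemma norm_product_bound (N X y A S r : R) : 0 <= N -> 0 <= y -> 0 <= r ->
  X <= N * (y * A) -> A <= S -> N * (X * r) <= N * N * S * y * r.
Proof.
move=> N0 y0 r0 XA AS; have -> : N * N * S * y * r = N * ((N * (y * S)) * r) by ring.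
apply: ler_wpM2l => //; apply: ler_wpM2r => //; apply: le_trans XA _.
by do 2! apply: ler_wpM2l => //.
Qed.

(** The partial derivatives of the vertical projection are bounded along a compact piece of the
    curve, which makes the constant uniform in [t]. *)
Lemma covector_equation_bound phi c d : atlas Q phi -> a <= c -> c <= d -> d <= b ->
  (forall t, c <= t <= d -> cdom phi (gamma t)) ->
  exists2 K : R, 0 <= K & ae_on c d (fun t =>
    `|derive1 (cov_coord phi gamma beta) t| <=
      K * `|derive1 (curve_coord phi gamma) t| * `|cov_coord phi gamma beta t|).
Proof.
move=> aphi ac cd db dphi; have [[cg gA] _] := gamma_hor.
have [xA _] := gA _ aphi _ _ ac cd db dphi.
have [_ sP] := PVf_smooth pi_sub H_conn aphi 1.
have dI t : c <= t <= d -> cimg phi ((cmap phi \o gamma) t) by move=> /dphi; exact: cimgP.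
have /choice[B BP] : forall i : 'I_n, exists B : R, forall t, c <= t <= d ->
    `|'D_(delta_mx 0 i) (PVf phi) (cmap phi (gamma t))| <= B.
  move=> i; have [B BP] := bounded_comp cd (fun y => sP (delta_mx 0 i) y) xA dI.
  by exists B.
(* One factor [n] stems from the pairing, the other from the product with a matrix, both for the
   maximum norm. *)
pose K := n%:R * n%:R * \sum_i `|B i|.
exists K; first by rewrite !mulr_ge0// sumr_ge0.
have G : ae_on c d (fun t => regular_horizontal H a b gamma beta t /\
    covector_equation pi H (chart_at (gamma t)) gamma beta t).
  exact: ae_on_sub ac db (ae_onI (ae_regular_horizontal ab gamma_hor beta_ac) ae_covector_equation).
apply: ae_onS G => t tcd [[tab reg vH] E]; have dt := dphi _ tcd; have [cgt dx dp] := reg.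
have tab' : a <= t <= b by case/andP: tab => /ltW -> /ltW ->.
have [dx' dp'] := regular_chart reg aphi dt.
have hx : derive1 (curve_coord phi gamma) t *m PV phi (gamma t) = 0.
  by apply/(mulPV_eq0 H_conn _ aphi dt); rewrite velocity_chart.
have Ephi := covector_equation_transfer pi_sub H_conn cgt aphi (chart_at_atlas _) dt (chart_at_dom _)
  dx' dp hx (beta_ann tab') E.
apply: norm_mx_le => [|i j]; first by rewrite !mulr_ge0// sumr_ge0.
rewrite ord1 -dot_delta Ephi (le_trans (dot_le _ _))//.
apply: norm_product_bound (mulmx_norm_le _ _) _ => //.
apply: le_trans (BP j t tcd) _; rewrite (le_trans (ler_norm _))//.
by rewrite (bigD1 j)//= lerDl sumr_ge0.
Qed.

(** Within a chart a zero spreads by [ac_uniqueness]; from one piece to the next it passes through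
    their common endpoint. *)
Lemma beta_nonzero : (exists2 t, a <= t <= b & beta t != 0) ->
  forall t, a <= t <= b -> beta t != 0.
Proof.
move=> [t1 t1ab nz] t tab; apply/negP => /eqP zt; move/eqP: nz; apply.
suff : forall c d, c = a -> d = b -> (exists2 t, c <= t <= d & beta t = 0) ->
    forall t, c <= t <= d -> beta t = 0.
  by move=> /(_ a b erefl erefl); apply => //; exists t.
move=> _ _ -> ->; have [[cg gA] _] := gamma_hor.
apply: (chart_ind (ltW ab) cg (P := fun c d => (exists2 t, c <= t <= d & beta t = 0) ->
    forall t, c <= t <= d -> beta t = 0)) => [c d e _ cd de _ Pcd Pde [s /andP[cs se] zs]|].
  have zd : beta d = 0.
    have [sd|ds] := leP s d; first by apply: Pcd; rewrite ?cd ?lexx//; exists s; rewrite ?cs.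
    by apply: Pde; rewrite ?de ?lexx//; exists s; rewrite // (ltW ds).
  move=> r /andP[cr re]; have [rd|dr] := leP r d.
    by apply: Pcd; rewrite ?cr//; exists d; rewrite ?cd ?lexx.
  by apply: Pde; rewrite ?re ?(ltW dr)//; exists d; rewrite ?de ?lexx.
move=> phi aphi c d ac cd db dphi [s scd zs] r rcd.
have [xA _] := gA _ aphi _ _ ac cd db dphi; have pA := beta_ac aphi ac cd db dphi.
have [K _ KP] := covector_equation_bound aphi ac cd db dphi.
have z0 u : c <= u <= d -> (cov_coord phi gamma beta u == 0) = (beta u == 0).
  by move=> ucd; apply: (ccoord_eq0 _ aphi); exact: dphi.
apply/eqP; rewrite -z0//; apply/eqP.
apply: (ac_uniqueness (K := K) cd pA xA) => //.
  by apply: ae_onS KP => u _ + _ _.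
by exists s => //; apply/eqP; rewrite z0// zs.
Qed.

Lemma equations_abnormal (S : subRiemannian Q) : hdistr S = H ->
  (exists2 t, a <= t <= b & beta t != 0) -> abnormal_curve S a b gamma.
Proof.
move=> SH nz; have [[cg gA] _] := gamma_hor.
pose lam t : cotangent_bundle Q := (gamma t, beta t).
exists lam => //; split; rewrite ?SH //; last 2 first.
- exact: beta_nonzero.
- have G := ae_onI (ae_regular_horizontal ab gamma_hor beta_ac) ae_covector_equation.
  apply: ae_onS G => t tab [[_ [_ dx dp] vH] E].
  have hx := (center_hor H_conn (gamma t) (velocity gamma t)).2 vH.
  exact: (@abnormal_covector_equation _ _ _ _ _ pi_sub H_conn lam t (beta_ann tab) dx dp hx).2 E.
split => // phi aphi c d ac cd db dphi.
have [xA xL] := gA _ aphi _ _ ac cd db dphi; have pA := beta_ac aphi ac cd db dphi.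
split.
  apply: (ac_dom (K := 1) _ xA pA) => s t _ _ _; rewrite mul1r prod_normE /=.
  by rewrite ge_max lerDl lerDr !normr_ge0.
have [K K0 KP] := covector_equation_bound aphi ac cd db dphi.
have [L L0 LP] := ac_bounded cd pA.
(* As [L] bounds the components of the covector on the piece, the linear estimate becomes |p'| <= K
   L |x'|. *)
apply: (L2_derivative_pair (C := K * L) cd xA pA xL).
apply: ae_onS KP => t tcd E _ _; apply: (le_trans E).
by rewrite mulrAC ler_wpM2r// ler_wpM2l//; exact: LP.
Qed.

End TransportToAbnormal.

Theorem corollary2p13 (R : realType) (Q M : manifold R) (pi : Q -> M)
    (pi_submersion : surjective_submersion pi)
    (H : Q -> {vspace tangent R Q})
    (H_connection : ehresmann_connection pi H)
    (S : subRiemannian Q) (S_distribution : hdistr S = H)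
    (a b : R) (ab : a < b) (gamma : R -> Q)
    (gamma_horizontal : horizontal_curve H a b gamma) :
  abnormal_curve S a b gamma <->
  exists beta : R -> cotangent R Q,
    [/\ (forall t, a <= t <= b -> Ann H (gamma t) (beta t)),
        ac_covector_along a b gamma beta,
        (exists2 t, a <= t <= b & beta t != 0),
        cotransport_along pi H a b gamma beta (fun=> 0)
      & ae_on a b (fun t => forall u : tangent R M,
          covector_curvature pi H (gamma t) (beta t)
            (velocity (pi \o gamma) t) u = 0)].
Proof.
split=> [A|[beta [bH bA nz T C]]].
  have [beta [bH bA nz [T C]]] := abnormal_equations pi_submersion H_connection ab
    gamma_horizontal S_distribution A.
  by exists beta.
exact: (equations_abnormal pi_submersion H_connection ab gamma_horizontal bH bA
  (conj T C) S_distribution nz).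
Qed.
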